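(* Let $\Omega\subset\mathbb R^N$ be a bounded open set. Let $j:\Omega\times\mathbb R\to\mathbb R$ be measurable in the first component and lower semicontinuous in the second one, and such that $$a(x)-c|s|^2\le j(x,s)$$ for suitable $c\ge0$ and $a\in L^1(\Omega)$. Let $\psi:\mathbb R\to[0,\infty]$ be a proper convex lower semicontinuous function with $\mathrm{dom}(\psi)\subset[0,\infty)$ not reduced to a point, such that $\lim_{s\to\infty}\psi(s)/s=\infty$. Then, for every $f\in H^{-1}(\Omega)$, the problem $$\min\int_\Omega\big(j(x,u)+\psi(m)\big)\,dx\quad\text{subject to}\quad\begin{cases}-\Delta u+m\,u=f\ \text{ in }\Omega\\ u\in H^1_0(\Omega),\quad m\in L^1(\Omega),\quad m\ge0\ \text{ a.e. in }\Omega\end{cases}$$ has at least one solution $\hat m\in L^1(\Omega)$.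
   Context: $\mathrm{dom}(\psi)=\{s\in\mathbb R:\psi(s)<\infty\}$. The state equation is understood in the variational sense: $u\in H^1_0(\Omega)\cap L^2_m(\Omega)$ and $\int_\Omega(\nabla u\cdot\nabla v+muv)\,dx=\langle f,v\rangle$ for all $v\in H^1_0(\Omega)\cap L^2_m(\Omega)$, where $L^2_m(\Omega)$ is the space of measurable $v$ with $\int_\Omega m v^2\,dx<\infty$. For each $m$ it has a unique solution $u$. A solution $\hat m$ of the problem is an admissible $m$ which, together with its associated state $u$, attains the minimum. *)

(* Defs.v *)
From HB Require Import structures.
From mathcomp Require Import all_boot all_order all_algebra.
From mathcomp Require Import all_classical all_reals all_analysis.
From mathcomp Require Import measurable_realfun.

Set Implicit Arguments.
Unset Strict Implicit.
Unset Printing Implicit Defensive.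

Import Order.TTheory GRing.Theory Num.Theory.
Import numFieldNormedType.Exports.

Local Open Scope classical_set_scope.
Local Open Scope ring_scope.

(* Row vectors carry the sigma-algebra generated by the coordinates, as
   n.-tuple T does in the library; for T = R this is the Borel sigma-algebra. *)
Section measurable_row.
Context {d} {T : measurableType d}.
Variable n : nat.

Let coors : 'I_n -> 'rV[T]_n -> T := fun i v => v ord0 i.

Let row_set0 : g_sigma_preimage coors set0.
Proof. exact: sigma_algebra0. Qed.

Let row_setC A : g_sigma_preimage coors A -> g_sigma_preimage coors (~` A).
Proof. exact: sigma_algebraC. Qed.

Let row_bigcup (F : _^nat) : (forall i, g_sigma_preimage coors (F i)) ->
  g_sigma_preimage coors (\bigcup_i (F i)).
Proof. exact: sigma_algebra_bigcup. Qed.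

HB.instance Definition _ := @isMeasurable.Build (measure_tuple_display d)
  'rV[T]_n (g_sigma_preimage coors) row_set0 row_setC row_bigcup.

End measurable_row.

Lemma measurable_row_coord d (T : measurableType d) n (i : 'I_n) :
  measurable_fun [set: 'rV[T]_n] (fun v : 'rV[T]_n => v ord0 i).
Proof.
move=> _ Y mY; rewrite setTI; apply: sub_sigma_algebra => /=.
rewrite -bigcup_seq/=; exists i => /=; first by rewrite mem_index_enum.
by exists Y => //; rewrite setTI.
Qed.

Lemma measurable_fun_row d1 d2 (T1 : measurableType d1)
    (T2 : measurableType d2) n (f : T1 -> 'rV[T2]_n) :
  (forall i, measurable_fun [set: T1] (fun x => f x ord0 i)) ->
  measurable_fun [set: T1] f.
Proof.
move=> mf; suff: g_sigma_preimage (fun i x => f x ord0 i) `<=` measurable.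
  rewrite (_ : (fun i x => _) =
               (fun i => (fun v : 'rV[T2]_n => v ord0 i) \o f))//.
  rewrite (@g_sigma_preimage_comp _ _ _ ('rV[T2]_n)) => prefS _ A mA.
  by apply: prefS; exists A.
apply: smallest_sub; first exact: sigma_algebra_measurable.
case: n => [|n] in f mf *; first by rewrite big_ord0.
rewrite -bigcup_mkord_ord; apply: bigcup_sub => i Ii.
by move=> A [B mB <-]; exact: mf.
Qed.

Section lebesgue_row.
Context {R : realType}.

Definition row_cons n (p : R * 'rV[R]_n) : 'rV[R]_n.+1 :=
  \row_i oapp (p.2 ord0) p.1 (unlift ord0 i).

Lemma measurable_row_cons n :
  measurable_fun [set: R * 'rV[R]_n] (@row_cons n).
Proof.
apply: measurable_fun_row => i.
rewrite (_ : (fun x => _) = fun p : R * 'rV[R]_n =>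
   oapp (p.2 ord0) p.1 (unlift ord0 i)); last by apply/funext => p; rewrite mxE.
case: (unliftP ord0 i) => [j|] _ /=.
  exact: (measurableT_comp (@measurable_row_coord _ R n j)).
exact: measurable_fst.
Qed.

Let uncons n (v : 'rV[R]_n.+1) : R * 'rV[R]_n :=
  (v ord0 ord0, \row_j v ord0 (lift ord0 j)).

Let row_consK n : cancel (@row_cons n) (@uncons n).
Proof.
move=> [a v]; rewrite /uncons /row_cons; congr pair.
  by rewrite mxE unlift_none.
by apply/rowP => j; rewrite !mxE liftK.
Qed.

Let unconsK n : cancel (@uncons n) (@row_cons n).
Proof.
move=> v; apply/rowP => i; rewrite mxE/=.
by case: (unliftP ord0 i) => [j ->|->]/=; rewrite ?mxE.
Qed.

Let measurable_uncons n : measurable_fun [set: 'rV[R]_n.+1] (@uncons n).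
Proof.
apply: measurable_fun_pair; first exact: measurable_row_coord.
apply: measurable_fun_row => i.
rewrite (_ : (fun x => _) = fun v : 'rV[R]_n.+1 => v ord0 (lift ord0 i)).
  exact: measurable_row_coord.
by apply/funext => v /=; rewrite mxE.
Qed.

Section step.
Local Open Scope ereal_scope.
Variables (n : nat) (mu : {sigma_finite_measure set 'rV[R]_n -> \bar R}).

Definition row_product : set 'rV[R]_n.+1 -> \bar R :=
  pushforward (@lebesgue_measure R \x mu) (@row_cons n).

Let row_product0 : row_product set0 = 0.
Proof. by rewrite /row_product /pushforward preimage_set0 measure0. Qed.

Let row_product_ge0 A : 0 <= row_product A.
Proof. by rewrite /row_product /pushforward; exact: measure_ge0. Qed.

Let row_product_sigma_additive : semi_sigma_additive row_product.
Proof.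
move=> F mF tF mUF; rewrite /row_product /pushforward preimage_bigcup.
have mcons A : measurable A -> measurable (@row_cons n @^-1` A).
  by move=> mA; rewrite -[X in measurable X]setTI; exact: measurable_row_cons.
apply: measure_semi_sigma_additive.
- by move=> k; exact: mcons.
- apply/trivIsetP => /= i j _ _ ij; rewrite -preimage_setI.
  by move/trivIsetP : tF => /(_ _ _ _ _ ij) ->//; rewrite preimage_set0.
- by rewrite -preimage_bigcup; exact: mcons.
Qed.

HB.instance Definition _ := isMeasure.Build _ _ _
  row_product row_product0 row_product_ge0 row_product_sigma_additive.

Let row_product_sigma_finite : sigma_finite setT row_product.
Proof.
have /sigma_finiteP[F [TF ndF Foo]] := sigma_finiteT (@lebesgue_measure R).
have /sigma_finiteP[G [TG ndG Goo]] := sigma_finiteT mu.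
exists (fun k => @uncons n @^-1` (F k `*` G k)).
  rewrite -preimage_bigcup predeqE => v; split => // _.
  have [k _ Fk] : (\bigcup_k F k) (uncons v).1 by rewrite -TF.
  have [l _ Gl] : (\bigcup_k G k) (uncons v).2 by rewrite -TG.
  exists (maxn k l) => //; split.
  - by move: Fk; exact/subsetPset/ndF/leq_maxl.
  - by move: Gl; exact/subsetPset/ndG/leq_maxr.
move=> k; have [mF Fk] := Foo k; have [mG Gk] := Goo k; split.
  by rewrite -[X in measurable X]setTI; apply: measurable_uncons => //;
     exact: measurableX.
rewrite /row_product /pushforward -comp_preimage.
rewrite (_ : _ \o _ = id); last by apply/funext => p /=; exact: row_consK.
by rewrite preimage_id product_measure1E// lte_mul_pinfty// ge0_fin_numE.
Qed.

HB.instance Definition _ := Measure_isSigmaFinite.Build _ _ _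
  row_product row_product_sigma_finite.

End step.

(* N-dimensional Lebesgue measure (on Borel sets), as an iterated product of
   the one-dimensional one *)
Fixpoint lebesgue_row n : {sigma_finite_measure set 'rV[R]_n -> \bar R} :=
  match n with
  | 0%N => \d_(0 : 'rV[R]_0)
  | m.+1 => @row_product m (lebesgue_row m)
  end.

Lemma lebesgue_row_box n (a b : 'rV[R]_n) :
  (forall i, a ord0 i <= b ord0 i) ->
  lebesgue_row n
    [set v : 'rV[R]_n | forall i, a ord0 i <= v ord0 i <= b ord0 i] =
  (\prod_(i < n) (b ord0 i - a ord0 i))%:E.
Proof.
elim: n => [|n IHn] in a b *.
  move=> _; rewrite big_ord0 /= diracE.
  by rewrite mem_set//= => -[].
move=> ab; rewrite big_ord_recl EFinM /= /row_product /pushforward.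
have -> : @row_cons n @^-1`
    [set v : 'rV[R]_n.+1 | forall i, a ord0 i <= v ord0 i <= b ord0 i] =
  `[a ord0 ord0, b ord0 ord0] `*`
    [set v : 'rV[R]_n | forall i,
      (uncons a).2 ord0 i <= v ord0 i <= (uncons b).2 ord0 i].
  apply/seteqP; split => [[x v] /= h|[x v] /= [h1 h2] i].
    split; first by have := h ord0; rewrite mxE unlift_none/= in_itv.
    by move=> i; have := h (lift ord0 i); rewrite !mxE liftK.
  rewrite mxE; case: (unliftP ord0 i) => [k ->|->] /=.
    by have := h2 k; rewrite !mxE.
  by move: h1; rewrite in_itv.
rewrite product_measure1E//.
- rewrite IHn; last by move=> i; rewrite !mxE.
  congr (_ * _)%E.
    apply: etrans; first exact: lebesgue_measure_itv.
    rewrite /= lte_fin; have := ab ord0; rewrite le_eqVlt => /predU1P[->|->] //.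
    by rewrite ltxx subrr.
  by congr EFin; apply: eq_bigr => i _; rewrite !mxE.
- rewrite (_ : mkset _ = \bigcap_(i in [set: 'I_n])
    [set v : 'rV[R]_n |
      (uncons a).2 ord0 i <= v ord0 i <= (uncons b).2 ord0 i]).
    apply: fin_bigcap_measurable => // i _.
    have := @measurable_row_coord _ R n i measurableT
      `[(uncons a).2 ord0 i, (uncons b).2 ord0 i]%classic.
    by rewrite setTI; apply; exact: measurable_itv.
  by apply/seteqP; split => v /= h i; [move=> _; exact: h|exact: h].
Qed.

End lebesgue_row.

Section upper_integral.
Local Open Scope ereal_scope.
Context {d} {T : measurableType d} {R : realType}.
Variables (mu : {measure set T -> \bar R}) (D : set T).

(* The library's \int only makes sense for Borel measurable integrands.  A
   function j(x, s) that is (Lebesgue) measurable in x for each s and lower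
   semicontinuous in s need not give a measurable x |-> j(x, u(x)), so the cost
   functional is defined by the upper integral, which is the integral as soon as
   the integrand is a.e. equal to a Borel function: upper_integralE. *)
Definition upper_integral (f : T -> \bar R) : \bar R :=
  ereal_inf [set \int[mu]_(x in D) g x | g in
    [set g : T -> \bar R | measurable_fun D g /\
                           {ae mu, forall x, D x -> f x <= g x}]].

Lemma ae_le_integral (f g : T -> \bar R) : measurable D ->
  measurable_fun D f -> measurable_fun D g ->
  {ae mu, forall x, D x -> f x <= g x} ->
  \int[mu]_(x in D) f x <= \int[mu]_(x in D) g x.
Proof.
move=> mD mf mg fg; rewrite [leLHS]integralE [leRHS]integralE; apply: leeB.
- apply: ae_ge0_le_integral => //.
  + exact: measurable_funepos.
  + exact: measurable_funepos.
  + apply: filterS fg => x fg Dx; rewrite !funeposE.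
    by rewrite ge_max !le_max fg//= lexx orbT.
- apply: ae_ge0_le_integral => //.
  + exact: measurable_funeneg.
  + exact: measurable_funeneg.
  + apply: filterS fg => x fg Dx; rewrite !funenegE.
    by rewrite ge_max !le_max leeN2 fg//= lexx orbT.
Qed.

Lemma upper_integralE (f g : T -> \bar R) : measurable D ->
  measurable_fun D g -> {ae mu, forall x, D x -> f x = g x} ->
  upper_integral f = \int[mu]_(x in D) g x.
Proof.
move=> mD mg fg; apply/eqP; rewrite eq_le; apply/andP; split.
  apply: ereal_inf_lbound; exists g => //; split => //.
  by apply: filterS fg => x fg Dx; rewrite fg.
apply: le_ereal_inf_tmp => _ [h [mh fh] <-]; apply: ae_le_integral => //.
by apply: filterS2 fg fh => x fg fh Dx; rewrite -fg// fh.
Qed.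

End upper_integral.

Section sobolev.
Context {R : realType} {N : nat}.
Local Notation V := 'rV[R]_N.
Local Notation leb := (@lebesgue_row R N).
Implicit Types (Om : set V) (u v phi m : V -> R) (g h : 'I_N -> V -> R).

Definition partial (i : 'I_N) phi : V -> R :=
  fun x => 'D_(delta_mx ord0 i) phi x.

Definition iter_partial (s : seq 'I_N) phi : V -> R := foldr partial phi s.

(* C^infinity: all iterated partial derivatives exist and are continuous *)
Definition smooth phi := forall s : seq 'I_N,
  continuous (iter_partial s phi) /\
  forall i x, derivable (iter_partial s phi) x (delta_mx ord0 i).

Definition test_function Om phi :=
  [/\ smooth phi, compact (closure [set x | phi x != 0]) &
      closure [set x | phi x != 0] `<=` Om].

(* Elements of L^1, L^2, H^1 are represented by Borel functions on R^N of which
   only the values on Om matter; every Lebesgue class has such a representative. *)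
Definition inL1 Om u := leb.-integrable Om (EFin \o u).

Definition inL2 Om u :=
  measurable_fun Om u /\ leb.-integrable Om (fun x => (u x ^+ 2)%:E).

Definition weak_gradient Om u g := forall phi, test_function Om phi ->
  forall i, (\int[leb]_(x in Om) (u x * partial i phi x)%:E =
             - \int[leb]_(x in Om) (g i x * phi x)%:E)%E.

(* u belongs to H^1(Om) and its gradient is g *)
Definition inH1 Om u g :=
  [/\ inL2 Om u, forall i, inL2 Om (g i) & weak_gradient Om u g].

Definition H1sqnorm Om u g : \bar R :=
  (\int[leb]_(x in Om) (u x ^+ 2)%:E +
   \sum_(i < N) \int[leb]_(x in Om) (g i x ^+ 2)%:E)%E.

Definition H1norm Om u g : R := Num.sqrt (fine (H1sqnorm Om u g)).

(* u belongs to H^1_0(Om), the closure of the test functions in H^1(Om), and its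
   gradient is g *)
Definition inH10 Om u g := inH1 Om u g /\
  exists phi_ : nat -> V -> R, (forall n, test_function Om (phi_ n)) /\
    H1sqnorm Om (phi_ n \- u) (fun i => partial i (phi_ n) \- g i)
      @[n --> \oo] --> 0%E.

(* F is a bounded linear functional on H^1_0(Om); since it is bounded, it only
   depends on the a.e. class in Om of its argument *)
Definition inHminus1 Om (F : (V -> R) -> R) :=
  (forall (a : R) u v g h, inH10 Om u g -> inH10 Om v h ->
     F (fun x => a * u x + v x) = a * F u + F v) /\
  exists C : R, forall u g, inH10 Om u g -> `|F u| <= C * H1norm Om u g.

(* L^2_m(Om) *)
Definition inL2w Om m v := measurable_fun Om v /\
  (\int[leb]_(x in Om) (m x * v x ^+ 2)%:E < +oo)%E.

(* u is a variational solution of - Delta u + m u = F, u in H^1_0(Om) *)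
Definition state Om F m u := exists g,
  [/\ inH10 Om u g, inL2w Om m u &
    forall v h, inH10 Om v h -> inL2w Om m v ->
      (\int[leb]_(x in Om)
         (\sum_(i < N) g i x * h i x + m x * u x * v x)%:E = (F v)%:E)%E].

Definition admissible Om m :=
  inL1 Om m /\ {ae leb, forall x, Om x -> 0 <= m x}.

Definition cost Om (j : V -> R -> R) (psi : R -> \bar R) m u : \bar R :=
  upper_integral leb Om (fun x => (j x (u x))%:E + psi (m x))%E.

Definition solution Om F j psi m :=
  admissible Om m /\ exists2 u, state Om F m u &
    forall m' u', admissible Om m' -> state Om F m' u' ->
      (cost Om j psi m u <= cost Om j psi m' u')%E.

Definition lebesgue_measurable_fun Om (w : V -> R) := forall B : set R,
  measurable B -> completed_algebra_gen leb (Om `&` w @^-1` B).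

End sobolev.

Section extended_functions.
Context {R : realType}.
Implicit Types psi : R -> \bar R.

Definition edom psi : set R := [set s | (psi s < +oo)%E].

Definition eproper psi :=
  (forall s, (-oo < psi s)%E) /\ exists s, (psi s < +oo)%E.

Definition econvex psi := forall (t x y : R), 0 <= t <= 1 ->
  (psi (t * x + (1 - t) * y)%R <= t%:E * psi x + (1 - t)%R%:E * psi y)%E.

End extended_functions.

(* Main.v *)
Require Import Defs.
From HB Require Import structures.
From mathcomp Require Import all_boot all_order all_algebra.
From mathcomp Require Import all_classical all_reals all_analysis.
From mathcomp Require Import measurable_realfun.
From mathcomp Require Import ring lra.

Set Implicit Arguments.
Unset Strict Implicit.
Unset Printing Implicit Defensive.

Import Order.TTheory GRing.Theory Num.Theory.
Import numFieldNormedType.Exports.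

Local Open Scope classical_set_scope.
Local Open Scope ring_scope.

(* Direct method.  Testing the state equation with u itself bounds, along a minimizing
   sequence, u_n in H^1_0 and m_n u_n^2 in L^1; by Rellich u_n converges to some u in
   L^2 and a.e.  Instead of a weak L^1 limit of m_n, one takes convex combinations of
   the tails of (m_n) and of the gradients, with the same weights: minimizing a
   strictly convex functional over such combinations makes them converge, a.e. for m
   and in L^2 for the gradients.  Since u_n -> u a.e., the combinations of m_n u_n v
   converge a.e. to m u v, and in L^1 by Vitali's theorem: m_n |u_n| is at most
   d m_n u_n^2 + m_n / (4 d), where m_n is uniformly integrable because psi is
   superlinear and psi(m_n) is bounded in L^1.  So u is the state of m, first against
   bounded test functions and then, by truncation, against all of them.  By convexity
   of psi and lower semicontinuity of j and psi, the cost of (m, u) is controlled by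
   Fatou's lemma. *)

(** The cost is an upper integral, and its integrand need not be measurable. Each near-optimal pair
    therefore comes with an integrable majorant [G_ n] of its integrand ([cost_majorant]), and the
    limit is taken on the nonnegative functions [G_ n - (a - c u_n^2)], which dominate [psi (m_n)].
    For the limit pair, exhibiting one measurable majorant with small integral is enough.

    The equation is averaged as a whole, which is why [m] and the gradients need common weights. The
    product [m_n u_n] survives the averaging because [u_n] converges pointwise: averages of
    [m_n w_n] with [w_n -> w] behave like [w] times the averages of [m_n].

    The space [L^2_m] of test functions changes with [m]. A bounded [v] lies in all of them, so it
    can be tested in every equation at once; this is why bounded tests come first.

    The functional that selects the combinations sees [m] through [1 / (1 + m)], which is bounded
    and strictly convex on the half-line. No bound on [m_n] is asked at that stage; the [L^1] bound
    only serves afterwards to keep the limit finite. *)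

Section liminf.
Context {R : realType}.
Local Open Scope ereal_scope.

Lemma limn_einf_ge (u : nat -> \bar R) a :
  (\forall n \near \oo, a <= u n) -> a <= limn_einf u.
Proof.
move=> [N _ Nu]; rewrite limn_einf_lim; apply: lime_ge; first exact: is_cvg_einfs.
exists N => // n Nn; apply: le_ereal_inf_tmp => _ [k /= nk <-].
by apply: Nu => /=; exact: leq_trans nk.
Qed.

Lemma limn_einf_le (u : nat -> \bar R) a :
  (\forall n \near \oo, u n <= a) -> limn_einf u <= a.
Proof.
move=> [N _ Nu]; rewrite limn_einf_lim; apply: lime_le; first exact: is_cvg_einfs.
exists N => // n Nn; apply: ge_ereal_inf; exists (u n); first by exists n => //=.
exact: Nu.
Qed.

End liminf.

(** * Integrals of real functions *)

Section integral_toolkit.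
Context d {T : measurableType d} {R : realType}.
Variables (mu : {measure set T -> \bar R}) (D : set T).
Hypothesis mD : measurable D.
Implicit Types (f g h : T -> R).

Definition rintegrable f := mu.-integrable D (EFin \o f).

Local Notation I f := (Rintegral mu D f).
Local Notation "'aeD' x , P" := {ae mu, forall x, D x -> P}
  (at level 200, x name).

Lemma rintegrable_measurable f : rintegrable f -> measurable_fun D f.
Proof. by move/measurable_int/measurable_EFinP. Qed.

Lemma EFin_Rintegral f : rintegrable f ->
  (\int[mu]_(x in D) (f x)%:E = (I f)%:E)%E.
Proof. by move=> fi; rewrite fineK//; exact: integrable_fin_num. Qed.

Lemma rintegrable0 : rintegrable (fun=> 0).
Proof. exact: integrable0. Qed.

Lemma rintegrableD f g : rintegrable f -> rintegrable g ->
  rintegrable (fun x => f x + g x).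
Proof. by move=> fi gi; exact: (integrableD mD fi gi). Qed.

Lemma rintegrableB f g : rintegrable f -> rintegrable g ->
  rintegrable (fun x => f x - g x).
Proof. by move=> fi gi; exact: (integrableB mD fi gi). Qed.

Lemma rintegrableZ k f : rintegrable f -> rintegrable (fun x => k * f x).
Proof. by move=> fi; exact: (integrableZl mD k fi). Qed.

Lemma rintegrable_sum (J : Type) (s : seq J) (f : J -> T -> R) :
  (forall i, rintegrable (f i)) -> rintegrable (fun x => \sum_(i <- s) f i x).
Proof.
move=> fi; elim: s => [|i s IH].
  by under eq_fun do rewrite big_nil; exact: rintegrable0.
by under eq_fun do rewrite big_cons; exact: rintegrableD.
Qed.

Lemma Rintegral_sum (J : Type) (s : seq J) (f : J -> T -> R) :
  (forall i, rintegrable (f i)) ->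
  I (fun x => \sum_(i <- s) f i x) = \sum_(i <- s) I (f i).
Proof.
move=> fi; elim: s => [|i s IH].
  rewrite big_nil -[RHS](mul0r (fine (mu D))) -Rintegral_cst//.
  by apply: eq_Rintegral => x _; rewrite big_nil.
rewrite big_cons -IH -RintegralD//; [|exact: fi|exact: rintegrable_sum].
by apply: eq_Rintegral => x _; rewrite big_cons.
Qed.

Lemma ae_le_Rintegral f g : rintegrable f -> rintegrable g ->
  (aeD x, f x <= g x) -> I f <= I g.
Proof.
move=> fi gi fg; rewrite -lee_fin -!EFin_Rintegral//.
by apply: ae_le_integral => //; [exact: measurable_int fi|exact: measurable_int gi].
Qed.

(** Dominated convergence for the constant sequence [f]: it accepts a bound that holds only a.e. and
    returns integrability. *)
Lemma ae_le_rintegrable f g : measurable_fun D f -> rintegrable g ->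
  (aeD x, `|f x| <= g x) -> rintegrable f.
Proof.
move=> mf gi fg.
have mfE : measurable_fun D (EFin \o f) by exact/measurable_EFinP.
have fgE : {ae mu, forall x (n : nat), D x -> (`|(EFin \o f) x| <= (EFin \o g) x)%E}.
  by apply: filterS fg => x fg n Dx /=; rewrite lee_fin fg.
have ff : {ae mu, forall x, D x -> (EFin \o f) x @[_ --> \oo] --> (EFin \o f) x}.
  by apply: aeW => x _; exact: cvg_cst.
by have [] := @dominated_convergence _ _ _ mu D mD (fun=> EFin \o f)
    (EFin \o f) (EFin \o g) (fun=> mfE) mfE ff gi fgE.
Qed.

Lemma ae_Rintegral_ge0 f : rintegrable f -> (aeD x, 0 <= f x) -> 0 <= I f.
Proof.
move=> fi f0; have <- : I (fun=> 0) = 0 by rewrite Rintegral_cst ?mul0r.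
exact: ae_le_Rintegral rintegrable0 fi f0.
Qed.

Lemma dominated_Rintegral (f_ : nat -> T -> R) f g :
  (forall n, measurable_fun D (f_ n)) -> measurable_fun D f -> rintegrable g ->
  (aeD x, f_ n x @[n --> \oo] --> f x) ->
  (aeD x, forall n, `|f_ n x| <= g x) ->
  rintegrable f /\ I (f_ n) @[n --> \oo] --> I f.
Proof.
move=> mf_ mf gi ff fg.
have fi n : rintegrable (f_ n).
  by apply: (ae_le_rintegrable (mf_ n) gi); apply: filterS fg => x fg Dx; exact: fg.
have mfE_ n : measurable_fun D (EFin \o f_ n) by exact/measurable_EFinP.
have mfE : measurable_fun D (EFin \o f) by exact/measurable_EFinP.
have fgE : {ae mu, forall x (n : nat), D x -> (`|(EFin \o f_ n) x| <= (EFin \o g) x)%E}.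
  by apply: filterS fg => x fg n Dx /=; rewrite lee_fin fg.
have ffE : {ae mu, forall x, D x -> (EFin \o f_ n) x @[n --> \oo] --> (EFin \o f) x}.
  by apply: filterS ff => x ff Dx; apply: cvg_EFin => //; [exact: nearW|exact: ff].
have [if_ _ If] := @dominated_convergence _ _ _ mu D mD (fun n => EFin \o f_ n)
    (EFin \o f) (EFin \o g) mfE_ mfE ffE gi fgE.
split => //; apply: (@fine_cvg _ _ _ _ _ (I f)).
by rewrite -EFin_Rintegral.
Qed.

(** The truncation at [0] supplies the nonnegativity everywhere that Fatou's lemma asks for, while
    [f_ n] is nonnegative only a.e. The bound on the integrals is asymptotic, so that [c] may be the
    limit of the bounds known for each [n]. *)
Lemma ae_fatou (f_ : nat -> T -> R) (c : R) :
  (forall n, rintegrable (f_ n)) -> (forall n, aeD x, 0 <= f_ n x) ->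
  (forall e, 0 < e -> \forall n \near \oo, I (f_ n) <= c + e) ->
  (\int[mu]_(x in D) limn_einf (fun n => (Num.max 0 (f_ n x))%:E) <= c%:E)%E.
Proof.
move=> fi f0 Ic; apply: le_trans (fatou _ _ _ _) _ => //.
- move=> n; apply/measurable_EFinP; apply: measurable_maxr => //.
  exact: rintegrable_measurable.
- by move=> n x _; rewrite lee_fin le_max lexx.
apply/lee_addgt0Pr => e e0; apply: limn_einf_le.
apply: filterS (Ic e e0) => n; rewrite -lee_fin EFinD; apply: le_trans.
rewrite -EFin_Rintegral//; apply: ae_le_integral => //.
- apply/measurable_EFinP; apply: measurable_maxr => //.
  exact: rintegrable_measurable.
- exact: measurable_int (fi n).
by apply: filterS (f0 n) => x fx Dx; rewrite lee_fin ge_max lexx fx.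
Qed.

(** Integrability of the limit is part of the conclusion: where the sequence converges, the lower
    limit of [ae_fatou] is [f], and its integral is finite. *)
Lemma cvg_fatou (f_ : nat -> T -> R) f (c : R) :
  (forall n, rintegrable (f_ n)) -> (forall n, aeD x, 0 <= f_ n x) ->
  measurable_fun D f -> (aeD x, f_ n x @[n --> \oo] --> f x) ->
  (forall e, 0 < e -> \forall n \near \oo, I (f_ n) <= c + e) ->
  rintegrable f /\ I f <= c.
Proof.
move=> fi f0 mf ff Ic.
have f0' : aeD x, forall n, 0 <= f_ n x.
  have : {ae mu, forall x, forall n, D x -> 0 <= f_ n x} by exact/ae_foralln.
  by apply: filterS => x h Dx n; exact: h.
have fe : aeD x, limn_einf (fun n => (Num.max 0 (f_ n x))%:E) = (f x)%:E.
  apply: filterS2 f0' ff => x f0x ffx Dx; move: (f0x Dx) (ffx Dx) => {}f0x {}ffx.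
  have : (f_ n x)%:E @[n --> \oo] --> (f x)%:E.
    by apply: cvg_EFin => //; exact: nearW.
  move/cvg_limn_einf_sup => [<- _]; congr limn_einf.
  by apply/funext => n; congr EFin; apply/max_idPr.
have f0x : aeD x, 0 <= f x.
  apply: filterS2 f0' ff => x f0x ffx Dx; move: (f0x Dx) (ffx Dx) => {}f0x {}ffx.
  by rewrite -(cvg_lim _ ffx)//; apply: limr_ge; [exact: cvgP ffx|exact: nearW].
have ml : measurable_fun D (fun x => limn_einf (fun n => (Num.max 0 (f_ n x))%:E)).
  rewrite (_ : (fun x => _) = fun x => - limn_esup (fun n => (- Num.max 0 (f_ n x))%:E))%E.
    apply: measurableT_comp => //; apply: measurable_fun_limn_esup => n.
    apply/measurable_EFinP; apply: measurableT_comp => //.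
    by apply: measurable_maxr => //; exact: rintegrable_measurable.
  by [].
have := ae_fatou fi f0 Ic.
rewrite (ae_eq_integral (fun x => (f x)%:E)) //; last exact/measurable_EFinP.
move=> Ifc; have : rintegrable f.
  apply/integrableP; split; first exact/measurable_EFinP.
  rewrite (ae_eq_integral (fun x => (f x)%:E)) //; first exact: le_lt_trans Ifc (ltry _).
  - by apply: measurableT_comp => //; exact/measurable_EFinP.
  - exact/measurable_EFinP.
  - by apply: filterS f0x => x f0x Dx /=; rewrite ger0_norm ?f0x.
by move=> fi'; split => //; rewrite -lee_fin -EFin_Rintegral.
Qed.

End integral_toolkit.

(** * Extraction of subsequences *)

Section subsequences.
Context {R : realType}.

(** The property may depend on the stage [k], typically through an accuracy; the search for the next
    index starts just above the previous one. *)
Lemma extract (P : nat -> nat -> Prop) :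
  (forall k N, exists2 n, (N <= n)%N & P k n) ->
  exists s : nat -> nat, (forall k, (s k < s k.+1)%N) /\ forall k, P k (s k).
Proof.
move=> Pex.
have nxt k N : {n | (N <= n)%N /\ P k n} by apply: cid; have [n] := Pex k N; exists n.
pose s := fix s k := if k is k'.+1 then sval (nxt k (s k').+1) else sval (nxt 0 0).
exists s; split => [k|[|k]] /=; first by case: (nxt _ _) => ? [].
- by case: (nxt _ _) => ? [].
- by case: (nxt _ _) => ? [].
Qed.

Lemma extract_ge (s : nat -> nat) : (forall k, (s k < s k.+1)%N) ->
  forall k, (k <= s k)%N.
Proof. by move=> ss; elim=> // k IH; exact: leq_ltn_trans IH (ss k). Qed.

Lemma extract_cvg (s : nat -> nat) : (forall k, (s k < s k.+1)%N) ->
  s @ \oo --> \oo.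
Proof.
move=> ss; apply/cvgnyPge => A; exists A => // n /= An.
exact: leq_trans An (extract_ge ss n).
Qed.

Lemma cvg_sqr0 (u : nat -> R) : u n ^+ 2 @[n --> \oo] --> 0 -> u n @[n --> \oo] --> 0.
Proof.
move=> /cvgr0Pnorm_le u0; apply/cvgr0Pnorm_le => e e0.
apply: filterS (u0 (e ^+ 2) (exprn_gt0 _ e0)) => n.
by rewrite normrX ler_sqr ?nnegrE// ltW.
Qed.

End subsequences.

(** * The space L^2 *)

Section L2_toolkit.
Context d {T : measurableType d} {R : realType}.
Variables (mu : {measure set T -> \bar R}) (D : set T).
Hypothesis mD : measurable D.
Implicit Types (f g h : T -> R).

Local Notation rint f := (rintegrable mu D f).
Local Notation I f := (Rintegral mu D f).
Local Notation "'aeD' x , P" := {ae mu, forall x, D x -> P}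
  (at level 200, x name).

(** Measurability is a separate clause because that of the square does not give that of [f]. For
    [lebesgue_row] this unfolds to [inL2]. *)
Definition L2 f := measurable_fun D f /\ rint (fun x => f x ^+ 2).

Definition sqn f := I (fun x => f x ^+ 2).

Definition cvgL2 (f_ : nat -> T -> R) f :=
  sqn (fun x => f_ n x - f x) @[n --> \oo] --> 0.

Lemma L2_measurable f : L2 f -> measurable_fun D f. Proof. by case. Qed.

Lemma L2_sqr f : L2 f -> rint (fun x => f x ^+ 2). Proof. by case. Qed.

Lemma ae_le_L2 f g : measurable_fun D f -> L2 g -> (aeD x, `|f x| <= `|g x|) -> L2 f.
Proof.
move=> mf [mg ig] fg; split => //; apply: (ae_le_rintegrable mD _ ig).
  exact: measurable_funX.
apply: filterS fg => x fg Dx; rewrite normrX -[leRHS]real_normK ?num_real//.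
by rewrite ler_sqr ?nnegrE// fg.
Qed.

Lemma rint_cst (C : R) : (mu D < +oo)%E -> rint (fun=> C).
Proof.
move=> Doo; apply: measurable_bounded_integrable => //.
by exists `|C|; split => // M CM x _; exact: ltW.
Qed.

Lemma rint_bounded f C : (mu D < +oo)%E -> measurable_fun D f ->
  (aeD x, `|f x| <= C) -> rint f.
Proof.
move=> Doo mf fC; apply: (ae_le_rintegrable mD mf _ fC).
exact: rint_cst.
Qed.

Lemma L2_bounded f C : (mu D < +oo)%E -> measurable_fun D f ->
  (aeD x, `|f x| <= C) -> L2 f.
Proof.
move=> Doo mf fC; split => //; apply: (@rint_bounded _ (C ^+ 2)) => //.
  exact: measurable_funX.
apply: filterS fC => x fC Dx; rewrite normrX ler_sqr ?nnegrE// ?fC//.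
exact: le_trans (fC Dx).
Qed.

Lemma L2_mul f g : L2 f -> L2 g -> rint (fun x => f x * g x).
Proof.
move=> [mf fi] [mg gi]; apply: (ae_le_rintegrable mD _ (rintegrableD mD fi gi)).
  exact: measurable_funM.
apply: aeW => x _; rewrite normrM -[f x ^+ 2]real_normK ?num_real//.
rewrite -[g x ^+ 2]real_normK ?num_real//.
by have := normr_ge0 (f x); have := normr_ge0 (g x); nra.
Qed.

Lemma L2D f g : L2 f -> L2 g -> L2 (fun x => f x + g x).
Proof.
move=> [mf fi] [mg gi]; split; first exact: measurable_funD.
apply: (@ae_le_rintegrable _ _ _ _ _ mD _ (fun x => 2 * (f x ^+ 2 + g x ^+ 2))).
- by apply: measurable_funX; exact: measurable_funD.
- by apply: rintegrableZ => //; exact: rintegrableD.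
- by apply: aeW => x _; rewrite ger0_norm ?sqr_ge0//; have := sqr_ge0 (f x - g x); nra.
Qed.

Lemma L2Z k f : L2 f -> L2 (fun x => k * f x).
Proof.
move=> [mf fi]; split; first exact: measurable_funM.
under eq_fun do rewrite exprMn.
exact: rintegrableZ.
Qed.

Lemma L2B f g : L2 f -> L2 g -> L2 (fun x => f x - g x).
Proof.
move=> fi /(L2Z (-1)) gi.
by rewrite (_ : (fun x => _) = fun x => f x + (-1) * g x);
  [exact: L2D|apply/funext => x; rewrite mulN1r].
Qed.

Lemma L2_0 : L2 (fun=> 0).
Proof.
split; first exact: measurable_cst.
by under eq_fun do rewrite expr0n/=; exact: rintegrable0.
Qed.

Lemma L2_mul_bounded f g C : measurable_fun D f -> (aeD x, `|f x| <= C) ->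
  L2 g -> L2 (fun x => f x * g x).
Proof.
move=> mf fC gi; apply: (ae_le_L2 _ (L2Z C gi)).
  exact: measurable_funM (L2_measurable gi).
apply: filterS fC => x fC Dx; rewrite !normrM ler_wpM2r//.
by rewrite (le_trans (fC Dx))// ler_norm.
Qed.

Lemma sqn_ge0 f : 0 <= sqn f.
Proof. by apply: Rintegral_ge0 => x _; exact: sqr_ge0. Qed.

Lemma sqnN f g : sqn (fun x => f x - g x) = sqn (fun x => g x - f x).
Proof. by apply: eq_Rintegral => x _; rewrite -sqrrN opprB. Qed.

Lemma sqnDZ t f g : L2 f -> L2 g ->
  sqn (fun x => f x + t * g x) = sqn f + 2 * t * I (fun x => f x * g x) + t ^+ 2 * sqn g.
Proof.
move=> fi gi; have fgi := L2_mul fi gi.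
have [_ ffi] := fi; have [_ ggi] := gi.
have i1 := rintegrableZ mD (2 * t) fgi; have i2 := rintegrableZ mD (t ^+ 2) ggi.
rewrite -!RintegralZl// -RintegralD// -RintegralD//; last exact: rintegrableD.
by apply: eq_Rintegral => x _; ring.
Qed.

Lemma sqnZ k f : L2 f -> sqn (fun x => k * f x) = k ^+ 2 * sqn f.
Proof.
move=> [mf fi]; rewrite -RintegralZl//.
by apply: eq_Rintegral => x _; rewrite exprMn.
Qed.

Lemma ae_le_sqn f g : L2 f -> L2 g -> (aeD x, `|f x| <= `|g x|) -> sqn f <= sqn g.
Proof.
move=> [_ fi] [_ gi] fg; apply: ae_le_Rintegral => //.
apply: filterS fg => x fg Dx; rewrite -real_normK ?num_real// -[leRHS]real_normK ?num_real//.
by rewrite ler_sqr ?nnegrE// fg.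
Qed.

Lemma sqnD_le f g : L2 f -> L2 g ->
  sqn (fun x => f x + g x) <= 2 * sqn f + 2 * sqn g.
Proof.
move=> fi gi; have [_ ffi] := fi; have [_ ggi] := gi.
rewrite -!RintegralZl// -RintegralD//; [|exact: rintegrableZ|exact: rintegrableZ].
apply: le_Rintegral => //; first by case: (L2D fi gi).
  by apply: rintegrableD => //; exact: rintegrableZ.
by move=> x _; have := sqr_ge0 (f x - g x); nra.
Qed.

Lemma sqnB_le f g h : L2 f -> L2 g -> L2 h ->
  sqn (fun x => f x - g x) <=
  2 * sqn (fun x => f x - h x) + 2 * sqn (fun x => h x - g x).
Proof.
move=> fi gi hi; apply: le_trans (sqnD_le (L2B fi hi) (L2B hi gi)).
by rewrite le_eqVlt; apply/orP; left; apply/eqP/eq_Rintegral => x _; rewrite addrA subrK.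
Qed.

Lemma cauchy_schwarz f g : L2 f -> L2 g ->
  (I (fun x => f x * g x)) ^+ 2 <= sqn f * sqn g.
Proof.
move=> fi gi; set p := I _.
have H t : 0 <= sqn f + 2 * t * p + t ^+ 2 * sqn g by rewrite -sqnDZ// sqn_ge0.
have f0 := sqn_ge0 f; have := sqn_ge0 g; rewrite le_eqVlt => /predU1P[g0|g0].
  rewrite -g0 mulr0 in H *; case: (eqVneq p 0) => [->|p0]; first by rewrite expr0n.
  (* With [sqn g = 0] the quadratic is affine in [t], and this [t] would give it the value [-1]. *)
  have := H (- (sqn f + 1) / (2 * p)).
  rewrite (_ : 2 * _ * p = - (sqn f + 1)); last by field.
  by rewrite mulr0; lra.
have := mulr_ge0 (ltW g0) (H (- p / sqn g)).
rewrite (_ : _ * _ = sqn f * sqn g - p ^+ 2); last first.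
  by field; rewrite gt_eqF.
by lra.
Qed.

Lemma cvgL2_ip (f_ : nat -> T -> R) f g : (forall n, L2 (f_ n)) -> L2 f -> L2 g -> cvgL2 f_ f ->
  I (fun x => f_ n x * g x) @[n --> \oo] --> I (fun x => f x * g x).
Proof.
move=> fi_ fi gi ff; apply/subr_cvg0; apply: cvg_sqr0.
apply: (@squeeze_cvgr _ _ _ _ (fun=> 0) (fun n => sqn (fun x => f_ n x - f x) * sqn g)).
- apply: nearW => n; rewrite sqr_ge0/=.
  rewrite -RintegralB//; [|exact: L2_mul|exact: L2_mul].
  apply: le_trans (cauchy_schwarz (L2B (fi_ n) fi) gi).
  by under eq_Rintegral do rewrite -mulrBl.
- exact: cvg_cst.
- by rewrite -[X in _ --> X](mul0r (sqn g)); apply: cvgM => //; exact: cvg_cst.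
Qed.

(** Expanding the square of [f_ n - f] expresses [sqn (f_ n)] through an inner product with [f] and
    a vanishing term, so no square root or triangle inequality is involved. *)
Lemma cvgL2_sqn (f_ : nat -> T -> R) f : (forall n, L2 (f_ n)) -> L2 f -> cvgL2 f_ f ->
  sqn (f_ n) @[n --> \oo] --> sqn f.
Proof.
move=> fi_ fi ff.
have E n : sqn (f_ n) =
    2 * I (fun x => f_ n x * f x) + sqn (fun x => f_ n x - f x) - sqn f.
  have := sqnDZ (-1) (fi_ n) fi.
  rewrite (_ : sqn (fun x => _ + _) = sqn (fun x => f_ n x - f x)); first by lra.
  by apply: eq_Rintegral => x _; rewrite mulN1r.
rewrite (_ : (fun n => _) = fun n => 2 * I (fun x => f_ n x * f x) +
  sqn (fun x => f_ n x - f x) - sqn f); last exact/funext.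
rewrite [X in _ --> X](_ : _ = 2 * I (fun x => f x * f x) + 0 - sqn f); last first.
  by rewrite (_ : sqn f = I (fun x => f x * f x)) //; first by lra.
apply: cvgB; last exact: cvg_cst.
apply: cvgD => //; apply: cvgM; first exact: cvg_cst.
exact: cvgL2_ip.
Qed.

Lemma cvgL2_comp (f_ : nat -> T -> R) f (s : nat -> nat) : s @ \oo --> \oo ->
  cvgL2 f_ f -> cvgL2 (fun n => f_ (s n)) f.
Proof. by move=> soo ff; exact: (cvg_comp _ _ soo ff). Qed.

Lemma cvgL2_cauchy (f_ : nat -> T -> R) f : (forall n, L2 (f_ n)) -> L2 f -> cvgL2 f_ f ->
  forall e, 0 < e -> exists n0, forall n p, (n0 <= n)%N -> (n0 <= p)%N ->
  sqn (fun x => f_ n x - f_ p x) <= e.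
Proof.
move=> fi_ fi /cvgr0Pnorm_le ff e e0; have e4 : 0 < e / 4 by rewrite divr_gt0.
have [n0 _ n0P] := ff _ e4; exists n0 => n p /n0P/= nP /n0P/= pP.
apply: le_trans (sqnB_le (fi_ n) (fi_ p) fi) _.
rewrite (sqnN f (f_ p)); rewrite !ger0_norm ?sqn_ge0// in nP pP.
by lra.
Qed.

(* With squared increments below [8^-k], the series of [4^k (increment)^2] has
   finite integral, so a.e. the increments are [O(2^-k)]. *)
Lemma riesz_fischer (f_ : nat -> T -> R) : (forall n, L2 (f_ n)) ->
  (forall e, 0 < e -> exists n0, forall n p, (n0 <= n)%N -> (n0 <= p)%N ->
     sqn (fun x => f_ n x - f_ p x) <= e) ->
  exists f, [/\ L2 f, cvgL2 f_ f & exists s : nat -> nat,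
    (forall k, (s k < s k.+1)%N) /\ (aeD x, f_ (s k) x @[k --> \oo] --> f x)].
Proof.
move=> fi cf.
have [k N|s [ss sP]] := @extract (fun k n => forall p, (n <= p)%N ->
    sqn (fun x => f_ p x - f_ n x) <= 8^-1 ^+ k).
  have [|n0 n0P] := cf (8^-1 ^+ k); first by rewrite exprn_gt0// invr_gt0.
  exists (maxn n0 N); first exact: leq_maxr.
  move=> p; rewrite geq_max => /andP[n0p _]; apply: n0P => //; exact: leq_maxl.
pose dd k x := f_ (s k.+1) x - f_ (s k) x.
have di k : L2 (dd k) by exact: L2B.
pose S n x := \sum_(k < n) 4 ^+ k * dd k x ^+ 2.
have Si n : rint (S n).
  by apply: rintegrable_sum => // k; apply: rintegrableZ => //; case: (di k).
have S0 n x : 0 <= S n x.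
  by apply: sumr_ge0 => k _; rewrite mulr_ge0 ?sqr_ge0// exprn_ge0.
have IS n : I (S n) <= 2.
  rewrite Rintegral_sum//; last by move=> k; apply: rintegrableZ => //; case: (di k).
  apply: (@le_trans _ _ (\sum_(k < n) 2^-1 ^+ k)).
    apply: ler_sum => k _; rewrite RintegralZl//; last by case: (di k).
    rewrite (_ : 2^-1 ^+ k = 4 ^+ k * 8^-1 ^+ k); last first.
      by rewrite -exprMn; congr (_ ^+ _); field.
    by rewrite ler_pM2l ?exprn_gt0//; apply: sP; rewrite ltnW.
  have -> : \sum_(k < n) (2^-1 : R) ^+ k = 2 - 2 * 2^-1 ^+ n.
    elim: n => [|n IH]; first by rewrite big_ord0 expr0; lra.
    by rewrite big_ord_recr/= IH exprS; lra.
  by rewrite lerBlDr lerDl mulr_ge0// exprn_ge0// invr_ge0.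
(* The partial sums [S n] increase with [n] and their integrals stay below [2]; their lower limit is
   thus integrable, hence finite a.e., and bounds all of them. *)
have Sfin : aeD x, exists M, forall n, S n x <= M.
  have := @ae_fatou _ _ _ _ _ mD S 2 Si (fun n => aeW _ (fun x _ => S0 n x)).
  move=> /(_ _)/wrap[e e0|HS]; first by apply: nearW => n; have := IS n; lra.
  have mS : measurable_fun D (fun x => limn_einf (fun n => (Num.max 0 (S n x))%:E)).
    rewrite /limn_einf; apply: measurableT_comp => //.
    apply: measurable_fun_limn_esup => n.
    apply/measurable_EFinP; apply: measurableT_comp => //.
    by apply: measurable_maxr => //; exact: rintegrable_measurable (Si n).
  have L0 x : (0 <= limn_einf (fun n => (Num.max 0 (S n x))%:E))%E.
    by apply: limn_einf_ge; apply: nearW => n; rewrite lee_fin le_max lexx.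
  have /(integrable_ae mD) : mu.-integrable D
      (fun x => limn_einf (fun n => (Num.max 0 (S n x))%:E)).
    apply/integrableP; split => //; under eq_integral do rewrite gee0_abs//.
    exact: le_lt_trans HS (ltry _).
  apply: filterS => x Lfin Dx; exists (fine (limn_einf (fun n => (Num.max 0 (S n x))%:E))) => n.
  rewrite -lee_fin fineK ?Lfin//; apply: limn_einf_ge; exists n => // p /= np.
  rewrite lee_fin le_max; apply/orP; right.
  rewrite /S -(subnKC np) big_split_ord/= lerDl sumr_ge0// => k _.
  by rewrite mulr_ge0 ?sqr_ge0// exprn_ge0.
have fcv : aeD x, cvgn (fun k => f_ (s k) x).
  apply: filterS Sfin => x /[apply] -[M SM].
  (* One term of the sum gives [4 ^+ k * dd k x ^+ 2 <= M]. The factor [1 + M] stands in for the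
     square root of [M], as [M <= (1 + M) ^+ 2]. *)
  have dM k : `|dd k x| <= (1 + M) * 2^-1 ^+ k.
    have M0 : 0 <= M by rewrite (le_trans (S0 0%N x)).
    rewrite -ler_sqr ?nnegrE ?mulr_ge0 ?addr_ge0 ?exprn_ge0 ?invr_ge0//.
    rewrite real_normK ?num_real// -(@ler_pM2l _ (4 ^+ k)) ?exprn_gt0//.
    have E : 4 ^+ k * (2^-1 ^+ k) ^+ 2 = 1 :> R.
      rewrite -exprM mulnC exprM -exprMn (_ : 4 * 2^-1 ^+ 2 = 1) ?expr1n//.
      by field.
    rewrite [leRHS](_ : _ = (1 + M) ^+ 2); last by rewrite exprMn mulrCA E mulr1.
    apply: (@le_trans _ _ M); last by nra.
    apply: le_trans (SM k.+1); rewrite /S big_ord_recr/= lerDr.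
    exact: S0.
  have : cvgn (series (fun k => dd k x)).
    apply: normed_cvg; apply: (@series_le_cvg _ _ (geometric (1 + M) 2^-1)) => //.
    - by move=> k /=.
    - by move=> k; exact: le_trans (dM k).
    by apply: is_cvg_geometric_series; rewrite ger0_norm ?invr_ge0// invf_lt1// ltr1n.
  have -> : (fun k => f_ (s k) x) = (fun k => f_ (s 0%N) x + series (fun k => dd k x) k).
    apply/funext => k; rewrite /series/= (_ : \sum_(0 <= i < k) dd i x =
        f_ (s k) x - f_ (s 0%N) x); last first.
      exact: (telescope_sumr (fun i => f_ (s i) x) (leq0n k)).
    by rewrite addrC subrK.
  by move=> c; apply: is_cvgD => //; exact: is_cvg_cst.
(* The upper limit is a measurable choice of the limit, defined also on the null set where there is
   none. *)
pose f x := fine (limn_esup (fun k => (f_ (s k) x)%:E)).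
have mf : measurable_fun D f.
  apply: measurableT_comp => //; apply: measurable_fun_limn_esup => k.
  by apply/measurable_EFinP; case: (fi (s k)).
have ff : aeD x, f_ (s k) x @[k --> \oo] --> f x.
  apply: filterS fcv => x /[apply] /cvg_ex[l fl].
  have /cvg_limn_einf_sup[_ fE] : (f_ (s k) x)%:E @[k --> \oo] --> l%:E.
    by apply: cvg_EFin => //; exact: nearW.
  by rewrite /f fE.
(* Fatou's lemma in the second index of the Cauchy estimate: it gives at once that [f_ n - f] is
   square integrable and that its norm is small. *)
have key e n0 : (forall n p, (n0 <= n)%N -> (n0 <= p)%N ->
      sqn (fun x => f_ n x - f_ p x) <= e) -> forall n, (n0 <= n)%N ->
    rint (fun x => (f_ n x - f x) ^+ 2) /\ sqn (fun x => f_ n x - f x) <= e.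
  move=> n0P n n0n.
  apply: (@cvg_fatou _ _ _ _ _ mD (fun k x => (f_ n x - f_ (s k) x) ^+ 2)).
  - by move=> k; case: (L2B (fi n) (fi (s k))).
  - by move=> k; apply: aeW => x _; exact: sqr_ge0.
  - by apply: measurable_funX; apply: measurable_funB => //; case: (fi n).
  - apply: filterS ff => x /[apply] ff; apply: cvgM; apply: cvgB => //; exact: cvg_cst.
  - move=> e' e'0; exists n0 => // k /= n0k; apply: le_trans (n0P _ _ n0n _) _.
      exact: leq_trans n0k (extract_ge ss k).
    by lra.
have fL2 : L2 f.
  have [n0 n0P] := cf 1 ltr01; have [fi2 _] := key _ _ n0P n0 (leqnn _).
  have : L2 (fun x => f_ n0 x - (f_ n0 x - f x)).
    by apply: L2B => //; split => //; apply: measurable_funB => //; case: (fi n0).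
  by congr L2; apply/funext => x; rewrite subKr.
exists f; split => //; last by exists s.
apply/cvgr0Pnorm_le => e e0; have [n0 n0P] := cf e e0.
by exists n0 => // n /= n0n; rewrite ger0_norm ?sqn_ge0//; have [] := key _ _ n0P n n0n.
Qed.

(* The hypothesis on [f_] is uniform integrability: up to a part of small integral
   [f_ n] is bounded by a constant. *)
Lemma vitali_Rintegral (f_ : nat -> T -> R) f : (mu D < +oo)%E ->
  (forall n, measurable_fun D (f_ n)) -> measurable_fun D f ->
  (aeD x, f_ n x @[n --> \oo] --> f x) ->
  (forall e, 0 < e -> exists C r, [/\ 0 <= C, forall n, rint (r n),
     forall n, aeD x, 0 <= r n x /\ `|f_ n x| <= C + r n x &
     forall n, I (r n) <= e]) ->
  rint f /\ I (f_ n) @[n --> \oo] --> I f.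
Proof.
move=> Doo mf_ mf ff UI.
(* Clamping to [[-C, C]]. The clamped functions are dominated by a constant, and the clamping error
   is at most the remainder [r n]. *)
pose cl (C y : R) : R := Num.max (- C) (Num.min C y).
have mcl C g : measurable_fun D g -> measurable_fun D (fun x => cl C (g x)).
  move=> mg; apply: measurable_maxr => //; exact: measurable_minr.
have clC C y : 0 <= C -> `|cl C y| <= C.
  move=> C0; rewrite ler_norml /cl le_max lexx/= ge_max ge_min lexx/= andbT.
  by lra.
have cld C y (r : R) : 0 <= C -> 0 <= r -> `|y| <= C + r -> `|y - cl C y| <= r.
  move=> C0 r0; rewrite /cl !ler_norml => /andP[y1 y2].
  by case: (leP C y) => Cy; [case: (leP (- C) C)|case: (leP (- C) y)] => Cy';
    apply/andP; split; lra.
have clcvg C : aeD x, cl C (f_ n x) @[n --> \oo] --> cl C (f x).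
  apply: filterS ff => x /[apply] ff; apply: (continuous_cvg _ _ ff).
  apply: (@continuous_max _ _ (fun=> - C) (fun y => Num.min C y)); first exact: cvg_cst.
  by apply: (@continuous_min _ _ (fun=> C) id); [exact: cvg_cst|exact: cvg_id].
have key e : 0 < e -> exists C, [/\ 0 <= C, forall n, rint (f_ n),
    forall n, I (fun x => `|f_ n x - cl C (f_ n x)|) <= e,
    rint (fun x => `|f x - cl C (f x)|) & I (fun x => `|f x - cl C (f x)|) <= e].
  move=> e0; have [C [r [C0 ri fr Ir]]] := UI e e0; exists C.
  have fi n : rint (f_ n).
    apply: (ae_le_rintegrable mD (mf_ n) (g := fun x => C + r n x)).
      by apply: rintegrableD => //; exact: rint_cst.
    by apply: filterS (fr n) => x /[apply] -[].
  have mfc n : measurable_fun D (fun x => `|f_ n x - cl C (f_ n x)|).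
    by apply: measurableT_comp => //; apply: measurable_funB => //; exact: mcl.
  have fcr n : aeD x, `|f_ n x - cl C (f_ n x)| <= r n x.
    by apply: filterS (fr n) => x /[apply] -[? ?]; exact: cld.
  have fci n : rint (fun x => `|f_ n x - cl C (f_ n x)|).
    apply: (ae_le_rintegrable mD (mfc n) (ri n)).
    by apply: filterS (fcr n) => x h Dx; rewrite normr_id h.
  have Ifc n : I (fun x => `|f_ n x - cl C (f_ n x)|) <= e.
    by apply: le_trans (Ir n); exact: ae_le_Rintegral.
  (* Fatou's lemma carries the bound on the clamping error over to [f], whose integrability is not
     known yet. *)
  have [||||fi' Ifi] := @cvg_fatou _ _ _ _ _ mD
    (fun n x => `|f_ n x - cl C (f_ n x)|) (fun x => `|f x - cl C (f x)|) e fci.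
  - by move=> n; apply: aeW.
  - by apply: measurableT_comp => //; apply: measurable_funB => //; exact: mcl.
  - apply: filterS2 ff (clcvg C) => x ff cc Dx; apply: cvg_norm.
    by apply: cvgB; [exact: ff|exact: cc].
  - by move=> e' e'0; apply: nearW => n; have := Ifc n; lra.
  by split.
have cli C g : 0 <= C -> measurable_fun D g -> rint (fun x => cl C (g x)).
  by move=> C0 mg; apply: (@rint_bounded _ C) => //; [exact: mcl|apply: aeW => x _; exact: clC].
have fi_ n : rint (f_ n) by have [C []] := key _ ltr01.
have fi : rint f.
  have [C [C0 _ _ fi _]] := key _ ltr01.
  apply: (ae_le_rintegrable mD mf (g := fun x => `|f x - cl C (f x)| + C)).
    by apply: rintegrableD => //; exact: rint_cst.
  apply: aeW => x _; rewrite -[X in `|X| <= _](subrK (cl C (f x))).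
  by apply: le_trans (ler_normD _ _) _; rewrite lerD2l clC.
split => //; apply/cvgrPdist_le => e e0.
have [|C [C0 _ fce _ fe]] := key (e / 3); first by rewrite divr_gt0.
have [_ /cvgrPdist_le/(_ (e / 3))] := @dominated_Rintegral _ _ _ _ _ mD
  (fun n x => cl C (f_ n x)) (fun x => cl C (f x)) (fun=> C)
  (fun n => mcl C _ (mf_ n)) (mcl C _ mf) (rint_cst C Doo)
  (clcvg C) (aeW _ (fun x _ n => clC C _ C0)).
rewrite divr_gt0// => /(_ isT); apply: filterS => n cn.
have diff g : rint g -> I (fun x => `|g x - cl C (g x)|) <= e / 3 ->
    `|I g - I (fun x => cl C (g x))| <= e / 3.
  move=> gi; apply: le_trans; have ci := cli C g C0 (rintegrable_measurable gi).
  rewrite -RintegralB//; apply: le_normr_Rintegral => //.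
  exact: rintegrableB.
have /ler_normlP[] := diff _ fi fe; have /ler_normlP[] := diff _ (fi_ n) (fce n).
move/ler_normlP : cn => [] ? ? ? ? ? ?.
by apply/ler_normlP; split; lra.
Qed.

End L2_toolkit.

(** * Smooth functions and truncation *)

Section row_measurability.
Context {R : realType} {N : nat}.
Local Notation V := 'rV[R]_N.

Lemma measurable_coord_box (P : 'I_N -> set R) : (forall i, measurable (P i)) ->
  measurable [set v : V | forall i, P i (v ord0 i)].
Proof.
move=> mP; rewrite (_ : mkset _ = \bigcap_(i in [set: 'I_N]) [set v : V | P i (v ord0 i)]).
  apply: fin_bigcap_measurable => // i _.
  by have := @measurable_row_coord _ R N i measurableT _ (mP i); rewrite setTI.
by apply/seteqP; split => v /= h i; [move=> _; exact: h|exact: h].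
Qed.

(** The sigma-algebra is generated by the coordinates, not by the open sets. An open set is the
    union of the rational cubes that it contains; there are countably many, enumerated through
    [pickle]. *)
Lemma open_measurable_row (A : set V) : open A -> measurable A.
Proof.
move=> oA; pose box (p : 'rV[rat]_N * rat) := [set v : V | forall i,
  `]ratr (p.1 ord0 i) - ratr p.2, ratr (p.1 ord0 i) + ratr p.2[%classic (v ord0 i)].
pose B k := if @unpickle ('rV[rat]_N * rat)%type k is Some p then
  if `[< box p `<=` A >] then box p else set0 else set0.
rewrite (_ : A = \bigcup_k B k); last first.
  apply/seteqP; split => [x Ax|x [k _]]; last first.
    by rewrite /B; case: unpickle => // p; case: asboolP => // + xp; exact.
  suff [p pA xp] : exists2 p, box p `<=` A & box p x.
    by exists (pickle p) => //; rewrite /B pickleK asboolT.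
  have := oA; rewrite openE => /(_ _ Ax) /nbhs_ballP[e /= e0 eA].
  (* Rational half-side [r < e / 2] and rational centre within [r] of [x]: the cube contains [x] and
     stays within [2 r < e] of it. *)
  have /rat_in_itvoo[r] : 0 < e / 2 by rewrite divr_gt0.
  rewrite in_itv/= => /andP[r0 re].
  have q_ i : {q : rat | x ord0 i - ratr r < ratr q < x ord0 i + ratr r}.
    apply: cid; have /rat_in_itvoo[q] : x ord0 i - ratr r < x ord0 i + ratr r by lra.
    by rewrite in_itv/= => qq; exists q.
  exists (\row_i sval (q_ i), r).
    move=> y /= yb; apply: eA; split => // i j; rewrite ord1.
    have := yb j; rewrite mxE; case: (q_ j) => q /= /andP[q1 q2].
    rewrite in_itv/= => /andP[y1 y2]; rewrite /ball/= ltr_norml.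
    by apply/andP; split; lra.
  move=> i /=; rewrite mxE; case: (q_ i) => q /= /andP[q1 q2].
  by rewrite in_itv/=; apply/andP; split; lra.
apply: bigcupT_measurable => k; rewrite /B; case: unpickle => // p.
case: asboolP => // _; exact: (@measurable_coord_box (fun i =>
  `]ratr (p.1 ord0 i) - ratr p.2, ratr (p.1 ord0 i) + ratr p.2[%classic)).
Qed.

Lemma continuous_measurable_row (f : V -> R) : continuous f ->
  measurable_fun [set: V] f.
Proof.
move=> cf mD; apply: (measurability _ (RGenOInfty.measurableE R)) => //.
move=> /= _ [_ [x ->] <-]; rewrite setTI; apply: open_measurable_row.
by apply: open_comp => //; exact: interval_open.
Qed.

End row_measurability.

Section continuous_algebra.
Context {R : realType} {T : topologicalType}.
Implicit Types (f g : T -> R).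

Lemma fcontinuousD f g : continuous f -> continuous g ->
  continuous (fun x => f x + g x).
Proof. by move=> cf cg x; apply: cvgD; [exact: cf|exact: cg]. Qed.

Lemma fcontinuousM f g : continuous f -> continuous g ->
  continuous (fun x => f x * g x).
Proof. by move=> cf cg x; apply: cvgM; [exact: cf|exact: cg]. Qed.

Lemma fcontinuousV f : (forall x, f x != 0) -> continuous f ->
  continuous (fun x => (f x)^-1).
Proof. by move=> f0 cf x; apply: cvgV => //; exact: cf. Qed.

End continuous_algebra.

Section smooth_algebra.
Context {R : realType} {N : nat}.
Local Notation V := 'rV[R]_N.
Implicit Types (f g : V -> R).

(** In [iter_partial] the head of the list is the outermost derivative. Peeling off the innermost
    one instead allows the product and quotient rules to be applied under induction on the order. *)
Fixpoint Ck n f : Prop :=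
  if n is k.+1 then [/\ continuous f,
    forall i x, derivable f x (delta_mx ord0 i) & forall i, Ck k (partial i f)]
  else continuous f.

Lemma CkW n f : Ck n.+1 f -> Ck n f.
Proof.
elim: n f => [|n IH] f; first by case.
by case=> cf df pf; split => // i; exact: IH.
Qed.

Lemma smooth_Ck n f : smooth f -> Ck n f.
Proof.
elim: n f => [|n IH] f sf; first by have [] := sf [::].
split; [by have [] := sf [::]|by have [] := sf [::]|] => i; apply: IH => s.
by have := sf (rcons s i); rewrite /iter_partial foldr_rcons.
Qed.

Lemma Ck_iter_partial s n f : Ck (size s + n) f -> Ck n (iter_partial s f).
Proof.
elim: s n => // i s IH n; rewrite [size _]/= addSnnS => /IH[_ _]; exact.
Qed.

Lemma smoothP f : smooth f <-> forall n, Ck n f.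
Proof.
split=> [sf n|sf s]; first exact: smooth_Ck.
by have [] := @Ck_iter_partial s 1 f (sf _).
Qed.

Lemma Ck_cst n (c : R) : Ck n (fun=> c).
Proof.
elim: n c => [|n IH] c; first exact: cst_continuous.
split; [exact: cst_continuous|by move=> i x; exact: (@derivable_cst _ _ R c x _)|move=> i].
rewrite (_ : partial i _ = fun=> 0); first exact: IH.
by apply/funext => x; rewrite /partial (@derive_cst _ V R).
Qed.

Lemma partialD i f g x : derivable f x (delta_mx ord0 i) ->
  derivable g x (delta_mx ord0 i) ->
  partial i (fun y => f y + g y) x = partial i f x + partial i g x.
Proof. by move=> df dg; exact: (@deriveD _ _ _ f g). Qed.

Lemma partialM i f g x : derivable f x (delta_mx ord0 i) ->
  derivable g x (delta_mx ord0 i) ->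
  partial i (fun y => f y * g y) x = f x * partial i g x + g x * partial i f x.
Proof. by move=> df dg; exact: (@deriveM _ _ f g). Qed.

Lemma CkD n f g : Ck n f -> Ck n g -> Ck n (fun x => f x + g x).
Proof.
elim: n f g => [|n IH] f g; first exact: fcontinuousD.
move=> [cf df pf] [cg dg pg]; split.
- exact: fcontinuousD.
- by move=> i x; exact: (@derivableD _ _ _ f g).
move=> i; rewrite (_ : partial i _ = fun x => partial i f x + partial i g x).
  by apply: IH; [exact: pf|exact: pg].
by apply/funext => x; rewrite partialD.
Qed.

Lemma CkM n f g : Ck n f -> Ck n g -> Ck n (fun x => f x * g x).
Proof.
elim: n f g => [|n IH] f g; first exact: fcontinuousM.
move=> cf' cg'; have [cf df pf] := cf'; have [cg dg pg] := cg'; split.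
- exact: fcontinuousM.
- by move=> i x; exact: (@derivableM _ _ f g).
move=> i; rewrite (_ : partial i _ =
  fun x => f x * partial i g x + g x * partial i f x).
  by apply: CkD; apply: IH; [exact: CkW cf'|exact: pg|exact: CkW cg'|exact: pf].
by apply/funext => x; rewrite partialM.
Qed.

Lemma partialV i f x : f x != 0 -> derivable f x (delta_mx ord0 i) ->
  partial i (fun y => (f y)^-1) x = - (f x) ^- 2 * partial i f x.
Proof. by move=> f0 df; exact: (deriveV f0 df). Qed.

Lemma CkV n f : (forall x, f x != 0) -> Ck n f -> Ck n (fun x => (f x)^-1).
Proof.
elim: n f => [|n IH] f f0; first exact: fcontinuousV.
move=> cf'; have [cf df pf] := cf'; split.
- exact: fcontinuousV.
- by move=> i x; exact: derivableV.
move=> i; rewrite (_ : partial i _ =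
  fun x => (-1) * (partial i f x * ((f x)^-1 * (f x)^-1))).
  apply: CkM; first exact: Ck_cst.
  by apply: CkM; [exact: pf|apply: CkM; apply: IH => //; exact: CkW].
by apply/funext => x; rewrite partialV// -exprVn expr2; ring.
Qed.

Lemma smoothM f g : smooth f -> smooth g -> smooth (fun x => f x * g x).
Proof. by move=> /smoothP sf /smoothP sg; apply/smoothP => n; exact: CkM. Qed.

Lemma smooth_derivable f : smooth f -> forall i x, derivable f x (delta_mx ord0 i).
Proof. by move=> /(_ [::])[]. Qed.

Lemma smooth_continuous f : smooth f -> continuous f.
Proof. by move=> /(_ [::])[]. Qed.

Lemma smooth_partial_continuous f : smooth f -> forall i, continuous (partial i f).
Proof. by move=> sf i; have [] := sf [:: i]. Qed.

Lemma testM Om f g : test_function Om f -> smooth g ->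
  test_function Om (fun x => f x * g x).
Proof.
move=> [sf cf fO] sg.
have fg : closure [set x | f x * g x != 0] `<=` closure [set x | f x != 0].
  by apply: closure_subset => x /=; rewrite mulf_eq0 negb_or => /andP[].
split; first exact: smoothM.
- by apply: subclosed_compact cf fg; exact: closed_closure.
- exact: subset_trans fg fO.
Qed.

End smooth_algebra.

(* [trunc e] is a smooth bounded function of [s], tending to [s] as [e] tends to [0]
   and 1-Lipschitz; [dtrunc e] is its derivative. *)
Section truncation.
Context {R : realType}.
Implicit Types (e s t : R).

Definition trunc e s := s * (1 + e ^+ 2 * (s * s))^-1.

Definition dtrunc e s := (1 - e ^+ 2 * (s * s)) * (1 + e ^+ 2 * (s * s)) ^- 2.

Lemma trunc_den_ge1 e s : 1 <= 1 + e ^+ 2 * (s * s).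
Proof. by rewrite lerDl mulr_ge0 ?sqr_ge0// -expr2 sqr_ge0. Qed.

Lemma trunc_den_gt0 e s : 0 < 1 + e ^+ 2 * (s * s).
Proof. exact: lt_le_trans ltr01 (trunc_den_ge1 e s). Qed.

(** With [A = e s] and [B = e t], the difference quotient is [1 - A B] over [(1 + A^2) (1 + B^2)],
    of modulus at most 1. *)
Lemma trunc_lip e s t : `|trunc e s - trunc e t| <= `|s - t|.
Proof.
have ds := trunc_den_gt0 e s; have dt := trunc_den_gt0 e t.
have -> : trunc e s - trunc e t = (s - t) * ((1 - e ^+ 2 * (s * t)) /
    ((1 + e ^+ 2 * (s * s)) * (1 + e ^+ 2 * (t * t)))).
  by rewrite /trunc; field; rewrite !gt_eqF.
rewrite normrM ler_piMr// normrM normfV (gtr0_norm (mulr_gt0 ds dt)).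
rewrite ler_pdivrMr ?mulr_gt0// mul1r ler_norml.
have := sqr_ge0 (e * (s - t)); have := sqr_ge0 (e * (s + t)).
have := sqr_ge0 (e * s * (e * t)).
by move=> h1 h2 h3; apply/andP; split; nra.
Qed.

Lemma trunc0 e : trunc e 0 = 0. Proof. by rewrite /trunc mul0r. Qed.

Lemma trunc_le e s : `|trunc e s| <= `|s|.
Proof. by have := trunc_lip e s 0; rewrite trunc0 !subr0. Qed.

(** The extreme values are taken at [s = e^-1] and its opposite; the inequality amounts to the
    square of [e |s| - 1] being nonnegative. *)
Lemma trunc_bounded e s : 0 < e -> `|trunc e s| <= (2 * e)^-1.
Proof.
move=> e0; rewrite /trunc normrM normfV (gtr0_norm (trunc_den_gt0 e s)).
rewrite ler_pdivrMr ?trunc_den_gt0// mulrC -ler_pdivrMr ?invr_gt0 ?mulr_gt0// invrK.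
have := sqr_ge0 (e * `|s| - 1).
have -> : s * s = `|s| * `|s| by rewrite -normrM ger0_norm// -expr2 sqr_ge0.
by nra.
Qed.

Lemma dtrunc_le1 e s : `|dtrunc e s| <= 1.
Proof.
have d0 := trunc_den_gt0 e s; have d1 := trunc_den_ge1 e s.
rewrite /dtrunc normrM normfV (gtr0_norm (exprn_gt0 _ d0)).
rewrite ler_pdivrMr ?exprn_gt0// mul1r ler_norml.
by apply/andP; split; nra.
Qed.

Lemma dtrunc_cont e : continuous (dtrunc e).
Proof.
move=> s; apply: cvgM.
  apply: cvgB; first exact: cvg_cst.
  by apply: cvgM; [exact: cvg_cst|apply: cvgM; exact: cvg_id].
apply: cvgV; first by rewrite expf_neq0// gt_eqF// trunc_den_gt0.
have c : (fun s => 1 + e ^+ 2 * (s * s)) s @[s --> s] --> 1 + e ^+ 2 * (s * s).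
  apply: cvgD; first exact: cvg_cst.
  by apply: cvgM; [exact: cvg_cst|apply: cvgM; exact: cvg_id].
exact: (cvgM c c).
Qed.

Lemma trunc_cont e : continuous (trunc e).
Proof.
move=> s; apply: cvgM; first exact: cvg_id.
apply: cvgV; first by rewrite gt_eqF// trunc_den_gt0.
apply: cvgD; first exact: cvg_cst.
by apply: cvgM; [exact: cvg_cst|apply: cvgM; exact: cvg_id].
Qed.

Lemma cvg_sqr_mul0 (e_ : nat -> R) s : e_ n @[n --> \oo] --> 0 ->
  e_ n ^+ 2 * (s * s) @[n --> \oo] --> 0.
Proof.
move=> e0; rewrite -[X in _ --> X](mul0r (s * s)); apply: cvgM; last exact: cvg_cst.
by rewrite -[X in _ --> X](mul0r 0); apply: cvgM.
Qed.

Lemma trunc_cvg (e_ : nat -> R) s : e_ n @[n --> \oo] --> 0 ->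
  trunc (e_ n) s @[n --> \oo] --> s.
Proof.
move=> /(@cvg_sqr_mul0 _ s) e0; rewrite -[X in _ --> X]mulr1.
apply: cvgM; first exact: cvg_cst.
rewrite -[X in _ --> X]invr1; apply: cvgV => //.
by rewrite -[X in _ --> X]addr0; apply: cvgD => //; exact: cvg_cst.
Qed.

Lemma dtrunc_cvg (e_ : nat -> R) s : e_ n @[n --> \oo] --> 0 ->
  dtrunc (e_ n) s @[n --> \oo] --> (1 : R).
Proof.
move=> /(@cvg_sqr_mul0 _ s) e0; rewrite -[X in _ --> X]mulr1.
apply: cvgM.
  by rewrite -[X in _ --> X](subr0 (1 : R)); apply: cvgB => //; exact: cvg_cst.
rewrite -[X in _ --> X]invr1; apply: cvgV => //.
rewrite -[X in _ --> X](mulr1 (1 : R)); apply: cvgM;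
  by rewrite -[X in _ --> X](addr0 (1 : R)); apply: cvgD => //; exact: cvg_cst.
Qed.

(** This is the reason for a rational truncation: its denominator is at least 1, so the product and
    quotient rules give smoothness and the derivative, and the factor [f] keeps the support inside
    [Om]. *)
Lemma trunc_test N (Om : set 'rV[R]_N) e (f : 'rV[R]_N -> R) :
  test_function Om f -> test_function Om (fun x => trunc e (f x)) /\
  forall i x, partial i (fun x => trunc e (f x)) x = dtrunc e (f x) * partial i f x.
Proof.
move=> tf; have [sf _ _] := tf; have /smoothP cf := sf.
have cd n : Ck n (fun x => 1 + e ^+ 2 * (f x * f x)).
  apply: CkD; first exact: Ck_cst.
  by apply: CkM; [exact: Ck_cst|exact: CkM].
have d0 x : 1 + e ^+ 2 * (f x * f x) != 0 by rewrite gt_eqF// trunc_den_gt0.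
have sV : smooth (fun x => (1 + e ^+ 2 * (f x * f x))^-1).
  by apply/smoothP => n; exact: CkV.
split; first exact: testM.
move=> i x; have df := @smooth_derivable _ _ f sf i x.
have dff : derivable (fun y => f y * f y) x (delta_mx ord0 i).
  exact: (@derivableM _ _ f f).
have dc (c : R) : derivable (fun=> c : R) x (delta_mx ord0 i).
  exact: (@derivable_cst _ _ R c x _).
have dcff : derivable (fun y => e ^+ 2 * (f y * f y)) x (delta_mx ord0 i).
  exact: (@derivableM _ _ (fun=> e ^+ 2) (fun y => f y * f y)).
have dp : derivable (fun y => 1 + e ^+ 2 * (f y * f y)) x (delta_mx ord0 i).
  exact: (@derivableD _ _ _ (fun=> 1 : R) (fun y => e ^+ 2 * (f y * f y))).
have p0 (c : R) : partial i (fun=> c) x = 0 by exact: (@derive_cst _ _ R).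
rewrite partialM ?partialV//; last exact: derivableV.
rewrite partialD// partialM// partialM// !p0 /dtrunc.
by field.
Qed.

End truncation.

(** * Fubini's theorem for bounded functions on cubes *)

Section bounded_support.
Context {R : realType}.

(** A class stable under slicing and under integrating out a variable, and integrable as soon as [B]
    has finite measure: Fubini's theorem then has no side conditions left to check. *)
Definition bsupp d {T : measurableType d} (B : set T) (f : T -> R) :=
  [/\ measurable_fun [set: T] f, exists C, forall x, `|f x| <= C &
      forall x, ~ B x -> f x = 0].

Section basics.
Context {d} {T : measurableType d} (B : set T).
Hypothesis mB : measurable B.
Variable mu : {measure set T -> \bar R}.
Hypothesis Boo : (mu B < +oo)%E.
Implicit Types f g : T -> R.

Lemma bsupp_restrict f : bsupp B f -> f = f \_ B.
Proof.
move=> [_ _ f0]; apply/funext => x; rewrite patchE; case: ifPn => //.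
by move/negP; rewrite inE => /f0.
Qed.

Lemma bsupp_rintegrable f : bsupp B f -> rintegrable mu setT f.
Proof.
move=> bf; have [mf [C fC] f0] := bf; rewrite /rintegrable.
have -> : EFin \o f = (EFin \o f) \_ B.
  by rewrite [in LHS](bsupp_restrict bf) restrict_EFin.
apply/(integrable_mkcond _ mB); apply: (@rint_bounded _ _ _ _ _ mB _ C) => //.
  exact: measurable_funS mf.
by apply: aeW.
Qed.

Lemma bsupp_RintegralE f : bsupp B f -> \int[mu]_x f x = \int[mu]_(x in B) f x.
Proof. by move=> bf; rewrite [RHS]Rintegral_mkcond -(bsupp_restrict bf). Qed.

Lemma bsupp_rintegrableS f D : measurable D -> bsupp B f -> rintegrable mu D f.
Proof. by move=> mD bf; apply: integrableS (bsupp_rintegrable bf). Qed.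

Lemma bsuppD f g : bsupp B f -> bsupp B g -> bsupp B (fun x => f x + g x).
Proof.
move=> [mf [C fC] f0] [mg [C' gC] g0]; split; first exact: measurable_funD.
- exists (C + C') => x; exact: le_trans (ler_normD _ _) (lerD _ _).
- by move=> x Bx; rewrite f0// g0// addr0.
Qed.

Lemma bsuppM f g : bsupp B f -> measurable_fun setT g -> (exists C, forall x, `|g x| <= C) ->
  bsupp B (fun x => f x * g x).
Proof.
move=> [mf [C fC] f0] mg [C' gC]; split; first exact: measurable_funM.
- by exists (C * C') => x; rewrite normrM ler_pM.
- by move=> x Bx; rewrite f0// mul0r.
Qed.

Lemma bsupp_sqr f : bsupp B f -> bsupp B (fun x => f x ^+ 2).
Proof. by move=> bf; have [mf bdf _] := bf; exact: bsuppM. Qed.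

Lemma bsupp_sum (J : Type) (s : seq J) (f : J -> T -> R) :
  (forall i, bsupp B (f i)) -> bsupp B (fun x => \sum_(i <- s) f i x).
Proof.
move=> bf; elim: s => [|i s IH].
  under eq_fun do rewrite big_nil; split => //; exists 0 => x; by rewrite normr0.
by under eq_fun do rewrite big_cons; exact: bsuppD.
Qed.

Lemma bsupp_norm_le f C : bsupp B f -> (forall x, `|f x| <= C) ->
  `|\int[mu]_x f x| <= C * fine (mu B).
Proof.
move=> bf fC; rewrite bsupp_RintegralE//.
apply: le_trans (le_normr_Rintegral mB (bsupp_rintegrableS mB bf)) _.
rewrite -Rintegral_cst//; apply: le_Rintegral => //.
- exact: integrable_norm (bsupp_rintegrableS mB bf).
- exact: rint_cst.
Qed.

End basics.

Section fubini.
Context {d1 d2} {T1 : measurableType d1} {T2 : measurableType d2}.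
Variables (m1 : {sigma_finite_measure set T1 -> \bar R})
  (m2 : {sigma_finite_measure set T2 -> \bar R}) (B1 : set T1) (B2 : set T2).
Hypotheses (mB1 : measurable B1) (mB2 : measurable B2).
Hypotheses (B1oo : (m1 B1 < +oo)%E) (B2oo : (m2 B2 < +oo)%E).
Variable f : T1 * T2 -> R.
Hypothesis bf : bsupp (B1 `*` B2) f.

Lemma bsupp_slice1 x : bsupp B2 (fun y => f (x, y)).
Proof.
have [mf [C fC] f0] := bf; split.
- exact: measurableT_comp mf (measurable_pair1 x).
- by exists C.
- by move=> y By; apply: f0 => -[].
Qed.

Lemma bsupp_slice2 y : bsupp B1 (fun x => f (x, y)).
Proof.
have [mf [C fC] f0] := bf; split.
- exact: measurableT_comp mf (measurable_pair2 y).
- by exists C.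
- by move=> x Bx; apply: f0 => -[].
Qed.

Lemma bsupp_prod_rintegrable : (m1 \x m2)%E.-integrable setT (EFin \o f).
Proof.
have mB : measurable (B1 `*` B2) by exact: measurableX.
have Boo : ((m1 \x m2) (B1 `*` B2) < +oo)%E.
  rewrite product_measure1E// lte_mul_pinfty ?measure_ge0//.
  by rewrite ge0_fin_numE// measure_ge0.
exact: (bsupp_rintegrable mB Boo bf).
Qed.

Let E1 x : (\int[m2]_y (f (x, y))%:E = (\int[m2]_y f (x, y))%:E)%E.
Proof.
apply: EFin_Rintegral => //; exact: (bsupp_rintegrable mB2 B2oo (bsupp_slice1 x)).
Qed.

Let E2 y : (\int[m1]_x (f (x, y))%:E = (\int[m1]_x f (x, y))%:E)%E.
Proof.
apply: EFin_Rintegral => //; exact: (bsupp_rintegrable mB1 B1oo (bsupp_slice2 y)).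
Qed.

Lemma bsupp_Rintegral1 : bsupp B1 (fun x => \int[m2]_y f (x, y)).
Proof.
have [mf [C fC] f0] := bf; split.
- apply/measurable_EFinP.
  rewrite (_ : EFin \o _ = fubini_F m2 (EFin \o f)); first exact: (measurable_fubini_F bsupp_prod_rintegrable).
  by apply/funext => x /=; rewrite -E1.
- exists (C * fine (m2 B2)) => x; exact: bsupp_norm_le (bsupp_slice1 x) _.
- move=> x Bx; rewrite -[RHS](mul0r (fine (m2 setT))) -Rintegral_cst//.
  by apply: eq_Rintegral => y _; apply: f0 => -[].
Qed.

Lemma bsupp_Rintegral2 : bsupp B2 (fun y => \int[m1]_x f (x, y)).
Proof.
have [mf [C fC] f0] := bf; split.
- apply/measurable_EFinP.
  rewrite (_ : EFin \o _ = fubini_G m1 (EFin \o f)); first exact: (measurable_fubini_G bsupp_prod_rintegrable).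
  by apply/funext => y /=; rewrite -E2.
- exists (C * fine (m1 B1)) => y; exact: bsupp_norm_le (bsupp_slice2 y) _.
- move=> y By; rewrite -[RHS](mul0r (fine (m1 setT))) -Rintegral_cst//.
  by apply: eq_Rintegral => x _; apply: f0 => -[].
Qed.

Lemma bsupp_fubini1 :
  \int[(m1 \x m2)%E]_z f z = \int[m1]_x (\int[m2]_y f (x, y)).
Proof.
rewrite /Rintegral -(integral12_prod_meas1 bsupp_prod_rintegrable); congr fine.
by apply: eq_integral => x _; rewrite -/(Rintegral _ _ _) -E1.
Qed.

Lemma bsupp_fubini2 :
  \int[(m1 \x m2)%E]_z f z = \int[m2]_y (\int[m1]_x f (x, y)).
Proof.
rewrite /Rintegral -(integral21_prod_meas1 bsupp_prod_rintegrable); congr fine.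
by apply: eq_integral => y _; rewrite -/(Rintegral _ _ _) -E2.
Qed.

End fubini.
End bounded_support.

Section row_fubini.
Context {R : realType}.
Local Notation lebr n := (@lebesgue_row R n).
Local Notation leb := (@lebesgue_measure R).

Definition cube (L : R) n := [set v : 'rV[R]_n | forall i, - L <= v ord0 i <= L].
Arguments cube L n : clear implicits.

Lemma measurable_cube L n : measurable (cube L n).
Proof.
have := @measurable_coord_box R n (fun=> `[- L, L]%classic) (fun=> measurable_itv _).
by rewrite (_ : mkset _ = cube L n).
Qed.

Lemma lebesgue_cube L n : 0 <= L -> (lebr n (cube L n) < +oo)%E.
Proof.
move=> L0; have := @lebesgue_row_box R n (const_mx (- L)) (const_mx L).
rewrite (_ : [set v | _] = cube L n).
  by move=> ->; [exact: ltry|move=> i; rewrite !mxE; lra].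
by apply/seteqP; split => v h i; have := h i; rewrite !mxE.
Qed.

Lemma cube_row_cons L n t (y : 'rV[R]_n) :
  cube L n.+1 (row_cons (t, y)) <-> `[- L, L]%classic t /\ cube L n y.
Proof.
split=> [h|[ht hy] i].
  split; first by have := h ord0; rewrite mxE unlift_none/= in_itv.
  by move=> i; have := h (lift ord0 i); rewrite mxE liftK.
rewrite mxE; case: (unliftP ord0 i) => [k _|_] /=; first exact: hy.
by move: ht; rewrite /= in_itv.
Qed.

Section row_succ.
Variables (n : nat) (L : R) (f : 'rV[R]_n.+1 -> R).
Hypothesis L0 : 0 <= L.
Hypothesis bf : bsupp (cube L n.+1) f.

Lemma bsupp_row_cons : bsupp (`[- L, L]%classic `*` cube L n) (f \o @row_cons R n).
Proof.
have [mf [C fC] f0] := bf; split.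
- exact: measurableT_comp mf (@measurable_row_cons R n).
- by exists C => x; exact: fC.
- by move=> [t y] nB; apply: f0; apply: contra_not nB => /cube_row_cons.
Qed.

Let Ioo : (leb `[(- L)%R, L]%classic < +oo)%E.
Proof. by rewrite lebesgue_measure_itv/=; case: ifP => _; rewrite -?EFinD ltry. Qed.

Lemma Rintegral_row_cons :
  \int[lebr n.+1]_v f v = \int[(leb \x lebr n)%E]_z f (row_cons z).
Proof.
have [mf _ _] := bf; rewrite /Rintegral; congr fine.
rewrite /= /row_product integral_pushforward//.
- exact: measurable_row_cons.
- exact/measurable_EFinP.
rewrite preimage_setT.
exact: (@bsupp_prod_rintegrable _ _ _ _ _ leb (lebr n) _ _ (measurable_itv _)
  (@measurable_cube L n) Ioo (@lebesgue_cube L n L0) _ bsupp_row_cons).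
Qed.

Lemma row_fubini1 :
  \int[lebr n.+1]_v f v = \int[leb]_t (\int[lebr n]_y f (row_cons (t, y))).
Proof.
rewrite Rintegral_row_cons; exact: (@bsupp_fubini1 _ _ _ _ _ leb (lebr n) _ _ (measurable_itv _)
  (@measurable_cube L n) Ioo (@lebesgue_cube L n L0) _ bsupp_row_cons).
Qed.

Lemma row_fubini2 :
  \int[lebr n.+1]_v f v = \int[lebr n]_y (\int[leb]_t f (row_cons (t, y))).
Proof.
rewrite Rintegral_row_cons; exact: (@bsupp_fubini2 _ _ _ _ _ leb (lebr n) _ _ (measurable_itv _)
  (@measurable_cube L n) Ioo (@lebesgue_cube L n L0) _ bsupp_row_cons).
Qed.

Lemma bsupp_row1 : bsupp `[- L, L]%classic (fun t => \int[lebr n]_y f (row_cons (t, y))).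
Proof.
exact: (@bsupp_Rintegral1 _ _ _ _ _ leb (lebr n) _ _ (measurable_itv _)
  (@measurable_cube L n) Ioo (@lebesgue_cube L n L0) _ bsupp_row_cons).
Qed.

Lemma bsupp_row2 : bsupp (cube L n) (fun y => \int[leb]_t f (row_cons (t, y))).
Proof.
exact: (@bsupp_Rintegral2 _ _ _ _ _ leb (lebr n) _ _ (measurable_itv _)
  (@measurable_cube L n) Ioo (@lebesgue_cube L n L0) _ bsupp_row_cons).
Qed.

Lemma bsupp_row_slice1 t : bsupp (cube L n) (fun y => f (row_cons (t, y))).
Proof. exact: bsupp_slice1 bsupp_row_cons t. Qed.

Lemma bsupp_row_slice2 y : bsupp `[- L, L]%classic (fun t => f (row_cons (t, y))).
Proof. exact: bsupp_slice2 bsupp_row_cons y. Qed.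

End row_succ.
End row_fubini.

Arguments cube {R} L n _.

(** * Poincare and finite-rank inequalities *)

Section integral_more.
Context d {T : measurableType d} {R : realType}.
Variables (mu : {measure set T -> \bar R}).

Lemma Rintegral_subset_le (A B : set T) (f : T -> R) : measurable A -> measurable B ->
  A `<=` B -> rintegrable mu B f -> (forall x, 0 <= f x) ->
  \int[mu]_(x in A) f x <= \int[mu]_(x in B) f x.
Proof.
move=> mA mB AB fi f0; have fiA : rintegrable mu A f by apply: integrableS fi.
rewrite -lee_fin -!EFin_Rintegral//; apply: ge0_subset_integral => //; first exact: measurable_int fi.
by move=> x _; rewrite lee_fin.
Qed.

Lemma sqr_Rintegral_le (D : set T) (f : T -> R) : measurable D -> (mu D < +oo)%E ->
  L2 mu D f -> (\int[mu]_(x in D) f x) ^+ 2 <= fine (mu D) * sqn mu D f.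
Proof.
move=> mD Doo fi; have L1 : L2 mu D (fun=> 1).
  by apply: (@L2_bounded _ _ _ _ _ mD _ 1) => //; apply: aeW => x _; rewrite normr1.
have := cauchy_schwarz mD fi L1.
rewrite (_ : sqn mu D (fun=> 1) = fine (mu D)); last first.
  by rewrite /sqn expr1n Rintegral_cst// mul1r.
rewrite (_ : Rintegral mu D _ = \int[mu]_(x in D) f x) 1?mulrC//.
by apply: eq_Rintegral => x _; rewrite mulr1.
Qed.

End integral_more.

(** * Inequalities on a line *)

Section line_functions.
Context {R : realType}.
Local Notation leb := (@lebesgue_measure R).
Implicit Types (W V : R -> R) (D : set (measurableTypeR R)).

(** [V] plays the part of the derivative of [W]. Only the integral formula is required, because it
    is what passes through the averages of [ac_row_avg]. *)
Definition ac_line (L : R) W V := [/\ bsupp `[- L, L]%classic W, bsupp `[- L, L]%classic V &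
  forall s t, s <= t -> W t - W s = \int[leb]_(r in `[s, t]) V r].

Lemma itv_oo a b : (leb `[a, b]%classic < +oo)%E.
Proof. by rewrite lebesgue_measure_itv/=; case: ifP => _; rewrite -?EFinD ltry. Qed.

Lemma line_rintegrable (L : R) (f : R -> R) D : measurable D ->
  bsupp `[- L, L]%classic f -> rintegrable leb D f.
Proof.
move=> mD bf.
exact: (@bsupp_rintegrableS R _ (measurableTypeR R) (`[- L, L]%classic : set R)
  (measurable_itv _) leb (itv_oo _ _) f D mD bf).
Qed.

Lemma line_RintegralE (L : R) (f : R -> R) : bsupp `[- L, L]%classic f ->
  \int[leb]_x f x = \int[leb]_(x in `[- L, L]) f x.
Proof. exact: (@bsupp_RintegralE R _ (measurableTypeR R) _ leb). Qed.

Section pair.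
Variables (L : R) (W V : R -> R).
Hypotheses (L0 : 0 <= L) (WV : ac_line L W V).

Let bW : bsupp `[- L, L]%classic W. Proof. by have [] := WV. Qed.
Let bV : bsupp `[- L, L]%classic V. Proof. by have [] := WV. Qed.
Let Ioo := itv_oo (- L) L.

Let bnV : bsupp `[- L, L]%classic (fun r => `|V r|).
Proof.
have [mV [C VC] V0] := bV; split; first exact: measurableT_comp.
- by exists C => x; rewrite normr_id.
- by move=> x /V0 ->; rewrite normr0.
Qed.

Lemma ac_line_L2 D : measurable D -> L2 leb D V.
Proof.
move=> mD; split; first by have [mV _ _] := bV; exact: measurable_funS mV.
exact: line_rintegrable mD (bsupp_sqr bV).
Qed.

Lemma ac_line_osc D s t : measurable D -> s <= t -> `[s, t]%classic `<=` D ->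
  `|W t - W s| <= \int[leb]_(r in D) `|V r|.
Proof.
move=> mD st sD; have [_ _ WVE] := WV; rewrite WVE//.
apply: le_trans (le_normr_Rintegral _ _) _ => //.
  exact: line_rintegrable bV.
by apply: Rintegral_subset_le => //; exact: line_rintegrable bnV.
Qed.

Lemma ac_line_osc_sqr D s t : measurable D -> (leb D < +oo)%E -> s <= t ->
  `[s, t]%classic `<=` D ->
  (W t - W s) ^+ 2 <= fine (leb D) * \int[leb]_(r in D) V r ^+ 2.
Proof.
move=> mD Doo st sD; have nL2 : L2 leb D (fun r => `|V r|).
  have := ac_line_L2 mD => VL2; apply: (ae_le_L2 mD _ VL2); last first.
    by apply: aeW => x _; rewrite normr_id.
  by apply: measurableT_comp => //; case: VL2.
apply: le_trans (le_trans (sqr_Rintegral_le mD Doo nL2) _).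
  rewrite -[leLHS]real_normK ?num_real// ler_sqr ?nnegrE//; first exact: ac_line_osc.
  exact: Rintegral_ge0.
rewrite le_eqVlt; apply/orP; left; apply/eqP; congr (_ * _).
by apply: eq_Rintegral => x _; rewrite real_normK ?num_real.
Qed.

Lemma ac_line_Rintegral0 : \int[leb]_r V r = 0.
Proof.
have L0' := L0; have [[_ _ W0] _ WVE] := WV.
(* [W] is known to vanish only off the closed interval, possibly not at its endpoints; the interval
   is enlarged so that both endpoints lie outside. *)
have bV1 : bsupp `[- (L + 1), L + 1]%classic V.
  have [mV bd V0] := bV; split => // x nx; apply: V0; apply: contra_not nx => /=.
  by rewrite !in_itv/=; lra.
have LL : - (L + 1) <= L + 1 by lra.
rewrite (line_RintegralE bV1) -WVE//.
by rewrite !W0 ?subr0//= in_itv/= => /andP[? ?]; lra.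
Qed.

(** Cauchy-Schwarz on the integral of [V] up to [t] bounds [W t ^+ 2] by [2 * L] times the integral
    of [V ^+ 2]; integrating over an interval of length [2 * L] gives the second factor. *)
Lemma ac_line_poincare : \int[leb]_r W r ^+ 2 <= (2 * L) ^+ 2 * \int[leb]_r V r ^+ 2.
Proof.
have L0' := L0; have [[_ _ W0] _ _] := WV.
rewrite (line_RintegralE (bsupp_sqr bW)) (line_RintegralE (bsupp_sqr bV)).
set v := \int[leb]_(r in _) V r ^+ 2.
have leI : fine (leb `[- L, L]%classic) = 2 * L.
  by rewrite lebesgue_measure_itv/= lte_fin; case: ltP => ?; rewrite -?EFinD/=; lra.
have Wle t : W t ^+ 2 <= 2 * L * v.
  have v0 : 0 <= 2 * L * v.
    by rewrite !mulr_ge0//; apply: Rintegral_ge0 => x _; exact: sqr_ge0.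
  case: (lerP (- L) t) => Lt; last first.
    by rewrite W0 ?expr0n//= in_itv/= => /andP[]; lra.
  case: (lerP t L) => tL; last first.
    by rewrite W0 ?expr0n//= in_itv/= => /andP[]; lra.
  (* The starting point must lie strictly to the left of [- L] for [W] to vanish there; [e] is then
     sent to [0]. *)
  have step e : 0 < e -> W t ^+ 2 <= (2 * L + e) * v.
    move=> e0; pose D' : set (measurableTypeR R) := `[- L - e, L]%classic.
    have leD : fine (leb D') = 2 * L + e.
      by rewrite lebesgue_measure_itv/= lte_fin; case: ltP => ?; rewrite -?EFinD/=; lra.
    have st : - L - e <= t by lra.
    have sD : `[- L - e, t]%classic `<=` D'.
      by move=> r; rewrite /D'/= !in_itv/= => /andP[? ?]; lra.
    have mD' : measurable D' by exact: measurable_itv.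
    have H := ac_line_osc_sqr mD' (itv_oo _ _) st sD.
    rewrite (W0 (- L - e)) ?subr0 in H; last by rewrite /= in_itv/= => /andP[]; lra.
    apply: le_trans H _; rewrite leD ler_wpM2l//; first by lra.
    rewrite /v -(line_RintegralE (bsupp_sqr bV))//.
    have i1 := line_rintegrable measurableT (bsupp_sqr bV).
    apply: (Rintegral_subset_le mD' measurableT (@subsetT _ _) i1).
    by move=> x; exact: sqr_ge0.
  apply/ler_addgt0Pr => e e0.
  have v1 : 0 < v + 1.
    by rewrite ltr_wpDl//; apply: Rintegral_ge0 => x _; exact: sqr_ge0.
  have := step (e / (v + 1)) (divr_gt0 e0 v1); rewrite mulrDl => /le_trans; apply.
  by rewrite lerD2l mulrAC ler_pdivrMr// ler_pM2l// lerDl.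
apply: (@le_trans _ _ (\int[leb]_(r in `[- L, L]) (2 * L * v))).
  apply: le_Rintegral => //; last exact: rint_cst.
  exact: line_rintegrable (bsupp_sqr bW).
by rewrite Rintegral_cst// leI; lra.
Qed.

(** Averaging [W t - W s] over [s] in the cell compares [W t] with the mean of [W]: the square of
    the difference is at most [l] times the integral of [V ^+ 2]. The factors 2 come from splitting
    the square of a sum. *)
Lemma ac_line_cell a l : 0 < l ->
  \int[leb]_(r in `[a, a + l[) W r ^+ 2 <=
  2 / l * (\int[leb]_(r in `[a, a + l[) W r) ^+ 2 +
  2 * l ^+ 2 * \int[leb]_(r in `[a, a + l[) V r ^+ 2.
Proof.
move=> l0; pose D : set (measurableTypeR R) := `[a, a + l[%classic.
rewrite -/D; have mD : measurable D by exact: measurable_itv.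
have leD : (leb D = l%:E)%E.
  by rewrite lebesgue_measure_itv/= lte_fin ltrDl l0 -EFinD; congr EFin; lra.
have Doo : (leb D < +oo)%E by rewrite leD ltry.
set A := \int[leb]_(r in D) W r; set v := \int[leb]_(r in D) V r ^+ 2.
have iW : rintegrable leb D W by exact: line_rintegrable bW.
have osc s t : D s -> D t -> (W t - W s) ^+ 2 <= l * v.
  wlog st : s t / s <= t.
    move=> H Ds Dt; case: (leP s t) => [st|/ltW ts]; first exact: H.
    by rewrite -sqrrN opprB; exact: H.
  rewrite /D/= !in_itv/= => /andP[a1 a2] /andP[a3 a4].
  have -> : l = fine (leb D) by rewrite leD.
  apply: ac_line_osc_sqr => // r; rewrite /D/= !in_itv/=; lra.
have v0 : 0 <= v by apply: Rintegral_ge0 => x _; exact: sqr_ge0.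
have Wle t : D t -> W t ^+ 2 <= 2 * (A / l) ^+ 2 + 2 * (l * v).
  move=> Dt; have iWt : rintegrable leb D (fun s => W t - W s).
    by apply: rintegrableB => //; exact: rint_cst.
  have E : \int[leb]_(s in D) (W t - W s) = l * W t - A.
    by rewrite RintegralB//; [rewrite Rintegral_cst//= leD mulrC|exact: rint_cst].
  have L2t : L2 leb D (fun s => W t - W s).
    have [C WC] : exists C, forall x, `|W x| <= C by have [_ [C WC] _] := bW; exists C.
    apply: (@L2_bounded _ _ _ _ _ mD _ (C + C)) => //.
      exact: rintegrable_measurable iWt.
    by apply: aeW => s _; apply: le_trans (ler_normB _ _) (lerD _ _).
  have := sqr_Rintegral_le mD Doo L2t; rewrite E /= leD /=.
  have : sqn leb D (fun s => W t - W s) <= l * v * l.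
    rewrite (_ : l * v * l = \int[leb]_(s in D) (l * v)); last first.
      by rewrite Rintegral_cst//= leD.
    apply: le_Rintegral => //; [by case: L2t|exact: rint_cst|].
    by move=> s Ds; exact: osc.
  move=> /(ler_wpM2l (ltW l0)) h1 h2; have {h1 h2} := le_trans h2 h1.
  have -> : l * W t - A = l * (W t - A / l) by field; rewrite gt_eqF.
  rewrite exprMn (_ : l * (l * v * l) = l ^+ 2 * (l * v)); last by ring.
  rewrite ler_pM2l ?exprn_gt0// => h.
  by have := sqr_ge0 (W t - 2 * (A / l)); nra.
apply: (@le_trans _ _ (\int[leb]_(r in D) (2 * (A / l) ^+ 2 + 2 * (l * v)))).
  apply: le_Rintegral => //; last exact: rint_cst.
  exact: line_rintegrable (bsupp_sqr bW).
rewrite Rintegral_cst//= leD/= le_eqVlt; apply/orP; left; apply/eqP.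
by field; rewrite gt_eqF.
Qed.

Lemma ac_line_cells a l k : 0 < l ->
  \int[leb]_(r in `[a, a + k%:R * l[) W r ^+ 2 <=
  \sum_(j < k) (2 / l * (\int[leb]_(r in `[a + j%:R * l, a + j.+1%:R * l[) W r) ^+ 2) +
  2 * l ^+ 2 * \int[leb]_(r in `[a, a + k%:R * l[) V r ^+ 2.
Proof.
move=> l0; elim: k => [|k IH].
  rewrite mul0r addr0 set_itv_ge ?bnd_simp ?ltxx// !Rintegral_set0 big_ord0; lra.
have ak : a <= a + k%:R * l by rewrite lerDl mulr_ge0// ltW.
have kk : a + k%:R * l <= a + k.+1%:R * l.
  by rewrite lerD2l ler_pM2r// ler_nat.
have split_int (f : R -> R) : bsupp `[- L, L]%classic f ->
    \int[leb]_(r in `[a, a + k.+1%:R * l[) f r =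
    \int[leb]_(r in `[a, a + k%:R * l[) f r +
    \int[leb]_(r in `[a + k%:R * l, a + k.+1%:R * l[) f r.
  move=> bf; rewrite (@itv_bndbnd_setU _ _ _ (BLeft (a + k%:R * l))) ?bnd_simp//.
  rewrite Rintegral_setU//.
    apply: line_rintegrable bf.
    by apply: measurableU; exact: measurable_itv.
  apply/disj_setPS => r [/=]; rewrite !in_itv/= => /andP[_ ?] /andP[? _]; lra.
rewrite !split_int; [|exact: bsupp_sqr bV|exact: bsupp_sqr bW].
rewrite big_ord_recr/=.
have := ac_line_cell (a + k%:R * l) l0.
rewrite /= (_ : a + k%:R * l + l = a + k.+1%:R * l); last first.
  by rewrite -natr1; ring.
move: IH; set X := \sum_(_ < _) _; lra.
Qed.

End pair.

(** The functionals are the integrals over cells of length [l], normalized by the square root of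
    [2 / l] to match [ac_line_cell]; cells with [2 * l ^+ 2 <= e] are short enough. *)
Lemma ac_line_finite_rank (L e : R) : 0 <= L -> 0 < e ->
  exists (J : finType) (E : J -> R -> R),
  (forall j, measurable_fun setT (E j) /\ exists C, forall x, `|E j x| <= C) /\
  forall W V, ac_line L W V ->
    \int[leb]_r W r ^+ 2 <= \sum_j (\int[leb]_r (W r * E j r)) ^+ 2 +
      e * \int[leb]_r V r ^+ 2.
Proof.
(* [L + 1] in place of [L]: the half-open cells must cover the closed interval [[- L, L]], and [M]
   must be positive even when [L = 0]. *)
move=> L0 e0; pose M := 2 * (L + 1); have M0 : 0 < M by rewrite /M; lra.
have [k [k0 kP]] : exists k : nat, (0 < k)%N /\ 2 * (M / k%:R) ^+ 2 <= e.
  exists (Num.bound (2 * M ^+ 2 / e)).+1; split => //.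
  set k := (Num.bound _).+1; have k0 : 0 < k%:R :> R by rewrite ltr0n.
  have kb : 2 * M ^+ 2 / e < k%:R.
    apply: lt_le_trans (archi_boundP _) _; first by rewrite divr_ge0 ?(ltW e0)// mulr_ge0// sqr_ge0.
    by rewrite ler_nat.
  rewrite expr_div_n mulrA ler_pdivrMr ?exprn_gt0//.
  move: kb; rewrite ltr_pdivrMr// => kb.
  have k1 : 1 <= k%:R :> R by rewrite ler1n.
  by apply: le_trans (ltW kb) _; rewrite mulrC ler_pM2l// expr2 ler_peMl// ltW.
have k0R : 0 < k%:R :> R by rewrite ltr0n.
pose l := M / k%:R; have l0 : 0 < l by rewrite divr_gt0.
pose a := - (L + 1).
pose I (j : 'I_k) : set (measurableTypeR R) := `[a + j%:R * l, a + j.+1%:R * l[%classic.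
exists 'I_k, (fun j r => Num.sqrt (2 / l) * \1_(I j) r); split.
  move=> j; split.
    apply: measurable_funM => //; apply: measurable_indic; exact: measurable_itv.
  exists (Num.sqrt (2 / l)) => x; rewrite normrM ger0_norm ?sqrtr_ge0//.
  by rewrite ler_piMr ?sqrtr_ge0// indicE ger0_norm// lern1 leq_b1.
move=> W V WV; have [bW bV _] := WV.
have al : a + k%:R * l = L + 1 by rewrite /a /l /M; field; rewrite gt_eqF.
have big f : bsupp `[- L, L]%classic f -> \int[leb]_r f r = \int[leb]_(r in `[a, a + k%:R * l[) f r.
  move=> [mf bf f0]; apply: (@bsupp_RintegralE R _ (measurableTypeR R) _ leb); split => // x nx; apply: f0.
  by apply: contra_not nx; rewrite al /a /= !in_itv/=; lra.
rewrite (big _ (bsupp_sqr bW)) (big _ (bsupp_sqr bV)).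
apply: le_trans (ac_line_cells WV a k l0) _; apply: lerD.
  rewrite le_eqVlt; apply/orP; left; apply/eqP; apply: eq_bigr => j _.
  rewrite (_ : \int[leb]_r (W r * _) = Num.sqrt (2 / l) * \int[leb]_(r in I j) W r).
    by rewrite exprMn sqr_sqrtr// divr_ge0// ltW.
  rewrite [in RHS]Rintegral_mkcond -RintegralZl//; last first.
    suff : leb.-integrable setT (EFin \o (W \_ (I j))) by [].
    have mIj : measurable (I j) by exact: measurable_itv.
    rewrite -restrict_EFin; apply/(integrable_mkcond _ mIj).
    by apply: line_rintegrable bW; exact: measurable_itv.
  apply: eq_Rintegral => r _; rewrite patchE indicE.
  by case: (r \in I j); rewrite ?mulr1 ?mulr0// mulrC.
rewrite ler_wpM2r//; first by apply: Rintegral_ge0 => x _; exact: sqr_ge0.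
Qed.

End line_functions.

(** * Induction on the dimension *)

Section row_functions.
Context {R : realType}.
Local Notation lebr n := (@lebesgue_row R n).
Local Notation leb := (@lebesgue_measure R).

Definition upd n (x : 'rV[R]_n) (i : 'I_n) (t : R) : 'rV[R]_n :=
  \row_j (if j == i then t else x ord0 j).

Definition row_tail n (v : 'rV[R]_n.+1) : 'rV[R]_n := \row_j v ord0 (lift ord0 j).

Lemma row_tailE n t (y : 'rV[R]_n) : row_tail (row_cons (t, y)) = y.
Proof. by apply/rowP => j; rewrite !mxE liftK. Qed.

Lemma row_headE n t (y : 'rV[R]_n) : row_cons (t, y) ord0 ord0 = t.
Proof. by rewrite mxE unlift_none. Qed.

Lemma measurable_row_tail n : measurable_fun setT (@row_tail n).
Proof.
apply: measurable_fun_row => i; under eq_fun do rewrite mxE.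
exact: measurable_row_coord.
Qed.

Lemma upd_head n s t (y : 'rV[R]_n) : upd (row_cons (s, y)) ord0 t = row_cons (t, y).
Proof.
apply/rowP => j; rewrite !mxE; case: (unliftP ord0 j) => [k ->|->].
  by rewrite eq_sym (negbTE (neq_lift _ _)).
by rewrite eqxx.
Qed.

Lemma upd_tail n s t (y : 'rV[R]_n) i :
  upd (row_cons (s, y)) (lift ord0 i) t = row_cons (s, upd y i t).
Proof.
apply/rowP => j; rewrite !mxE; case: (unliftP ord0 j) => [k ->|->] /=.
  by rewrite (inj_eq lift_inj) mxE.
by [].
Qed.

(* Absolute continuity along the coordinate lines: unlike smoothness, this is
   inherited by the partial averages used in the induction on the dimension. *)
Definition ac_row L n (w : 'rV[R]_n -> R) (dw : 'I_n -> 'rV[R]_n -> R) :=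
  [/\ bsupp (cube L n) w, forall i, bsupp (cube L n) (dw i) &
   forall i x s t, s <= t ->
     w (upd x i t) - w (upd x i s) = \int[leb]_(r in `[s, t]) dw i (upd x i r)].

Definition bounded_mfun d (T : measurableType d) (e : T -> R) :=
  measurable_fun setT e /\ exists C, forall x, `|e x| <= C.

Lemma cube_rintegrable L n (f : 'rV[R]_n -> R) D : 0 <= L -> measurable D ->
  bsupp (cube L n) f -> rintegrable (lebr n) D f.
Proof.
move=> L0 mD bf.
exact: (bsupp_rintegrableS (@measurable_cube _ L n) (@lebesgue_cube _ L n L0) mD bf).
Qed.

Section succ.
Variables (L : R) (n : nat) (w : 'rV[R]_n.+1 -> R) (dw : 'I_n.+1 -> 'rV[R]_n.+1 -> R).
Hypotheses (L0 : 0 <= L) (aw : ac_row L w dw).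

Lemma ac_row_line y : ac_line L (fun t => w (row_cons (t, y))) (fun t => dw ord0 (row_cons (t, y))).
Proof.
have [bw bdw wdw] := aw; split; [exact: bsupp_row_slice2|exact: bsupp_row_slice2|].
move=> s t st; have := wdw ord0 (row_cons (0, y)) s t st; rewrite !upd_head => ->.
by apply: eq_Rintegral => r _; rewrite upd_head.
Qed.

Lemma ac_row_slice t : ac_row L (fun y => w (row_cons (t, y)))
  (fun j y => dw (lift ord0 j) (row_cons (t, y))).
Proof.
have [bw bdw wdw] := aw; split; [exact: bsupp_row_slice1|move=> i; exact: bsupp_row_slice1|].
move=> i y s s' ss'; have := wdw (lift ord0 i) (row_cons (t, y)) s s' ss'.
rewrite !upd_tail => ->.
by apply: eq_Rintegral => r _; rewrite upd_tail.
Qed.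

Lemma bsupp_weight e f : bounded_mfun e -> bsupp (cube L n.+1) f ->
  bsupp (cube L n.+1) (fun v => f v * e (row_tail v)).
Proof.
move=> [me [C eC]] bf; apply: bsuppM => //; last by exists C.
by apply: measurableT_comp me _; exact: measurable_row_tail.
Qed.

(** By Fubini, integrating out the other coordinates against a weight keeps the primitive relation
    in the first one. The one-dimensional inequality thus applies to the coefficients produced by
    the induction hypothesis. *)
Lemma ac_row_avg e : bounded_mfun e ->
  ac_line L (fun t => \int[lebr n]_y (w (row_cons (t, y)) * e y))
        (fun t => \int[lebr n]_y (dw ord0 (row_cons (t, y)) * e y)).
Proof.
move=> ge; have [bw bdw wdw] := aw; have bwe := bsupp_weight ge bw.
have bde := bsupp_weight ge (bdw ord0).
have E f t : \int[lebr n]_y (f (row_cons (t, y)) * e y) =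
    \int[lebr n]_y (f (row_cons (t, y)) * e (row_tail (row_cons (t, y)))).
  by apply: eq_Rintegral => y _; rewrite row_tailE.
under eq_fun do rewrite E; under [X in ac_line _ _ X]eq_fun do rewrite E.
split; [exact: bsupp_row1 bwe|exact: bsupp_row1 bde|move=> s t st].
have iw r : rintegrable (lebr n) setT
    (fun y => w (row_cons (r, y)) * e (row_tail (row_cons (r, y)))).
  by apply: (@cube_rintegrable L) => //; exact: (bsupp_row_slice1 bwe).
rewrite -RintegralB//; [|exact: iw|exact: iw].
(* The indicator extends the integral over the segment to the whole line, so that both orders of
   integration apply to a single function on rows. *)
pose f v := dw ord0 v * e (row_tail v) * \1_(`[s, t]%classic : set R) (v ord0 ord0).
have bf : bsupp (cube L n.+1) f.
  apply: bsuppM => //.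
    apply: measurableT_comp; first by apply: measurable_indic; exact: measurable_itv.
    exact: measurable_row_coord.
  by exists 1 => x; rewrite indicE ger0_norm// lern1 leq_b1.
have f1 := row_fubini1 L0 bf; have f2 := row_fubini2 L0 bf.
transitivity (\int[lebr n]_y \int[leb]_r f (row_cons (r, y))).
  apply: eq_Rintegral => y _; rewrite !row_tailE -mulrBl.
  have [_ _ ->//] := ac_row_line y.
  have mst : measurable (`[s, t]%classic : set (measurableTypeR R)) by exact: measurable_itv.
  rewrite -RintegralZr//; last exact: (line_rintegrable mst (bsupp_row_slice2 (bdw ord0) y)).
  rewrite Rintegral_mkcond; apply: eq_Rintegral => r _.
  rewrite patchE /f !row_tailE row_headE indicE.
  by case: (_ \in _); rewrite ?mulr1 ?mulr0.
rewrite -f2 f1 [RHS]Rintegral_mkcond; apply: eq_Rintegral => r _.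
rewrite patchE; case: ifPn => rst.
  by apply: eq_Rintegral => y _; rewrite /f row_headE indicE rst mulr1.
rewrite -[RHS](mul0r (fine (lebr n setT))) -Rintegral_cst//.
by apply: eq_Rintegral => y _; rewrite /f row_headE indicE (negbTE rst) mulr0.
Qed.

Lemma ac_row_poincare :
  \int[lebr n.+1]_v w v ^+ 2 <= (2 * L) ^+ 2 * \int[lebr n.+1]_v dw ord0 v ^+ 2.
Proof.
have [bw bdw _] := aw; have bw2 := bsupp_sqr bw; have bd2 := bsupp_sqr (bdw ord0).
rewrite (row_fubini2 L0 bw2) (row_fubini2 L0 bd2).
have i1 := cube_rintegrable L0 measurableT (bsupp_row2 L0 bw2).
have i2 := cube_rintegrable L0 measurableT (bsupp_row2 L0 bd2).
rewrite -RintegralZl//; apply: le_Rintegral => //; first exact: rintegrableZ.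
by move=> y _; exact: ac_line_poincare L0 (ac_row_line y).
Qed.

End succ.

Lemma ac_row_Rintegral0 L n w dw (i : 'I_n) : 0 <= L -> ac_row L w dw ->
  \int[lebr n]_v dw i v = 0.
Proof.
move=> L0; elim: n w dw i => [|n IH] w dw i aw; first by case: i.
have [_ bdw _] := aw; case: (unliftP ord0 i) => [j ->|->].
  rewrite (row_fubini1 L0 (bdw _)) -[RHS](mul0r (fine (leb setT))) -Rintegral_cst//.
  by apply: eq_Rintegral => t _; exact: (IH _ _ j (ac_row_slice aw t)).
rewrite (row_fubini2 L0 (bdw _)) -[RHS](mul0r (fine (lebr n setT))) -Rintegral_cst//.
by apply: eq_Rintegral => y _; exact: ac_line_Rintegral0 L0 (ac_row_line aw y).
Qed.

(* Quantitative Rellich: up to a small multiple of the gradient, the L^2 norm is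
   controlled by finitely many averages. *)
Lemma ac_row_finite_rank n L (eta : R) : 0 <= L -> 0 < eta ->
  exists (J : finType) (E : J -> 'rV[R]_n -> R), (forall j, bounded_mfun (E j)) /\
  forall w dw, ac_row L w dw ->
    \int[lebr n]_v w v ^+ 2 <= \sum_j (\int[lebr n]_v (w v * E j v)) ^+ 2 +
      eta * \sum_i \int[lebr n]_v dw i v ^+ 2.
Proof.
move=> L0; elim: n eta => [|n IH] eta eta0.
  exists 'I_1, (fun _ _ => 1); split; first by split => //; exists 1 => x; rewrite normr1.
  move=> w dw [[mw _ _] _ _]; rewrite big_ord1 big_ord0 mulr0 addr0.
  have E f : measurable_fun setT f -> \int[lebr 0]_v f v = f 0.
    move=> mf; rewrite /Rintegral /= integral_dirac//; last exact/measurable_EFinP.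
    by rewrite diracT mul1e.
  under [X in X ^+ 2]eq_Rintegral do rewrite mulr1.
  by rewrite !E//; exact: measurable_funX.
have e20 : 0 < eta / 2 by rewrite divr_gt0.
(* The induction hypothesis acts on the slice at height [t] and leaves finitely many coefficients
   [W j t]; the one-dimensional inequality in [t] is then applied to each of them. The resulting
   functionals are products of a weight in the tail and a weight in the head. *)
have [J [E [gE HE]]] := IH _ e20.
pose K j := sqn (lebr n) (cube L n) (E j).
have K0 j : 0 <= K j by exact: sqn_ge0.
have sK0 : 0 < 1 + \sum_j K j by rewrite ltr_pwDl// sumr_ge0.
(* By Cauchy-Schwarz the derivative of the coefficient [W j] costs [K j] times that of [w], so the
   one-dimensional error is multiplied by the sum of the [K j]; dividing by one plus that sum also
   avoids a zero denominator. *)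
have e10 : 0 < eta / 2 / (1 + \sum_j K j) by rewrite divr_gt0.
have [J1 [E1 [gE1 HE1]]] := ac_line_finite_rank L0 e10.
set e1 := eta / 2 / _ in e10 HE1.
exists (J * J1)%type, (fun p v => E p.1 (row_tail v) * E1 p.2 (v ord0 ord0)); split.
  move=> [j j1] /=; have [mE [C EC]] := gE j; have [mE1 [C1 EC1]] := gE1 j1; split.
    apply: measurable_funM; first by apply: measurableT_comp mE (@measurable_row_tail n).
    by apply: measurableT_comp mE1 _; exact: measurable_row_coord.
  by exists (C * C1) => v; rewrite normrM ler_pM.
move=> w dw aw; have [bw bdw _] := aw.
pose W j t := \int[lebr n]_y (w (row_cons (t, y)) * E j y).
pose V j t := \int[lebr n]_y (dw ord0 (row_cons (t, y)) * E j y).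
have WV j : ac_line L (W j) (V j) by exact: ac_row_avg (gE j).
have bW j : bsupp `[- L, L]%classic (W j) by have [] := WV j.
have bV j : bsupp `[- L, L]%classic (V j) by have [] := WV j.
pose G i t := \int[lebr n]_y dw i (row_cons (t, y)) ^+ 2.
have bG i : bsupp `[- L, L]%classic (G i) by exact: bsupp_row1 (bsupp_sqr (bdw i)).
have GE i : \int[lebr n.+1]_v dw i v ^+ 2 = \int[leb]_t G i t.
  exact: row_fubini1 L0 (bsupp_sqr (bdw i)).
have li f : bsupp `[- L, L]%classic f -> rintegrable leb setT f.
  exact: line_rintegrable.
have G0 i : 0 <= \int[leb]_t G i t.
  by apply: Rintegral_ge0 => t _; apply: Rintegral_ge0 => y _; exact: sqr_ge0.
have VG j t : V j t ^+ 2 <= K j * G ord0 t.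
  have bd := bsupp_row_slice1 (bdw ord0) t; have [mE [C EC]] := gE j.
  have mC := @measurable_cube R L n; have Coo := @lebesgue_cube R L n L0.
  have LE : L2 (lebr n) (cube L n) (E j).
    apply: (@L2_bounded _ _ _ _ _ mC _ C) => //; first exact: measurable_funS mE.
    by apply: aeW.
  have Ld : L2 (lebr n) (cube L n) (fun y => dw ord0 (row_cons (t, y))).
    split; last exact: cube_rintegrable L0 mC (bsupp_sqr bd).
    by have [md _ _] := bd; exact: measurable_funS md.
  have := cauchy_schwarz mC Ld LE.
  rewrite -(bsupp_RintegralE (lebr n) (bsuppM bd mE (ex_intro _ C EC))) => /le_trans; apply.
  rewrite mulrC ler_wpM2l ?K0// /G le_eqVlt; apply/orP; left; apply/eqP.
  exact: (esym (bsupp_RintegralE (lebr n) (bsupp_sqr bd))).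
rewrite (row_fubini1 L0 (bsupp_sqr bw)).
have bW2 : bsupp `[- L, L]%classic (fun t => \sum_j W j t ^+ 2).
  by apply: bsupp_sum => j; exact: bsupp_sqr.
have bGs : bsupp `[- L, L]%classic (fun t => \sum_(i < n) G (lift ord0 i) t).
  exact: bsupp_sum.
have ir : rintegrable leb setT (fun t => eta / 2 * \sum_(i < n) G (lift ord0 i) t).
  by apply: rintegrableZ => //; exact: li.
have il := li _ bW2.
apply: (@le_trans _ _ (\int[leb]_t (\sum_j W j t ^+ 2 +
    eta / 2 * \sum_(i < n) G (lift ord0 i) t))).
  apply: le_Rintegral => //.
  - exact: li (bsupp_row1 L0 (bsupp_sqr bw)).
  - exact: rintegrableD.
  - by move=> t _; exact: HE (ac_row_slice aw t).
rewrite RintegralD//.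
rewrite RintegralZl//; last exact: li.
rewrite Rintegral_sum//; last by move=> j; apply: li; exact: bsupp_sqr.
rewrite Rintegral_sum//; last by move=> i; exact: li.
have step j : \int[leb]_t W j t ^+ 2 <=
    \sum_j1 (\int[leb]_t (W j t * E1 j1 t)) ^+ 2 + e1 * (K j * \int[leb]_t G ord0 t).
  apply: le_trans (HE1 _ _ (WV j)) _; rewrite lerD2l ler_pM2l//.
  rewrite -RintegralZl//; last exact: li.
  apply: le_Rintegral => //; first by apply: li; exact: bsupp_sqr.
  by apply: rintegrableZ => //; exact: li.
apply: (@le_trans _ _ (\sum_j \sum_j1 (\int[leb]_t (W j t * E1 j1 t)) ^+ 2 +
    e1 * (\sum_j K j) * (\int[leb]_t G ord0 t) +
    eta / 2 * \sum_(i < n) \int[leb]_t G (lift ord0 i) t)).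
  rewrite lerD2r; apply: le_trans (ler_sum _ (fun j _ => step j)) _.
  by rewrite big_split/= lerD2l -mulr_sumr -mulr_suml mulrA.
rewrite -addrA; apply: lerD.
  rewrite pair_bigA/= le_eqVlt; apply/orP; left; apply/eqP.
  apply: eq_bigr => -[j j1] _ /=; congr (_ ^+ 2).
  have [mE1 [C1 EC1]] := gE1 j1.
  have b1 : bsupp (cube L n.+1) (fun v => w v * (E j (row_tail v) * E1 j1 (v ord0 ord0))).
    have -> : (fun v => w v * (E j (row_tail v) * E1 j1 (v ord0 ord0))) =
              (fun v => w v * E j (row_tail v) * E1 j1 (v ord0 ord0)).
      by apply/funext => v; rewrite mulrA.
    apply: bsuppM; [exact: bsupp_weight| |by exists C1].
    by apply: measurableT_comp mE1 _; exact: measurable_row_coord.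
  rewrite (row_fubini1 L0 b1); apply: eq_Rintegral => t _.
  rewrite /W -RintegralZr//.
    by apply: eq_Rintegral => y _; rewrite row_tailE row_headE mulrA.
  have [mE [C EC]] := gE j; apply: cube_rintegrable L0 measurableT _.
  by apply: bsuppM => //; [exact: bsupp_row_slice1 bw t|exists C].
rewrite [leRHS](_ : _ = eta * \int[leb]_t G ord0 t +
    eta * \sum_(i < n) \int[leb]_t G (lift ord0 i) t); last first.
  by rewrite -mulrDr big_ord_recl; congr (_ * (_ + _)); [|apply: eq_bigr => i _].
apply: lerD.
  rewrite ler_wpM2r// /e1 mulrAC ler_pdivrMr// -mulrA ler_pM2l//.
  have := sK0; have : 0 <= \sum_j K j by exact: sumr_ge0.
  by lra.
rewrite ler_wpM2r ?sumr_ge0//; lra.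
Qed.

End row_functions.

(** * Test functions along coordinate lines *)

Section test_functions.
Context {R : realType} {N : nat}.
Local Notation V := 'rV[R]_N.
Local Notation lebr n := (@lebesgue_row R n).
Local Notation leb := (@lebesgue_measure R).

Lemma bounded_cube (Om : set V) : bounded_set Om ->
  exists2 L, 0 <= L & Om `<=` cube L N.
Proof.
move=> [M [Mr OM]]; exists (`|M| + 1); first by rewrite addr_ge0.
move=> x Ox i; rewrite -ler_norml.
have M1 : M < `|M| + 1 by rewrite ltr_pwDr// ler_norm.
apply: le_trans (OM _ M1 x Ox); rewrite [leRHS](_ : _ = mx_norm x)// mx_normrE.
by apply: le_trans (le_bigmax _ _ (ord0, i)).
Qed.

Lemma bounded_support (f : V -> R) K : continuous f -> compact K ->
  (forall x, ~ K x -> f x = 0) -> exists C, forall x, `|f x| <= C.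
Proof.
move=> cf cK f0; have /compact_bounded[M [_ MK]] :=
  continuous_compact (continuous_subspaceT cf) cK.
exists (Num.max 0 (M + 1)) => x; have [Kx|/f0 ->] := pselect (K x); last first.
  by rewrite normr0 le_max lexx.
rewrite le_max; apply/orP; right; apply: (MK (M + 1)); first by rewrite ltrDl.
by exists x.
Qed.

Lemma updE (x : V) i t : upd x i t = upd x i 0 + t *: delta_mx ord0 i.
Proof.
apply/rowP => j; rewrite !mxE eqxx/=.
by case: (j == i); rewrite ?mulr1 ?mulr0 ?add0r ?addr0.
Qed.

Lemma upd_continuous (x : V) i : continuous (upd x i).
Proof.
move=> t; have -> : upd x i = (fun t => upd x i 0 + t *: delta_mx ord0 i).
  by apply/funext => s; exact: updE.
by apply: cvgD; [exact: cvg_cst|apply: cvgZ; [exact: cvg_id|exact: cvg_cst]].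
Qed.

Lemma upd_derivable (f : V -> R) x i t :
  derivable f (upd x i t) (delta_mx ord0 i) ->
  derivable (fun r => f (upd x i r)) t 1 /\
  'D_1 (fun r => f (upd x i r)) t = partial i f (upd x i t).
Proof.
have E : (fun h => h^-1 *: (((fun r => f (upd x i r)) \o shift t) (h *: 1) -
      f (upd x i t))) =
    (fun h => h^-1 *: ((f \o shift (upd x i t)) (h *: delta_mx ord0 i) - f (upd x i t))).
  apply/funext => h /=; congr (_ *: (f _ - _)).
  rewrite updE [in RHS]updE addrCA addrA -addrA -scalerDl.
  by rewrite [h%:A]mulr1 addrC.
by rewrite /derivable /partial /derive E.
Qed.

Lemma test_partial0 Om (f : V -> R) i x : test_function Om f ->
  ~ closure [set x | f x != 0] x -> partial i f x = 0.
Proof.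
move=> _ nx; rewrite /partial -(@derive_cst _ _ R 0 x (delta_mx ord0 i)).
apply: near_eq_derive.
have oC : open (~` closure [set x | f x != 0]) by exact/closed_openC/closed_closure.
have : nbhs x (~` closure [set x | f x != 0]).
  by apply: open_nbhs_nbhs; split.
apply: filterS => y ny; apply/eqP; apply/negP => /negP fy; apply: ny.
exact: subset_closure.
Qed.

Lemma test_ac_row Om L (f : V -> R) : Om `<=` cube L N -> test_function Om f ->
  ac_row L f (fun i => partial i f).
Proof.
move=> OmL tf; have [sf cf fO] := tf.
have f0 x : ~ closure [set x | f x != 0] x -> f x = 0.
  move=> nx; apply/eqP; apply/negP => /negP fx; apply: nx; exact: subset_closure.
have cL x : ~ cube L N x -> ~ closure [set x | f x != 0] x.
  by apply: contra_not => /fO/OmL.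
split.
- split; [exact: continuous_measurable_row (smooth_continuous sf)| |by move=> x /cL/f0].
  exact: bounded_support (smooth_continuous sf) cf f0.
- move=> i; have cp := @smooth_partial_continuous _ _ f sf i.
  have p0 x := @test_partial0 Om f i x tf.
  split; [exact: continuous_measurable_row cp| |by move=> x /cL/p0].
  exact: bounded_support cp cf p0.
move=> i x s t; rewrite le_eqVlt => /predU1P[->|st].
  by rewrite subrr set_itv1 Rintegral_set1.
have df r : derivable f (upd x i r) (delta_mx ord0 i) by exact: smooth_derivable.
have cl (g : V -> R) : continuous g -> continuous (fun r => g (upd x i r)).
  by move=> cg r; apply: continuous_comp; [exact: upd_continuous|exact: cg].
rewrite /Rintegral (@continuous_FTC2 _ (fun r => partial i f (upd x i r))
  (fun r => f (upd x i r)))//.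
- by apply: continuous_subspaceT; apply: cl; exact: smooth_partial_continuous.
- have c := cl _ (smooth_continuous sf).
  split; [by move=> r _; have [] := upd_derivable (df r)| |].
  + by apply: cvg_at_right_filter; exact: c.
  + by apply: cvg_at_left_filter; exact: c.
- by move=> r _; rewrite derive1E; have [_ ->] := upd_derivable (df r).
Qed.

Lemma testM_Rintegral0 Om (f g : V -> R) i : bounded_set Om ->
  test_function Om f -> smooth g ->
  \int[lebr N]_x (f x * partial i g x + g x * partial i f x) = 0.
Proof.
move=> /bounded_cube[L L0 OmL] tf sg.
have := ac_row_Rintegral0 i L0 (test_ac_row OmL (testM tf sg)) => <-.
apply: eq_Rintegral => x _; rewrite partialM//; last exact: smooth_derivable.
by have [sf _ _] := tf; exact: smooth_derivable.
Qed.

End test_functions.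

(** * The space H^1_0 *)

Section sobolev_space.
Context {R : realType} {N : nat}.
Local Notation V := 'rV[R]_N.
Local Notation leb := (@lebesgue_row R N).
Variable Om : set V.
Hypotheses (Om_open : open Om) (Om_bounded : bounded_set Om).
Implicit Types (u v w phi : V -> R) (g h : 'I_N -> V -> R).

Local Notation I f := (Rintegral leb Om f).
Local Notation sq u := (sqn leb Om u).
Local Notation "'L2O' u" := (L2 leb Om u) (at level 10, u at level 8).

Definition gsq g := \sum_i sq (g i).

Definition nsq u g := sq u + gsq g.

Lemma measurable_Om : measurable Om.
Proof. exact: open_measurable_row. Qed.
Hint Resolve measurable_Om : core.

Lemma Om_finite : (leb Om < +oo)%E.
Proof.
have [L L0 OL] := bounded_cube Om_bounded.
apply: le_lt_trans (@lebesgue_cube _ L N L0); apply: le_measure => //; rewrite inE.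
- exact: measurable_Om.
- exact: measurable_cube.
Qed.

Lemma gsq_ge0 g : 0 <= gsq g.
Proof. by apply: sumr_ge0 => i _; exact: sqn_ge0. Qed.

Lemma nsq_ge0 u g : 0 <= nsq u g.
Proof. by rewrite addr_ge0// ?sqn_ge0// gsq_ge0. Qed.

Lemma gsqD_le g h : (forall i, L2O (g i)) -> (forall i, L2O (h i)) ->
  gsq (fun i x => g i x + h i x) <= 2 * gsq g + 2 * gsq h.
Proof.
move=> Lg Lh; rewrite /gsq !mulr_sumr -big_split; apply: ler_sum => i _.
exact: sqnD_le.
Qed.

Lemma gsqB_le g h k : (forall i, L2O (g i)) -> (forall i, L2O (h i)) ->
  (forall i, L2O (k i)) ->
  gsq (fun i x => g i x - h i x) <=
  2 * gsq (fun i x => g i x - k i x) + 2 * gsq (fun i x => k i x - h i x).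
Proof.
move=> Lg Lh Lk; rewrite /gsq !mulr_sumr -big_split; apply: ler_sum => i _.
exact: sqnB_le.
Qed.

Lemma sq_le_gsq g i : sq (g i) <= gsq g.
Proof.
by rewrite /gsq (bigD1 i)//= lerDl sumr_ge0// => j _; exact: sqn_ge0.
Qed.

Lemma cvg_gsq0 (g_ : nat -> 'I_N -> V -> R) g :
  (forall i, cvgL2 leb Om (fun n => g_ n i) (g i)) ->
  gsq (fun i x => g_ n i x - g i x) @[n --> \oo] --> 0.
Proof.
move=> cg; rewrite /gsq; elim: (index_enum _) => [|i s IH].
  have : (fun _ : nat => 0 : R) @ \oo --> (0 : R) by exact: cvg_cst.
  apply: cvg_trans; apply: near_eq_cvg.
  by apply: nearW => n; rewrite big_nil.
have ci : sq (fun x => g_ n i x - g i x) @[n --> \oo] --> 0 by exact: cg.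
have -> : (fun n => \sum_(j <- i :: s) sq (fun x => g_ n j x - g j x)) =
    (fun n => sq (fun x => g_ n i x - g i x) +
              \sum_(j <- s) sq (fun x => g_ n j x - g j x)).
  by apply/funext => n; rewrite big_cons.
by rewrite -[X in _ --> X]addr0; exact: cvgD.
Qed.

Lemma H1sqnormE u g : L2O u -> (forall i, L2O (g i)) ->
  H1sqnorm Om u g = (nsq u g)%:E.
Proof.
move=> Lu Lg; rewrite /H1sqnorm EFinD (EFin_Rintegral measurable_Om (L2_sqr Lu)).
rewrite /gsq -sumEFin; congr (_ + _)%E; apply: eq_bigr => i _.
exact: (EFin_Rintegral measurable_Om (L2_sqr (Lg i))).
Qed.

Lemma H1normE u g : L2O u -> (forall i, L2O (g i)) ->
  H1norm Om u g = Num.sqrt (nsq u g).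
Proof. by move=> Lu Lg; rewrite /H1norm H1sqnormE. Qed.

Lemma Rintegral_support (f : V -> R) : (forall x, ~ Om x -> f x = 0) ->
  \int[leb]_x f x = I f.
Proof.
move=> f0; rewrite [RHS]Rintegral_mkcond; apply: eq_Rintegral => x _.
by rewrite patchE; case: ifPn => // /negP; rewrite inE => /f0.
Qed.

Section test.
Variable phi : V -> R.
Hypothesis tphi : test_function Om phi.

Lemma test_bounded_mfun : bounded_mfun phi /\ forall i, bounded_mfun (partial i phi).
Proof.
have [L L0 OL] := bounded_cube Om_bounded.
have [[m b _] bd _] := test_ac_row OL tphi; split; first by split.
by move=> i; have [mi bi _] := bd i; split.
Qed.

Lemma test_support x : ~ Om x -> phi x = 0.
Proof.
have [_ _ sO] := tphi; move=> nx; apply/eqP; apply/negP => /negP px; apply/nx/sO.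
exact: subset_closure.
Qed.

Lemma test_partial_support i x : ~ Om x -> partial i phi x = 0.
Proof.
by have [_ _ sO] := tphi; move=> nx; apply: (test_partial0 i tphi) => /sO.
Qed.

End test.

Lemma bounded_mfun_L2 (e : V -> R) : bounded_mfun e -> L2O e.
Proof.
move=> [me [C eC]]; apply: (L2_bounded measurable_Om (C := C) Om_finite).
  exact: measurable_funS me.
by apply: aeW.
Qed.

Lemma test_L2 phi : test_function Om phi -> L2O phi.
Proof. by move=> /test_bounded_mfun[/bounded_mfun_L2]. Qed.

Lemma test_partial_L2 phi i : test_function Om phi -> L2O (partial i phi).
Proof. by move=> /test_bounded_mfun[_ /(_ i)/bounded_mfun_L2]. Qed.

Lemma weak_gradientP u g : L2O u -> (forall i, L2O (g i)) ->
  weak_gradient Om u g <-> forall phi, test_function Om phi -> forall i,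
    I (fun x => u x * partial i phi x) = - I (fun x => g i x * phi x).
Proof.
move=> Lu Lg; split=> H phi tp i.
  by have /(congr1 fine) := H phi tp i; rewrite fineN; exact.
have L1 := test_L2 tp; have L3 := test_partial_L2 i tp.
rewrite (EFin_Rintegral measurable_Om (L2_mul measurable_Om Lu L3)).
by rewrite (EFin_Rintegral measurable_Om (L2_mul measurable_Om (Lg i) L1)) H.
Qed.

(** A form stable under further limits: real-valued integrals, and approximation at every accuracy
    instead of along a sequence. Choosing test functions at accuracies [1 / (n + 1)] gives the
    sequence back. *)
Lemma inH10P u g : inH10 Om u g <-> [/\ L2O u, forall i, L2O (g i),
  forall phi, test_function Om phi -> forall i,
    I (fun x => u x * partial i phi x) = - I (fun x => g i x * phi x) &
  forall e, 0 < e -> exists2 phi, test_function Om phi &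
    nsq (fun x => phi x - u x) (fun i x => partial i phi x - g i x) <= e].
Proof.
split.
  move=> [[Lu Lg /weak_gradientP wg] [phi_ [tp cp]]]; split => //; first exact: wg.
  move=> e e0; have E n : H1sqnorm Om (phi_ n \- u) (fun i => partial i (phi_ n) \- g i) =
      (nsq (fun x => phi_ n x - u x) (fun i x => partial i (phi_ n) x - g i x))%:E.
    apply: H1sqnormE; first exact: (L2B measurable_Om (test_L2 (tp n)) Lu).
    by move=> i; exact: (L2B measurable_Om (test_partial_L2 i (tp n)) (Lg i)).
  have : nsq (fun x => phi_ n x - u x) (fun i x => partial i (phi_ n) x - g i x)
      @[n --> \oo] --> 0.
    move: cp; under eq_fun do rewrite E.
    exact: fine_cvg.
  move=> /cvgr0Pnorm_le/(_ _ e0)[n _ /(_ n (leqnn _))] /=.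
  by rewrite ger0_norm ?nsq_ge0// => h; exists (phi_ n).
move=> [Lu Lg wg ap]; split; first by split => //; exact/weak_gradientP.
have ch n : {phi | test_function Om phi /\
    nsq (fun x => phi x - u x) (fun i x => partial i phi x - g i x) <= n.+1%:R^-1}.
  by apply: cid; have [|phi] := ap n.+1%:R^-1; [rewrite invr_gt0|exists phi].
exists (fun n => sval (ch n)); split; first by move=> n; case: (ch n) => ? [].
have E n : H1sqnorm Om (sval (ch n) \- u) (fun i => partial i (sval (ch n)) \- g i) =
    (nsq (fun x => sval (ch n) x - u x) (fun i x => partial i (sval (ch n)) x - g i x))%:E.
  have tp : test_function Om (sval (ch n)) by case: (ch n) => ? [].
  apply: H1sqnormE; first exact: (L2B measurable_Om (test_L2 tp) Lu).
  by move=> i; exact: (L2B measurable_Om (test_partial_L2 i tp) (Lg i)).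
under eq_fun do rewrite E.
apply: cvg_EFin; first exact: nearW.
apply: (@squeeze_cvgr _ _ _ _ (fun=> 0) (fun n => n.+1%:R^-1)).
- by apply: nearW => n /=; rewrite nsq_ge0/=; case: (ch n) => ? [].
- exact: cvg_cst.
- exact: cvg_harmonic.
Qed.

Lemma H10_L2 u g : inH10 Om u g -> L2O u.
Proof. by move=> /inH10P[]. Qed.

Lemma H10_gL2 u g : inH10 Om u g -> forall i, L2O (g i).
Proof. by move=> /inH10P[]. Qed.

Lemma test_H10 phi : test_function Om phi -> inH10 Om phi (fun i => partial i phi).
Proof.
move=> tp; apply/inH10P; split.
- exact: test_L2.
- by move=> i; exact: test_partial_L2.
- move=> psi tq i; have [sq _ _] := tq.
  have := testM_Rintegral0 i Om_bounded tp sq; rewrite Rintegral_support; last first.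
    by move=> x nx; rewrite (test_support tp)// (test_partial_support tp)// mul0r mulr0 addr0.
  rewrite RintegralD//.
  + rewrite (_ : I (fun x => psi x * _) = I (fun x => partial i phi x * psi x)).
      by move=> h; lra.
    by apply: eq_Rintegral => x _; rewrite mulrC.
  + by apply: L2_mul => //; [exact: test_L2|exact: test_partial_L2].
  + by apply: L2_mul => //; [exact: test_L2|exact: test_partial_L2].
- move=> e e0; exists phi => //; rewrite /nsq /gsq.
  have z : sq (fun=> 0) = 0 by rewrite /sqn expr0n/= Rintegral_cst// mul0r.
  rewrite (_ : (fun x => phi x - phi x) = fun=> 0); last by apply/funext => x; rewrite subrr.
  rewrite z add0r big1 ?ltW// => i _.
  rewrite (_ : (fun x => _) = fun=> 0)//; by apply/funext => x; rewrite subrr.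
Qed.

Lemma H10_closed (u_ : nat -> V -> R) (g_ : nat -> 'I_N -> V -> R) u g :
  (forall n, inH10 Om (u_ n) (g_ n)) -> L2O u -> (forall i, L2O (g i)) ->
  cvgL2 leb Om u_ u -> (forall i, cvgL2 leb Om (fun n => g_ n i) (g i)) ->
  inH10 Om u g.
Proof.
move=> Hn Lu Lg cu cg.
have Lun n := H10_L2 (Hn n); have Lgn n := H10_gL2 (Hn n).
apply/inH10P; split => //.
  move=> phi tp i; have Lp := test_L2 tp; have Lpp := test_partial_L2 i tp.
  have c1 := cvgL2_ip measurable_Om Lun Lu Lpp cu.
  have c2 := cvgL2_ip measurable_Om (fun n => Lgn n i) (Lg i) Lp (cg i).
  have /cvgN c3 := c2; apply: (cvg_unique _ c1) => //.
  suff -> : (fun n => I (fun x => u_ n x * partial i phi x)) =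
      (fun n => - I (fun x => g_ n i x * phi x)) by exact: c3.
  by apply/funext => n; have /inH10P[_ _ + _] := Hn n => ->.
move=> e e0.
have cn : nsq (fun x => u_ n x - u x) (fun i x => g_ n i x - g i x) @[n --> \oo] --> 0.
  rewrite -[X in _ --> X]addr0; apply: cvgD; first exact: cu.
  exact: cvg_gsq0.
have e4 : 0 < e / 4 by rewrite divr_gt0.
have /cvgr0Pnorm_le/(_ _ e4)[n _ /(_ n (leqnn _))] /= := cn.
rewrite ger0_norm ?nsq_ge0// => ne.
have /inH10P[_ _ _ /(_ _ e4)[phi tp pe]] := Hn n; exists phi => //.
apply: (@le_trans _ _ (2 * nsq (fun x => phi x - u_ n x) (fun i x => partial i phi x - g_ n i x)
   + 2 * nsq (fun x => u_ n x - u x) (fun i x => g_ n i x - g i x))); last by lra.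
have s1 := sqnB_le measurable_Om (test_L2 tp) Lu (Lun n).
have s2 := gsqB_le (fun i => test_partial_L2 i tp) Lg (Lgn n).
by rewrite /nsq; lra.
Qed.

Lemma H10_lin (a : R) u v g h : inH10 Om u g -> inH10 Om v h ->
  inH10 Om (fun x => a * u x + v x) (fun i x => a * g i x + h i x).
Proof.
move=> /inH10P[Lu Lg wu au] /inH10P[Lv Lh wv av]; apply/inH10P; split.
- by apply: L2D => //; exact: L2Z.
- by move=> i; apply: L2D => //; exact: L2Z.
- move=> phi tp i; have Lp := test_L2 tp; have Lpp := test_partial_L2 i tp.
  have i1 := L2_mul measurable_Om Lu Lpp; have i2 := L2_mul measurable_Om Lv Lpp.
  have i3 := L2_mul measurable_Om (Lg i) Lp; have i4 := L2_mul measurable_Om (Lh i) Lp.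
  have E (f k p : V -> R) : rintegrable leb Om (fun x => f x * p x) ->
      rintegrable leb Om (fun x => k x * p x) ->
      I (fun x => (a * f x + k x) * p x) = a * I (fun x => f x * p x) + I (fun x => k x * p x).
    move=> j1 j2; rewrite -RintegralZl// -RintegralD//; last exact: rintegrableZ.
    by apply: eq_Rintegral => x _; ring.
  by rewrite !E// wu// wv//; ring.
(* The two approximation errors enter with coefficients [2 * a ^+ 2] and [2]; [k] is twice their
   sum. *)
move=> e e0; pose k := 4 * (1 + a ^+ 2); have k0 : 0 < k.
  by rewrite mulr_gt0// ltr_pwDl// sqr_ge0.
have ek : 0 < e / k by rewrite divr_gt0.
have [phi tp pe] := au _ ek; have [psi tq qe] := av _ ek.
have tH := inH10P (fun x => a * phi x + psi x) (fun i x => a * partial i phi x + partial i psi x).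
have [sp cp sO] := tp; have [sq' cq sO'] := tq.
have tt : test_function Om (fun x => a * phi x + psi x).
  have cl : closure [set x | a * phi x + psi x != 0] `<=`
      closure [set x | phi x != 0] `|` closure [set x | psi x != 0].
    rewrite -closureU; apply: closure_subset => x /= ax.
    have [p0|p0] := eqVneq (phi x) 0; last by left.
    by right; apply: contra_neq ax => q0; rewrite p0 q0 mulr0 addr0.
  split.
  - apply/smoothP => n; apply: CkD; last exact: smooth_Ck.
    by apply: CkM; [exact: Ck_cst|exact: smooth_Ck].
  - apply: (subclosed_compact (@closed_closure _ _) (compactU cp cq) cl).
  - by move=> x /cl[]; [exact: sO|exact: sO'].
exists (fun x => a * phi x + psi x) => //.
have pE i x : partial i (fun x => a * phi x + psi x) x =
    a * partial i phi x + partial i psi x.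
  have dp : derivable phi x (delta_mx ord0 i) by exact: smooth_derivable.
  have dq : derivable psi x (delta_mx ord0 i) by exact: smooth_derivable.
  have dc : derivable (fun=> a : R) x (delta_mx ord0 i) by exact: (@derivable_cst _ _ R a x _).
  have dap : derivable (fun y => a * phi y) x (delta_mx ord0 i).
    exact: (@derivableM _ _ (fun=> a) phi).
  rewrite partialD// partialM// (_ : partial i (fun=> a) x = 0) ?mulr0 ?addr0//.
  exact: (@derive_cst _ _ R).
have cmp (f1 f2 k1 k2 : V -> R) : L2O f1 -> L2O f2 -> L2O k1 -> L2O k2 ->
    sq (fun x => (a * f1 x + f2 x) - (a * k1 x + k2 x)) <=
    2 * a ^+ 2 * sq (fun x => f1 x - k1 x) + 2 * sq (fun x => f2 x - k2 x).
  move=> l1 l2 l3 l4; have la := L2Z measurable_Om a (L2B measurable_Om l1 l3).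
  have := sqnD_le measurable_Om la (L2B measurable_Om l2 l4).
  rewrite (sqnZ measurable_Om _ (L2B measurable_Om l1 l3)) mulrA; apply: le_trans.
  rewrite le_eqVlt; apply/orP; left; apply/eqP; apply: eq_Rintegral => x _.
  by congr (_ ^+ 2); ring.
have c1 := cmp _ _ _ _ (test_L2 tp) (test_L2 tq) Lu Lv.
have c2 : gsq (fun i x => partial i (fun x => a * phi x + psi x) x - (a * g i x + h i x)) <=
    2 * a ^+ 2 * gsq (fun i x => partial i phi x - g i x) +
    2 * gsq (fun i x => partial i psi x - h i x).
  rewrite /gsq !mulr_sumr -big_split; apply: ler_sum => i _ /=.
  have := cmp _ _ _ _ (test_partial_L2 i tp) (test_partial_L2 i tq) (Lg i) (Lh i).
  by apply: le_trans; rewrite le_eqVlt; apply/orP; left; apply/eqP/eq_Rintegral => x _;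
    rewrite pE.
rewrite /nsq in pe qe *; have a20 := sqr_ge0 a.
have ee : e = 4 * (1 + a ^+ 2) * (e / k) by rewrite -/k mulrCA divff ?mulr1// gt_eqF.
apply: (le_trans (lerD c1 c2)); rewrite ee.
set t := e / k in pe qe ek *.
have := ler_wpM2l (mulr_ge0 (ler0n R 2) a20) pe; move: qe (mulr_ge0 a20 (ltW ek)) (ltW ek).
by lra.
Qed.

Lemma H10B u v g h : inH10 Om u g -> inH10 Om v h ->
  inH10 Om (fun x => u x - v x) (fun i x => g i x - h i x).
Proof.
move=> Hu Hv; have := H10_lin (-1) Hv Hu.
congr inH10; first by apply/funext => x; rewrite mulN1r addrC.
by apply/funext => i; apply/funext => x; rewrite mulN1r addrC.
Qed.

Lemma H10_0 : inH10 Om (fun=> 0) (fun _ _ => 0).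
Proof.
have t0 : test_function Om (fun=> 0 : R).
  have e0 : [set x : V | (0 : R) != 0] = set0.
    by apply/seteqP; split => x //=; rewrite eqxx.
  rewrite /test_function e0 closure0; split => //; last exact: compact0.
  by apply/smoothP => n; exact: Ck_cst.
have := test_H10 t0; congr inH10.
by apply/funext => i; apply/funext => x; exact: (@derive_cst _ _ R).
Qed.

Lemma test_finite_rank eta : 0 < eta ->
  exists (J : finType) (E : J -> V -> R), (forall j, bounded_mfun (E j)) /\
  forall phi, test_function Om phi ->
    sq phi <= \sum_j (I (fun x => phi x * E j x)) ^+ 2 +
      eta * gsq (fun i => partial i phi).
Proof.
move=> eta0; have [L L0 OL] := bounded_cube Om_bounded.
have [J [E [gE HE]]] := @ac_row_finite_rank R N L eta L0 eta0.
exists J, E; split => // phi tp; have := HE _ _ (test_ac_row OL tp).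
rewrite Rintegral_support; last by move=> x nx; rewrite (test_support tp)// expr0n.
move=> /le_trans; apply; rewrite le_eqVlt; apply/orP; left; apply/eqP.
congr (_ + _ * _); apply: eq_bigr => j _.
  by rewrite Rintegral_support// => x nx; rewrite (test_support tp)// mul0r.
by rewrite Rintegral_support// => x nx; rewrite (test_partial_support tp)// expr0n.
Qed.

Lemma H10_approx u g e : inH10 Om u g -> 0 < e -> exists phi,
  [/\ test_function Om phi, sq (fun x => phi x - u x) <= e,
      sq u <= 2 * sq phi + 2 * e & gsq (fun i => partial i phi) <= 2 * gsq g + 2 * e].
Proof.
move=> /inH10P[Lu Lg _ ap] /ap[phi tp pe]; exists phi.
have p1 : sq (fun x => phi x - u x) <= e.
  by apply: le_trans pe; rewrite lerDl gsq_ge0.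
have p2 : gsq (fun i x => partial i phi x - g i x) <= e.
  by apply: le_trans pe; rewrite lerDr sqn_ge0.
split => //.
  have := sqnD_le measurable_Om (test_L2 tp) (L2B measurable_Om Lu (test_L2 tp)).
  rewrite sqnN (_ : sq (fun x => _ + _) = sq u); last first.
    by apply: eq_Rintegral => x _; rewrite addrC subrK.
  by move: p1; lra.
have := gsqD_le Lg (fun i => L2B measurable_Om (test_partial_L2 i tp) (Lg i)).
rewrite (_ : gsq (fun i x => _ + _) = gsq (fun i => partial i phi)).
  by move: p2; lra.
by apply: eq_bigr => i _; apply: eq_Rintegral => x _; rewrite addrC subrK.
Qed.

Lemma H10_finite_rank eta : 0 < eta ->
  exists (J : finType) (E : J -> V -> R), (forall j, bounded_mfun (E j)) /\
  forall u g, inH10 Om u g ->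
    sq u <= 4 * \sum_j (I (fun x => u x * E j x)) ^+ 2 + 4 * eta * gsq g.
Proof.
move=> eta0; have [J [E [gE HE]]] := test_finite_rank eta0.
exists J, E; split => // u g Hu; have Lu := H10_L2 Hu.
(* [K] collects the coefficients of the approximation error: the first term comes from the
   functionals, the second from the gradient, and the last from replacing [u] by a test function. *)
pose K := 4 * \sum_j sq (E j) + 4 * eta + 2.
have K0 : 0 < K.
  rewrite ltr_pwDr// addr_ge0 ?mulr_ge0 ?sumr_ge0 ?ltW// => j _; exact: sqn_ge0.
apply/ler_addgt0Pr => e e0; have eK : 0 < e / K by rewrite divr_gt0.
have [phi [tp p1 p2 p3]] := H10_approx Hu eK.
have h := HE _ tp.
have s : \sum_j (I (fun x => phi x * E j x)) ^+ 2 <=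
    2 * \sum_j (I (fun x => u x * E j x)) ^+ 2 + 2 * (\sum_j sq (E j)) * (e / K).
  rewrite mulrAC -[_ * (e / K) * _]mulrA -!mulrDr mulr_sumr -big_split mulr_sumr.
  apply: ler_sum => j _ /=.
  have LE := bounded_mfun_L2 (gE j); have Ld := L2B measurable_Om (test_L2 tp) Lu.
  have := cauchy_schwarz measurable_Om Ld LE.
  set P := I (fun x => phi x * _); set U := I (fun x => u x * _).
  rewrite (_ : I (fun x => _ * _) = P - U); last first.
    rewrite -RintegralB//; [|apply: L2_mul => //; exact: test_L2|exact: L2_mul].
    by apply: eq_Rintegral => x _; rewrite mulrBl.
  have := ler_wpM2r (sqn_ge0 leb Om (E j)) p1; have := sqr_ge0 (P - 2 * U).
  by nra.
have ee : e = K * (e / K) by rewrite mulrCA divff ?mulr1// gt_eqF.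
rewrite [X in _ <= _ + X]ee {1}/K.
have := ler_wpM2l (ltW eta0) p3.
set S1 := \sum_j _ in s h *; set S2 := \sum_j _ in s *; set S3 := \sum_j _ in s *.
by move: p2 h s; nra.
Qed.

(** A single direction suffices, the first coordinate, and the positive dimension provides it.
    Density of the test functions then costs a factor 4. *)
Lemma H10_poincare : (0 < N)%N -> exists2 CP, 0 <= CP &
  forall u g, inH10 Om u g -> sq u <= CP * gsq g.
Proof.
move=> N0; have [L L0 OL] := bounded_cube Om_bounded.
have tP phi : test_function Om phi -> sq phi <= (2 * L) ^+ 2 * gsq (fun i => partial i phi).
  move=> tp; have ap := test_ac_row OL tp; pose i0 := Ordinal N0.
  have : \int[leb]_v phi v ^+ 2 <= (2 * L) ^+ 2 * \int[leb]_v partial i0 phi v ^+ 2.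
    move: N0 (phi) (ap) @i0; clear -L0; case: N => // n N0 phi ap /=.
    rewrite (_ : Ordinal N0 = ord0); last exact: val_inj.
    exact: ac_row_poincare L0 ap.
  rewrite Rintegral_support; last by move=> x nx; rewrite (test_support tp)// expr0n.
  rewrite Rintegral_support; last by move=> x nx; rewrite (test_partial_support tp)// expr0n.
  move/le_trans; apply; rewrite ler_wpM2l ?sqr_ge0//.
  exact: (sq_le_gsq (fun i => partial i phi)).
exists (4 * (2 * L) ^+ 2); first by rewrite mulr_ge0// sqr_ge0.
move=> u g Hu; apply/ler_addgt0Pr => e e0; have L2_0 := sqr_ge0 (2 * L).
pose K := 4 * (2 * L) ^+ 2 + 2; have K0 : 0 < K by rewrite /K; lra.
have eK : 0 < e / K by rewrite divr_gt0.
have [phi [tp p1 p2 p3]] := H10_approx Hu eK.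
have ee : e = K * (e / K) by rewrite mulrCA divff ?mulr1// gt_eqF.
rewrite [X in _ <= _ + X]ee {1}/K.
have := ler_wpM2l L2_0 p3; have := tP _ tp; move: p2.
by lra.
Qed.

Section dual.
Variable F : (V -> R) -> R.
Hypothesis FH : inHminus1 Om F.

Lemma dual_bound : exists2 C, 0 <= C & forall u g, inH10 Om u g ->
  `|F u| <= C * Num.sqrt (nsq u g).
Proof.
have [_ [C FC]] := FH; exists `|C| => // u g Hu; apply: le_trans (FC _ _ Hu) _.
rewrite H1normE; [|exact: H10_L2 Hu|exact: H10_gL2 Hu].
by rewrite ler_wpM2r// ?sqrtr_ge0// ler_norm.
Qed.

Lemma dualB u v g h : inH10 Om u g -> inH10 Om v h ->
  F (fun x => u x - v x) = F u - F v.
Proof.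
move=> Hu Hv; have [Flin _] := FH; have := Flin (-1) _ _ _ _ Hv Hu.
rewrite (_ : (fun x => _ + _) = fun x => u x - v x); first by move=> ->; ring.
by apply/funext => x; ring.
Qed.

Lemma dual_lin a u v g h : inH10 Om u g -> inH10 Om v h ->
  F (fun x => a * u x + v x) = a * F u + F v.
Proof. by move=> Hu Hv; have [+ _] := FH; apply; [exact: Hu|exact: Hv]. Qed.

Lemma dual_cvg (u_ : nat -> V -> R) (g_ : nat -> 'I_N -> V -> R) u g :
  (forall n, inH10 Om (u_ n) (g_ n)) -> inH10 Om u g ->
  cvgL2 leb Om u_ u -> (forall i, cvgL2 leb Om (fun n => g_ n i) (g i)) ->
  F (u_ n) @[n --> \oo] --> F u.
Proof.
move=> Hn Hu cu cg; have [C C0 FC] := dual_bound.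
apply/subr_cvg0; apply/norm_cvg0P.
apply: (@squeeze_cvgr _ _ _ _ (fun=> 0) (fun n => C * Num.sqrt
    (nsq (fun x => u_ n x - u x) (fun i x => g_ n i x - g i x)))).
- apply: nearW => n; rewrite normr_ge0/= -(dualB (Hn n) Hu).
  exact: FC (H10B (Hn n) Hu).
- exact: cvg_cst.
rewrite -[X in _ --> X](mulr0 C); apply: cvgM; first exact: cvg_cst.
rewrite -[X in _ --> X]sqrtr0; apply: continuous_cvg; first exact: sqrt_continuous.
rewrite -[X in _ --> X]addr0; apply: cvgD; first exact: cu.
exact: cvg_gsq0.
Qed.

End dual.
End sobolev_space.

(** * Limits in [L^2] *)

Section L2_convergence.
Context d {T : measurableType d} {R : realType}.
Variables (mu : {measure set T -> \bar R}) (D : set T).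
Hypothesis mD : measurable D.
Implicit Types (f g h : T -> R).

Local Notation I f := (Rintegral mu D f).
Local Notation "'aeD' x , P" := {ae mu, forall x, D x -> P}
  (at level 200, x name).

Lemma sqn0_ae f : L2 mu D f -> sqn mu D f = 0 -> aeD x, f x = 0.
Proof.
move=> [mf fi] f0; have mf2 : measurable_fun D (fun x => (f x ^+ 2)%:E).
  by apply/measurable_EFinP; exact: measurable_funX.
have := (ae_eq_integral_abs mu mD mf2).1 => /(_ _)/wrap[|].
  rewrite -[RHS]/(0%:E) -f0 -(EFin_Rintegral mD fi); apply: eq_integral => x _.
  by rewrite /= ger0_norm// sqr_ge0.
apply: filterS => x /[apply] /= -[] /eqP; rewrite sqrf_eq0 => /eqP; exact.
Qed.

Lemma cvgL2_unique (f_ : nat -> T -> R) f g : (forall n, L2 mu D (f_ n)) ->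
  L2 mu D f -> L2 mu D g -> cvgL2 mu D f_ f -> cvgL2 mu D f_ g -> aeD x, f x = g x.
Proof.
move=> Ln Lf Lg cf cg; have /sqn0_ae : L2 mu D (fun x => f x - g x) by exact: L2B.
move=> /(_ _)/wrap[|]; last by apply: filterS => x /[apply] /subr0_eq.
apply/eqP; rewrite eq_le sqn_ge0 andbT; apply/ler_addgt0Pr => e e0; rewrite add0r.
have e4 : 0 < e / 4 by rewrite divr_gt0.
move/cvgr0Pnorm_le : cf => /(_ _ e4)[n1 _ P1].
move/cvgr0Pnorm_le : cg => /(_ _ e4)[n2 _ P2].
have := P1 (maxn n1 n2) (leq_maxl _ _); have := P2 (maxn n1 n2) (leq_maxr _ _).
rewrite /= !ger0_norm ?sqn_ge0// => h1 h2.
have := sqnB_le mD Lf Lg (Ln (maxn n1 n2)); rewrite (sqnN _ _ f (f_ _)).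
by lra.
Qed.

Lemma cvgL2_ae_subseq (f_ : nat -> T -> R) f : (forall n, L2 mu D (f_ n)) ->
  L2 mu D f -> cvgL2 mu D f_ f -> exists s : nat -> nat,
    (forall k, (s k < s k.+1)%N) /\ (aeD x, f_ (s k) x @[k --> \oo] --> f x).
Proof.
move=> Ln Lf cf; have [g [Lg cg [s [ss fg]]]] := riesz_fischer mD Ln (cvgL2_cauchy mD Ln Lf cf).
exists s; split => //; have := cvgL2_unique Ln Lf Lg cf cg.
by apply: filterS2 fg => x fg E Dx; rewrite E//; exact: fg.
Qed.

Lemma cvgL2_dominated (f_ : nat -> T -> R) f g : (forall n, measurable_fun D (f_ n)) ->
  measurable_fun D f -> L2 mu D g -> (aeD x, f_ n x @[n --> \oo] --> f x) ->
  (aeD x, forall n, `|f_ n x - f x| <= `|g x|) -> cvgL2 mu D f_ f.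
Proof.
move=> mf_ mf [mg gi] ff fg.
have [|||||_] := @dominated_Rintegral _ _ _ mu D mD (fun n x => (f_ n x - f x) ^+ 2)
    (fun=> 0) (fun x => g x ^+ 2).
- by move=> n; apply: measurable_funX; exact: measurable_funB.
- exact: measurable_cst.
- by [].
- apply: filterS ff => x /[apply] ff.
  have c : f_ n x - f x @[n --> \oo] --> (0 : R) by apply/subr_cvg0.
  have c2 := cvgM c c; rewrite mulr0 in c2; exact: c2.
- apply: filterS fg => x fg Dx n.
  rewrite normrX -[leRHS]real_normK ?num_real// ler_sqr ?nnegrE//; exact: fg.
by rewrite Rintegral_cst// mul0r.
Qed.

Lemma cvgL2D (f_ g_ : nat -> T -> R) f g : (forall n, L2 mu D (f_ n)) ->
  (forall n, L2 mu D (g_ n)) -> L2 mu D f -> L2 mu D g ->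
  cvgL2 mu D f_ f -> cvgL2 mu D g_ g ->
  cvgL2 mu D (fun n x => f_ n x + g_ n x) (fun x => f x + g x).
Proof.
move=> Lfn Lgn Lf Lg cf cg.
apply: (@squeeze_cvgr _ _ _ _ (fun=> 0) (fun n =>
  2 * sqn mu D (fun x => f_ n x - f x) + 2 * sqn mu D (fun x => g_ n x - g x))).
- apply: nearW => n; rewrite sqn_ge0/=.
  apply: le_trans (sqnD_le mD (L2B mD (Lfn n) Lf) (L2B mD (Lgn n) Lg)).
  rewrite le_eqVlt; apply/orP; left; apply/eqP; apply: eq_Rintegral => x _.
  by congr (_ ^+ 2); ring.
- exact: cvg_cst.
have z : 2 * 0 + 2 * 0 = 0 :> R by ring.
by rewrite -[X in _ --> X]z; apply: cvgD; apply: cvgM => //; exact: cvg_cst.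
Qed.

End L2_convergence.

(** * Rellich's theorem and truncation in H^1_0 *)

Section sobolev_compactness.
Context {R : realType} {N : nat}.
Local Notation V := 'rV[R]_N.
Local Notation leb := (@lebesgue_row R N).
Variable Om : set V.
Hypotheses (Om_open : open Om) (Om_bounded : bounded_set Om).
Implicit Types (u v w phi : V -> R) (g h : 'I_N -> V -> R).

Local Notation I f := (Rintegral leb Om f).
Local Notation sq u := (sqn leb Om u).
Local Notation "'L2O' u" := (L2 leb Om u) (at level 10, u at level 8).
Let mOm := measurable_Om Om_open.

(** An ultrafilter [G] finer than the image of [U] converges in the compact segment. If the set of
    good indices were not in [U], its complement would be, and [G] would contain two disjoint
    sets. *)
Lemma ultra_cvg_bounded (U : set_system nat) (a : nat -> R) (M : R) :
  UltraFilter U -> (forall n, `|a n| <= M) ->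
  exists l, forall e, 0 < e -> U [set n | `|a n - l| <= e].
Proof.
move=> UU aM.
have cI : compact `[- M, M]%classic := @segment_compact R (- M) M.
have [G [GU UG]] := @ultraFilterLemma _ (fmap a U) _.
rewrite compact_ultra in cI.
have GI : G `[- M, M]%classic.
  apply: UG; rewrite /fmap /=; apply: filterS filterT => n _ /=.
  by rewrite in_itv/= -ler_norml.
have [l [_ Gl]] := cI G GU GI; exists l => e e0.
have Gle : G [set y | `|y - l| <= e].
  apply: Gl; apply/nbhs_ballP; exists e => //= y.
  by rewrite /ball/= distrC => /ltW.
have [//|nU] := in_ultra_setVsetC [set n | `|a n - l| <= e] UU.
have /UG GC : (fmap a U) (~` [set y | `|y - l| <= e]) by [].
have PG : ProperFilter G by exact: ultra_proper.
exfalso; have [G0 GF] := PG; apply: G0.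
by rewrite -(setICr [set y | `|y - l| <= e]); apply: filterI.
Qed.

(* Along an ultrafilter the averages of [H10_finite_rank] converge for all accuracies at
   once, so no diagonal extraction is needed. *)
Lemma rellich (u_ : nat -> V -> R) (g_ : nat -> 'I_N -> V -> R) (K : R) :
  (forall n, inH10 Om (u_ n) (g_ n)) -> (forall n, nsq Om (u_ n) (g_ n) <= K) ->
  exists u (s : nat -> nat), [/\ L2O u, (forall k, (s k < s k.+1)%N),
    cvgL2 leb Om (fun k => u_ (s k)) u &
    {ae leb, forall x, Om x -> u_ (s k) x @[k --> \oo] --> u x}].
Proof.
move=> Hn nK; have Lu n := H10_L2 Om_open Om_bounded (Hn n).
have Lg n := H10_gL2 Om_open Om_bounded (Hn n).
have uK n : sq (u_ n) <= K by apply: le_trans (nK n); rewrite lerDl gsq_ge0.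
have gK n : gsq Om (g_ n) <= K by apply: le_trans (nK n); rewrite lerDr sqn_ge0.
have K0 : 0 <= K by apply: le_trans (uK 0%N); exact: sqn_ge0.
have [U [UU ooU]] := @ultraFilterLemma _ (\oo : set_system nat) _.
have key e : 0 < e -> exists2 A, U A & forall n p, A n -> A p ->
    sq (fun x => u_ n x - u_ p x) <= e.
  (* A difference of two gradients has [gsq] at most [4 * K], so the gradient term
     [4 * eta * (4 * K)] is at most [e / 2]; [d] below is tuned to leave the other half for the
     averages. *)
  move=> e0; pose eta := e / (32 * (K + 1)); have K1 : 0 < K + 1 by rewrite ltr_wpDl.
  have eta0 : 0 < eta by rewrite divr_gt0// mulr_gt0.
  have [J [E [gE HE]]] := H10_finite_rank Om_open Om_bounded eta0.
  have LE j := bounded_mfun_L2 Om_open Om_bounded (gE j).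
  have al j : exists l, forall d, 0 < d ->
      U [set n | `|I (fun x => u_ n x * E j x) - l| <= d].
    apply: (ultra_cvg_bounded (M := K * sq (E j) + 1)) => n.
    have := cauchy_schwarz mOm (Lu n) (LE j).
    have := ler_wpM2r (sqn_ge0 leb Om (E j)) (uK n).
    set y := I _ => h1 h2.
    have h3 : `|y| ^+ 2 <= K * sq (E j) by rewrite real_normK ?num_real//; lra.
    have := normr_ge0 y; have := sqr_ge0 (`|y| - 1); nra.
  have {al}[l lP] := choice al.
  pose d := e / (32 * (#|J|%:R + 1)); have J1 : 0 < #|J|%:R + 1 :> R by rewrite ltr_wpDl.
  (* If two averages are within both 1 and [d] of their limit, the square of their difference is at
     most [2 * (2 * d)]: linear in [d], with no square root to choose. *)
  have dd0 : 0 < Num.min 1 d by rewrite lt_min ltr01 divr_gt0// mulr_gt0.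
  exists [set n | forall j, `|I (fun x => u_ n x * E j x) - l j| <= Num.min 1 d].
    apply: (@filter_forall _ J (fun j n => `|I (fun x => u_ n x * E j x) - l j| <= Num.min 1 d)).
    by move=> j; exact: lP.
  move=> n p An Ap; have := HE _ _ (H10B Om_open Om_bounded (Hn n) (Hn p)).
  have Ij j : (I (fun x => (u_ n x - u_ p x) * E j x)) ^+ 2 <= 4 * d.
    rewrite (_ : I _ = I (fun x => u_ n x * E j x) - I (fun x => u_ p x * E j x)); last first.
      rewrite -RintegralB//; [|exact: L2_mul|exact: L2_mul].
      by apply: eq_Rintegral => x _; rewrite mulrBl.
    have := An j; have := Ap j; rewrite /= !le_min.
    set a := I _; set b := I _ => /andP[b1 b2] /andP[a1 a2].
    have ab1 : `|a - b| <= 2.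
      by move/ler_normlP : a1 => []; move/ler_normlP : b1 => [] ? ? ? ?;
        apply/ler_normlP; split; lra.
    have ab2 : `|a - b| <= 2 * d.
      by move/ler_normlP : a2 => []; move/ler_normlP : b2 => [] ? ? ? ?;
        apply/ler_normlP; split; lra.
    rewrite -real_normK ?num_real// expr2 (_ : 4 * d = 2 * (2 * d)); last by ring.
    by rewrite distrC; apply: ler_pM.
  have gs : gsq Om (fun i x => g_ n i x - g_ p i x) <= 4 * K.
    have L0 (i : 'I_N) : L2O (fun=> 0 : R) by exact: (@L2_0 _ _ _ leb Om).
    have := gsqB_le (k := fun _ _ => 0) Om_open (Lg n) (Lg p) L0.
    have s1 : gsq Om (fun i x => g_ n i x - 0) = gsq Om (g_ n).
      by apply: eq_bigr => i _; apply: eq_Rintegral => x _; rewrite subr0.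
    have s2 : gsq Om (fun i x => 0 - g_ p i x) = gsq Om (g_ p).
      by apply: eq_bigr => i _; apply: eq_Rintegral => x _; rewrite sub0r sqrrN.
    by rewrite s1 s2; have := gK n; have := gK p; lra.
  have sj : \sum_j (I (fun x => (u_ n x - u_ p x) * E j x)) ^+ 2 <= #|J|%:R * (4 * d).
    apply: le_trans (ler_sum _ (fun j _ => Ij j)) _.
    by rewrite [leRHS]mulr_natl sumr_const.
  have e1 : #|J|%:R * (4 * d) <= e / 8.
    have -> : e / 8 = (#|J|%:R + 1) * (4 * d) by rewrite /d; field; rewrite gt_eqF.
    rewrite ler_pM2r ?lerDl// mulr_gt0// /d divr_gt0// mulr_gt0//.
  have e2 : 4 * eta * (4 * K) <= e / 2.
    have -> : e / 2 = 4 * eta * (4 * (K + 1)) by rewrite /eta; field; rewrite gt_eqF.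
    by apply: ler_wpM2l; [rewrite mulr_ge0// ltW|lra].
  have := ler_wpM2l (mulr_ge0 (ler0n R 4) (ltW eta0)) gs.
  by lra.
have cA k : {A | U A /\ forall n p, A n -> A p ->
    sq (fun x => u_ n x - u_ p x) <= k.+1%:R^-1}.
  by apply: cid; have [|A UA AP] := key k.+1%:R^-1; [rewrite invr_gt0|exists A].
(* Intersecting with the earlier sets makes an index taken at stage [n] good for every accuracy of
   rank [k <= n], which the Cauchy property needs. *)
pose B k := [set n | forall l : 'I_k.+1, sval (cA l) n].
have UB k : U (B k).
  apply: (@filter_forall _ _ (fun (l : 'I_k.+1) n => sval (cA l) n)).
  by move=> l; case: (svalP (cA l)).
have [k M|s [ss sB]] := @extract (fun k n => B k n).
  have UM : U [set n | (M <= n)%N] by apply: ooU; exists M.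
  by have [n [Bn Mn]] := filter_ex (filterI (UB k) UM); exists n.
have [|f [Lf cf [t [tt ft]]]] := @riesz_fischer _ _ _ leb Om mOm (fun k => u_ (s k)) (fun k => Lu _).
  move=> e e0; have [k ke] : exists k : nat, k.+1%:R^-1 <= e.
    exists (Num.bound e^-1); rewrite invf_ple ?posrE//.
    apply/ltW; apply: lt_trans (archi_boundP _) _; first by rewrite invr_ge0 ltW.
    by rewrite ltr_nat.
  exists k => n p kn kp; apply: le_trans ke; have [_] := svalP (cA k); apply.
    exact: (sB n (Ordinal (kn : (k < n.+1)%N))).
  exact: (sB p (Ordinal (kp : (k < p.+1)%N))).
exists f, (s \o t); split => //.
- move=> k /=; have : forall m n, (m < n)%N -> (s m < s n)%N.
    move=> m n; elim: n => // n IH; rewrite ltnS leq_eqVlt => /predU1P[->//|/IH].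
    by move=> /ltn_trans; apply.
  by apply; exact: tt.
- by apply: cvgL2_comp cf; exact: extract_cvg.
Qed.

(** Chain rule by density. For test functions [phi -> v], the gradient of the truncation splits into
    [dtrunc (phi)] times the gradient error, which tends to 0 because [dtrunc] is bounded by 1, and
    [dtrunc (phi) * h], which converges by domination along an a.e. convergent subsequence. *)
Lemma H10_trunc e v h : inH10 Om v h ->
  inH10 Om (fun x => trunc e (v x)) (fun i x => dtrunc e (v x) * h i x).
Proof.
move=> Hv; have Lv := H10_L2 Om_open Om_bounded Hv; have Lh := H10_gL2 Om_open Om_bounded Hv.
have [mv _] := Lv.
have ch n : {phi | test_function Om phi /\
    nsq Om (fun x => phi x - v x) (fun i x => partial i phi x - h i x) <= n.+1%:R^-1}.
  apply: cid; have /(inH10P Om_open Om_bounded)[_ _ _ ap] := Hv.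
  by have [|phi] := ap n.+1%:R^-1; [rewrite invr_gt0|exists phi].
pose phi n := sval (ch n).
have tphi n : test_function Om (phi n) by case: (svalP (ch n)).
have nphi n := (svalP (ch n)).2; rewrite -/(phi _) in nphi.
have Lp n := test_L2 Om_open Om_bounded (tphi n).
have Lpp n i := test_partial_L2 Om_open Om_bounded i (tphi n).
have cp : cvgL2 leb Om phi v.
  apply: (@squeeze_cvgr _ _ _ _ (fun=> 0) (fun n => n.+1%:R^-1)).
  - apply: nearW => n; rewrite sqn_ge0/=; apply: le_trans (nphi n).
    by rewrite lerDl gsq_ge0.
  - exact: cvg_cst.
  - exact: cvg_harmonic.
have cpp i : cvgL2 leb Om (fun n => partial i (phi n)) (h i).
  apply: (@squeeze_cvgr _ _ _ _ (fun=> 0) (fun n => n.+1%:R^-1)).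
  - apply: nearW => n; rewrite sqn_ge0/=; apply: le_trans (nphi n).
    apply: le_trans (sq_le_gsq Om (fun i x => partial i (phi n) x - h i x) i) _.
    by rewrite lerDr sqn_ge0.
  - exact: cvg_cst.
  - exact: cvg_harmonic.
have [s [ss ae]] := cvgL2_ae_subseq mOm Lp Lv cp.
have soo := extract_cvg ss.
have mT : measurable_fun [set: R] (trunc e) by apply: continuous_measurable_fun; exact: trunc_cont.
have mdT : measurable_fun [set: R] (dtrunc e) by apply: continuous_measurable_fun; exact: dtrunc_cont.
have LTv : L2O (fun x => trunc e (v x)).
  apply: (ae_le_L2 mOm _ Lv); first exact: measurableT_comp.
  by apply: aeW => x _; exact: trunc_le.
have mdv : measurable_fun Om (fun x => dtrunc e (v x)) by exact: measurableT_comp.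
have mdp n : measurable_fun Om (fun x => dtrunc e (phi (s n) x)).
  by apply: measurableT_comp => //; have [] := Lp (s n).
have d1 (f : V -> R) : {ae leb, forall x, Om x -> `|dtrunc e (f x)| <= 1}.
  by apply: aeW => x _; exact: dtrunc_le1.
have Ldh i : L2O (fun x => dtrunc e (v x) * h i x).
  exact: (L2_mul_bounded mOm mdv (d1 _) (Lh i)).
have tt n := (trunc_test e (tphi (s n))).1.
have pt n := (trunc_test e (tphi (s n))).2.
have Hn n := test_H10 Om_open Om_bounded (tt n).
apply: (H10_closed Om_open Om_bounded Hn LTv Ldh).
  have c := cvgL2_comp soo cp.
  apply: (@squeeze_cvgr _ _ _ _ (fun=> 0) (fun n => sq (fun x => phi (s n) x - v x))) => //.
    apply: nearW => n; rewrite sqn_ge0/=.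
    apply: (ae_le_sqn mOm (L2B mOm (test_L2 Om_open Om_bounded (tt n)) LTv) (L2B mOm (Lp _) Lv)).
    by apply: aeW => x _; exact: trunc_lip.
  exact: cvg_cst.
move=> i; have Lan n : L2O (fun x => dtrunc e (phi (s n) x) * (partial i (phi (s n)) x - h i x)).
  exact: (L2_mul_bounded mOm (mdp n) (d1 _) (L2B mOm (Lpp _ i) (Lh i))).
have Lbn n : L2O (fun x => dtrunc e (phi (s n) x) * h i x).
  exact: (L2_mul_bounded mOm (mdp n) (d1 _) (Lh i)).
have ca : cvgL2 leb Om (fun n x => dtrunc e (phi (s n) x) *
    (partial i (phi (s n)) x - h i x)) (fun=> 0).
  apply: (@squeeze_cvgr _ _ _ _ (fun=> 0) (fun n => sq (fun x => partial i (phi (s n)) x - h i x))).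
  - apply: nearW => n; rewrite sqn_ge0/=.
    apply: (ae_le_sqn mOm (L2B mOm (Lan n) (@L2_0 _ _ _ leb Om)) (L2B mOm (Lpp _ i) (Lh i))).
    by apply: aeW => x _; rewrite subr0 normrM ler_piMl// dtrunc_le1.
  - exact: cvg_cst.
  - exact: (cvgL2_comp soo (cpp i)).
have cb : cvgL2 leb Om (fun n x => dtrunc e (phi (s n) x) * h i x)
    (fun x => dtrunc e (v x) * h i x).
  apply: (cvgL2_dominated mOm (g := fun x => 2 * h i x)).
  - by move=> n; have [] := Lbn n.
  - by have [] := Ldh i.
  - exact: L2Z.
  - apply: filterS ae => x /[apply] px; apply: cvgM; last exact: cvg_cst.
    by apply: continuous_cvg px; exact: dtrunc_cont.
  - apply: aeW => x _ n; rewrite -mulrBl !normrM ler_wpM2r//.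
    apply: le_trans (ler_normB _ _) _; rewrite ger0_norm//.
    by have := dtrunc_le1 e (phi (s n) x); have := dtrunc_le1 e (v x); lra.
have := cvgL2D mOm Lan Lbn (@L2_0 _ _ _ leb Om) (Ldh i) ca cb.
congr cvgL2; first apply/funext => n; apply/funext => x; last by rewrite add0r.
by rewrite pt; ring.
Qed.

Lemma H10_trunc_cvg v h (e_ : nat -> R) : inH10 Om v h -> e_ n @[n --> \oo] --> 0 ->
  cvgL2 leb Om (fun n x => trunc (e_ n) (v x)) v /\
  forall i, cvgL2 leb Om (fun n x => dtrunc (e_ n) (v x) * h i x) (h i).
Proof.
move=> Hv e0; have Lv := H10_L2 Om_open Om_bounded Hv; have Lh := H10_gL2 Om_open Om_bounded Hv.
have Ln n := H10_trunc (e_ n) Hv.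
split.
  apply: (cvgL2_dominated mOm (g := fun x => 2 * v x)).
  - by move=> n; have [] := H10_L2 Om_open Om_bounded (Ln n).
  - by have [] := Lv.
  - exact: L2Z.
  - by apply: aeW => x _; exact: trunc_cvg.
  - apply: aeW => x _ n; apply: le_trans (ler_normB _ _) _; rewrite [leRHS]normrM (ger0_norm (ler0n R 2)).
    by have := trunc_le (e_ n) (v x); lra.
move=> i; apply: (cvgL2_dominated mOm (g := fun x => 2 * h i x)).
- by move=> n; have [] := H10_gL2 Om_open Om_bounded (Ln n) i.
- by have [] := Lh i.
- exact: L2Z.
- apply: aeW => x _; rewrite -[X in _ --> X]mul1r; apply: cvgM; last exact: cvg_cst.
  exact: dtrunc_cvg.
- apply: aeW => x _ n; rewrite -[X in _ - X]mul1r -mulrBl !normrM ler_wpM2r//.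
  apply: le_trans (ler_normB _ _) _; rewrite normr1 (ger0_norm (ler0n R 2)).
  by have := dtrunc_le1 (e_ n) (v x); lra.
Qed.

End sobolev_compactness.

(** * The state equation *)

Section state_equation.
Context {R : realType} {N : nat}.
Local Notation V := 'rV[R]_N.
Local Notation leb := (@lebesgue_row R N).
Variable Om : set V.
Hypotheses (Om_open : open Om) (Om_bounded : bounded_set Om) (N_gt0 : (0 < N)%N).
Variable F : (V -> R) -> R.
Hypothesis FH : inHminus1 Om F.
Implicit Types (u v w phi m : V -> R) (g h : 'I_N -> V -> R).

Local Notation I f := (Rintegral leb Om f).
Local Notation sq u := (sqn leb Om u).
Local Notation "'L2O' u" := (L2 leb Om u) (at level 10, u at level 8).
Local Notation rint f := (rintegrable leb Om f).
Let mOm := measurable_Om Om_open.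
Let HL2 u g (H : inH10 Om u g) := H10_L2 Om_open Om_bounded H.
Let HgL2 u g (H : inH10 Om u g) := H10_gL2 Om_open Om_bounded H.

Definition gdot g h := \sum_i I (fun x => g i x * h i x).

Lemma gdotE g h : (forall i, L2O (g i)) -> (forall i, L2O (h i)) ->
  rint (fun x => \sum_i g i x * h i x) /\
  I (fun x => \sum_i g i x * h i x) = gdot g h.
Proof.
move=> Lg Lh; have Li i := L2_mul mOm (Lg i) (Lh i); split.
  exact: rintegrable_sum.
exact: Rintegral_sum.
Qed.

Lemma gsqDZ t g h : (forall i, L2O (g i)) -> (forall i, L2O (h i)) ->
  gsq Om (fun i x => g i x + t * h i x) =
  gsq Om g + 2 * t * gdot g h + t ^+ 2 * gsq Om h.
Proof.
move=> Lg Lh; rewrite /gsq /gdot !mulr_sumr -!big_split; apply: eq_bigr => i _.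
exact: (sqnDZ mOm t (Lg i) (Lh i)).
Qed.

Lemma gdot_cvg (g_ : nat -> 'I_N -> V -> R) g h :
  (forall n i, L2O (g_ n i)) -> (forall i, L2O (g i)) -> (forall i, L2O (h i)) ->
  (forall i, cvgL2 leb Om (fun n => g_ n i) (g i)) ->
  gdot (g_ n) h @[n --> \oo] --> gdot g h.
Proof.
move=> Ln Lg Lh cg; rewrite /gdot; elim: (index_enum _) => [|i s IH].
  rewrite big_nil (_ : (fun n => _) = fun=> 0); first exact: cvg_cst.
  by apply/funext => n; rewrite big_nil.
rewrite big_cons (_ : (fun n => \sum_(j <- i :: s) _) =
  (fun n => I (fun x => g_ n i x * h i x) + \sum_(j <- s) I (fun x => g_ n j x * h j x))).
  by apply: cvgD IH; exact: (cvgL2_ip mOm (fun n => Ln n i) (Lg i) (Lh i) (cg i)).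
by apply/funext => n; rewrite big_cons.
Qed.

Lemma gdotC g h : gdot g h = gdot h g.
Proof. by apply: eq_bigr => i _; apply: eq_Rintegral => x _; rewrite mulrC. Qed.

Lemma gdotxx g : gdot g g = gsq Om g.
Proof. by []. Qed.

(** Poincare's inequality removes the [L^2] part of the norm, so that testing an equation with its
    own solution bounds the gradient. *)
Lemma dual_gbound : exists2 C, 0 <= C & forall u g, inH10 Om u g ->
  `|F u| <= C * Num.sqrt (gsq Om g).
Proof.
have [C C0 FC] := dual_bound Om_open Om_bounded FH.
have [P P0 HP] := H10_poincare Om_open Om_bounded N_gt0.
exists (C * Num.sqrt (P + 1)); first by rewrite mulr_ge0// sqrtr_ge0.
move=> u g Hu; apply: le_trans (FC _ _ Hu) _; rewrite -mulrA ler_wpM2l//.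
rewrite -sqrtrM; last by rewrite addr_ge0.
rewrite ler_wsqrtr// mulrDl mul1r /nsq lerD2r; exact: HP.
Qed.

Lemma quadratic_ge0 (b q : R) : 0 <= q ->
  (forall t, 0 <= 2 * t * b + t ^+ 2 * q) -> b = 0.
Proof.
move=> q0 H; have q1 : 0 < 1 + q by rewrite ltr_pwDl.
(* The minimizer [- b / q] is undefined at [q = 0]; with [1 + q] the value is still a negative
   multiple of [b ^+ 2]. *)
have := H (- b / (1 + q)).
rewrite (_ : _ + _ = - (b ^+ 2 * (2 + q)) / (1 + q) ^+ 2); last first.
  by field; rewrite gt_eqF.
rewrite pmulr_lge0 ?invr_gt0 ?exprn_gt0// oppr_ge0 => b2.
apply/eqP; rewrite -sqrf_eq0 eq_le sqr_ge0 andbT.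
have : 0 < 2 + q by lra.
by move=> q2; rewrite -(ler_pM2r q2) mul0r.
Qed.

Lemma L2w_rintegrable m v : admissible Om m -> inL2w Om m v ->
  rint (fun x => m x * v x ^+ 2).
Proof.
move=> [mi m0] [mv vf]; have mm := rintegrable_measurable mi.
have mmv : measurable_fun Om (fun x => m x * v x ^+ 2).
  by apply: measurable_funM => //; exact: measurable_funX.
apply/integrableP; split; first exact/measurable_EFinP.
rewrite (ae_eq_integral (fun x => (m x * v x ^+ 2)%:E)) //.
- by apply: measurableT_comp => //; exact/measurable_EFinP.
- exact/measurable_EFinP.
- apply: filterS m0 => x m0 Dx /=.
  by rewrite ger0_norm// mulr_ge0 ?sqr_ge0// m0.
Qed.

Lemma rintegrable_L2w m v : measurable_fun Om v ->
  rint (fun x => m x * v x ^+ 2) -> inL2w Om m v.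
Proof.
by move=> mv vi; split => //; rewrite (EFin_Rintegral mOm vi) ltry.
Qed.

Lemma rintegrable_muv m u v : admissible Om m -> measurable_fun Om u ->
  measurable_fun Om v -> rint (fun x => m x * u x ^+ 2) ->
  rint (fun x => m x * v x ^+ 2) -> rint (fun x => m x * u x * v x).
Proof.
move=> [mi m0] mu mv ui vi; have mm := rintegrable_measurable mi.
apply: (ae_le_rintegrable mOm _ (rintegrableD mOm ui vi)).
  by apply: measurable_funM => //; exact: measurable_funM.
apply: filterS m0 => x m0 Dx; have mx := m0 Dx.
rewrite -mulrA normrM ger0_norm// -mulrDr ler_wpM2l// normrM.
rewrite -[u x ^+ 2]real_normK ?num_real// -[v x ^+ 2]real_normK ?num_real//.
have := sqr_ge0 (`|u x| - `|v x|); have := normr_ge0 (u x); have := normr_ge0 (v x).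
by nra.
Qed.

Lemma stateP m u : admissible Om m -> state Om F m u <-> exists g,
  [/\ inH10 Om u g, rint (fun x => m x * u x ^+ 2) &
    forall v h, inH10 Om v h -> rint (fun x => m x * v x ^+ 2) ->
      gdot g h + I (fun x => m x * u x * v x) = F v].
Proof.
move=> am; split=> -[g [Hu ui eq]]; exists g; split => //.
- exact: L2w_rintegrable.
- move=> v h Hv vi; have ui' := L2w_rintegrable am ui.
  have wv := rintegrable_L2w (L2_measurable (HL2 Hv)) vi.
  have := congr1 fine (eq v h Hv wv); rewrite /= => <-.
  have [di <-] := gdotE (HgL2 Hu) (HgL2 Hv).
  rewrite -RintegralD//.
  exact: (rintegrable_muv am (L2_measurable (HL2 Hu)) (L2_measurable (HL2 Hv)) ui' vi).
- by apply: rintegrable_L2w => //; exact: (L2_measurable (HL2 Hu)).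
- move=> v h Hv wv; have vi := L2w_rintegrable am wv; rewrite -(eq _ _ Hv vi).
  have [di <-] := gdotE (HgL2 Hu) (HgL2 Hv).
  have mi := rintegrable_muv am (L2_measurable (HL2 Hu)) (L2_measurable (HL2 Hv)) ui vi.
  by rewrite -RintegralD// -(EFin_Rintegral mOm (rintegrableD mOm di mi)).
Qed.

(** Tested with [u], the equation gives [s^2 + int m u^2 <= C s] for the norm [s] of the gradient,
    hence [s <= C]; Poincare's constant [P] accounts for the [L^2] norm. The constant [K] depends on
    neither [m] nor [u]. *)
Lemma state_bound : exists K, forall m u, admissible Om m -> state Om F m u ->
  exists g, [/\ inH10 Om u g, rint (fun x => m x * u x ^+ 2),
    forall v h, inH10 Om v h -> rint (fun x => m x * v x ^+ 2) ->
      gdot g h + I (fun x => m x * u x * v x) = F v,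
    nsq Om u g <= K & I (fun x => m x * u x ^+ 2) <= K].
Proof.
have [C C0 FC] := dual_gbound.
have [P P0 HP] := H10_poincare Om_open Om_bounded N_gt0.
exists ((P + 1) * C ^+ 2) => m u am /(stateP _ am)[g [Hu ui eq]].
exists g; have := eq _ _ Hu ui; rewrite gdotxx.
have -> : I (fun x => m x * u x * u x) = I (fun x => m x * u x ^+ 2).
  by apply: eq_Rintegral => x _; rewrite expr2 mulrA.
have mu0 : 0 <= I (fun x => m x * u x ^+ 2).
  apply: (ae_Rintegral_ge0 mOm ui); have [_] := am.
  by apply: filterS => x m0 Dx; rewrite mulr_ge0 ?sqr_ge0// m0.
move=> e; have := FC _ _ Hu; rewrite -e ger0_norm ?addr_ge0 ?gsq_ge0//.
have := sqr_sqrtr (gsq_ge0 Om g); have := sqrtr_ge0 (gsq Om g).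
set s := Num.sqrt _; set G := gsq Om g => s0 sG; rewrite -sG => b.
have sC : s <= C.
  have [s00|s00] := eqVneq s 0; first by rewrite s00.
  have sp : 0 < s by rewrite lt_neqAle eq_sym s00.
  by rewrite -(ler_pM2r sp); nra.
have sC2 : s ^+ 2 <= C ^+ 2 by rewrite ler_sqr ?nnegrE.
have PC : 0 <= P * C ^+ 2 by rewrite mulr_ge0 ?sqr_ge0.
split => //.
  rewrite /nsq; have := HP _ _ Hu; rewrite -/G -sG => h.
  have := ler_wpM2l P0 sC2; lra.
have : C * s <= C ^+ 2 by rewrite expr2 ler_wpM2l.
have := sqr_ge0 s; lra.
Qed.

Lemma admissible_cst c : 0 <= c -> admissible Om (fun=> c).
Proof.
by move=> c0; split; [exact: (rint_cst mOm _ (Om_finite Om_open Om_bounded))|exact: aeW].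
Qed.

(* Dirichlet's principle: minimizing sequences of the energy are Cauchy by the
   parallelogram identity. *)
Lemma state_zero : exists u, state Om F (fun=> 0) u.
Proof.
have [C C0 FC] := dual_gbound.
have [P P0 HP] := H10_poincare Om_open Om_bounded N_gt0.
pose S := [set y | exists u g, inH10 Om u g /\ y = gsq Om g - 2 * F u].
have S0 : S !=set0.
  by exists (gsq Om (fun _ _ => 0) - 2 * F (fun=> 0)), (fun=> 0), (fun _ _ => 0);
    split => //; exact: H10_0.
have Slb y : S y -> - C ^+ 2 <= y.
  move=> [u [g [Hu ->]]]; have := FC _ _ Hu => /ler_normlP[_].
  have := sqr_sqrtr (gsq_ge0 Om g); set s := Num.sqrt _ => <-.
  by have := sqr_ge0 (s - C); lra.
have hS : has_inf S by split => //; exists (- C ^+ 2) => y /Slb.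
set i0 := inf S.
have lb u g : inH10 Om u g -> i0 <= gsq Om g - 2 * F u.
  by move=> Hu; apply: ge_inf; [case: hS|exists u, g].
have ch n : {p : (V -> R) * ('I_N -> V -> R) | inH10 Om p.1 p.2 /\
    gsq Om p.2 - 2 * F p.1 <= i0 + n.+1%:R^-1}.
  apply: cid; have n0 : 0 < n.+1%:R^-1 :> R by rewrite invr_gt0.
  have [_ [u [g [Hu ->]]] lt] := inf_adherent n0 hS.
  by exists (u, g); split => //; exact: ltW.
pose u_ n := (sval (ch n)).1; pose g_ n := (sval (ch n)).2.
have Hn n : inH10 Om (u_ n) (g_ n) by case: (svalP (ch n)).
have En n : gsq Om (g_ n) - 2 * F (u_ n) <= i0 + n.+1%:R^-1 by case: (svalP (ch n)).
(* Comparison of the near-minimizer with its perturbation by [t v]: an approximate Euler equation,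
   from which [quadratic_ge0] extracts the exact one in the limit. *)
have var n v h t : inH10 Om v h ->
    - n.+1%:R^-1 <= 2 * t * (gdot (g_ n) h - F v) + t ^+ 2 * gsq Om h.
  move=> Hv; have Hl := H10_lin Om_open Om_bounded t Hv (Hn n).
  have := lb _ _ Hl; rewrite (dual_lin FH _ Hv (Hn n)).
  rewrite (_ : gsq Om _ = gsq Om (fun i x => g_ n i x + t * h i x)); last first.
    by apply: eq_bigr => i _; apply: eq_Rintegral => x _; rewrite addrC.
  rewrite (gsqDZ _ (HgL2 (Hn n)) (HgL2 Hv)); have := En n.
  by set r := n.+1%:R^-1; set b := gdot _ _; set q := gsq _ h; set p := gsq _ _; nra.
have gc n p : gsq Om (fun i x => g_ n i x - g_ p i x) <= 2 * n.+1%:R^-1 + 2 * p.+1%:R^-1.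
  have Hd := H10B Om_open Om_bounded (Hn n) (Hn p).
  have Lp := HgL2 (Hn p); have Ld := HgL2 Hd.
  have e1 := gsqDZ 1 Lp Ld.
  (* Half the difference added to the [p]-th term is the midpoint, whose energy is at least the
     infimum. *)
  have h3 := lb _ _ (H10_lin Om_open Om_bounded 2^-1 Hd (Hn p)).
  rewrite (dual_lin FH _ Hd (Hn p)) (dualB FH (Hn n) (Hn p)) in h3.
  rewrite (_ : gsq Om _ = gsq Om (fun i x => g_ p i x + 2^-1 * (g_ n i x - g_ p i x))) in h3; last first.
    by apply: eq_bigr => i _; apply: eq_Rintegral => x _; rewrite addrC.
  rewrite (gsqDZ _ Lp Ld) in h3.
  rewrite (_ : gsq Om (fun i x => _ + 1 * _) = gsq Om (g_ n)) in e1; last first.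
    by apply: eq_bigr => i _; apply: eq_Rintegral => x _; rewrite mul1r addrC subrK.
  have := En n; have := En p; move: h3 e1.
  set q := gsq Om (fun i x => g_ n i x - g_ p i x).
  set b := gdot _ _; set r := n.+1%:R^-1; set r' := p.+1%:R^-1.
  rewrite expr1n expr2 mul1r; lra.
have inv_small e : 0 < e -> exists n0, forall n, (n0 <= n)%N -> n.+1%:R^-1 <= e :> R.
  move=> e0; have /cvgr0Pnorm_le/(_ _ e0)[n0 _ H] := @cvg_harmonic R.
  by exists n0 => n /H /=; rewrite ger0_norm.
have gcauchy e : 0 < e -> exists n0, forall n p, (n0 <= n)%N -> (n0 <= p)%N ->
    gsq Om (fun i x => g_ n i x - g_ p i x) <= e.
  move=> e0; have [|n0 H] := inv_small (e / 4); first by rewrite divr_gt0.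
  exists n0 => n p /H hn /H hp; apply: le_trans (gc n p) _; move: hn hp.
  by set r := n.+1%:R^-1; set r' := p.+1%:R^-1; lra.
have [i|u [Lu cu _]] := @riesz_fischer _ _ _ leb Om mOm u_ (fun n => HL2 (Hn n)).
  move=> i0'; have P1 : 0 < P + 1 by rewrite ltr_wpDl.
  have [|n0 H] := gcauchy (i / (P + 1)); first by rewrite divr_gt0.
  exists n0 => n p /H /[apply] h.
  apply: le_trans (HP _ _ (H10B Om_open Om_bounded (Hn n) (Hn p))) _.
  have := ler_wpM2l P0 h => /le_trans; apply.
  by rewrite mulrCA ler_piMr ?(ltW i0')// ler_pdivrMr// mul1r lerDl.
have gex i : exists gi, L2O gi /\ cvgL2 leb Om (fun n => g_ n i) gi.
  have [e e0|gi [Lgi cgi _]] := @riesz_fischer _ _ _ leb Om mOm (fun n => g_ n i)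
      (fun n => HgL2 (Hn n) i).
    have [n0 H] := gcauchy e e0; exists n0 => n p /H /[apply]; apply: le_trans.
    exact: (sq_le_gsq Om (fun i x => g_ n i x - g_ p i x)).
  by exists gi.
have {gex}[g gP] := choice gex.
have Lg i := (gP i).1; have cg i := (gP i).2.
have Hu := H10_closed Om_open Om_bounded Hn Lu Lg cu cg.
exists u; apply/(stateP _ (admissible_cst (lexx 0))); exists g.
have z0 w : (fun x => 0 * w x ^+ 2) = (fun=> 0) :> (V -> R).
  by apply/funext => x; rewrite mul0r.
split => //; first by rewrite z0; exact: rintegrable0.
move=> v h Hv _; have -> : I (fun x => 0 * u x * v x) = 0.
  rewrite -[RHS](mul0r (fine (leb Om))) -Rintegral_cst//.
  by apply: eq_Rintegral => x _; rewrite !mul0r.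
rewrite addr0; apply/eqP; rewrite -subr_eq0; apply/eqP.
apply: (quadratic_ge0 (gsq_ge0 Om h)) => t.
have c := gdot_cvg (fun n => HgL2 (Hn n)) Lg (HgL2 Hv) cg.
have c0 : - n.+1%:R^-1 @[n --> \oo] --> (- 0 : R) by apply: cvgN; exact: cvg_harmonic.
rewrite -[0]oppr0; apply: (ler_cvg_to c0 (g := fun n => 2 * t * (gdot (g_ n) h - F v) +
    t ^+ 2 * gsq Om h)).
- apply: cvgD; last exact: cvg_cst.
  by apply: cvgM; [exact: cvg_cst|apply: cvgB => //; exact: cvg_cst].
- by apply: nearW => n; exact: var.
Qed.

End state_equation.

(** * Forward convex combinations *)

(* [ev t s] is the convex combination of the terms of [s] with the dyadic weights
   encoded by the binary tree [t]; iterated midpoints suffice because only the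
   parallelogram argument is needed to extract convergent combinations. *)
Inductive dtree := Leaf of nat | Node of dtree & dtree.

Section convex_combinations.
Context {R : realType}.
Implicit Types (s : nat -> R) (t : dtree).

Fixpoint ev t s : R :=
  match t with Leaf n => s n | Node a b => (ev a s + ev b s) / 2 end.

Fixpoint above n t : bool :=
  match t with Leaf k => (n <= k)%N | Node a b => above n a && above n b end.

Lemma above_le n k t : (n <= k)%N -> above k t -> above n t.
Proof.
move=> nk; elim: t => [i|a IHa b IHb] /=; first exact: leq_trans.
by move=> /andP[/IHa -> /IHb ->].
Qed.

Lemma above0 t : above 0 t.
Proof. by elim: t => //= a -> b ->. Qed.

Lemma ev_le n t s s' : above n t -> (forall i, (n <= i)%N -> s i <= s' i) ->
  ev t s <= ev t s'.
Proof.
move=> + ss; elim: t => [i|a IHa b IHb] /=; first exact: ss.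
by move=> /andP[/IHa h /IHb h']; lra.
Qed.

Lemma ev_eq t s s' : (forall i, s i = s' i) -> ev t s = ev t s'.
Proof. by move=> ss; elim: t => [i|a IHa b IHb] /=; [exact: ss|rewrite IHa IHb]. Qed.

Lemma ev_cst t (c : R) : ev t (fun=> c) = c.
Proof. by elim: t => [//|a IHa b IHb] /=; lra. Qed.

Lemma evD t s s' : ev t (fun i => s i + s' i) = ev t s + ev t s'.
Proof. by elim: t => [//|a IHa b IHb] /=; lra. Qed.

Lemma evZ t (c : R) s : ev t (fun i => c * s i) = c * ev t s.
Proof. by elim: t => [//|a IHa b IHb] /=; rewrite IHa IHb; lra. Qed.

Lemma evZr t (c : R) s : ev t (fun i => s i * c) = ev t s * c.
Proof. by rewrite [RHS]mulrC -evZ; apply: ev_eq => i; rewrite mulrC. Qed.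

Lemma evB t s s' : ev t (fun i => s i - s' i) = ev t s - ev t s'.
Proof. by elim: t => [//|a IHa b IHb] /=; lra. Qed.

Lemma ev_ge0 t s : (forall i, 0 <= s i) -> 0 <= ev t s.
Proof. by move=> s0; elim: t => [i|a IHa b IHb] /=; [exact: s0|lra]. Qed.

Lemma ev_norm t s : `|ev t s| <= ev t (fun i => `|s i|).
Proof.
elim: t => [//|a IHa b IHb] /=; rewrite normrM (@ger0_norm _ 2^-1) ?invr_ge0//.
by have := ler_normD (ev a s) (ev b s); lra.
Qed.

Lemma ev_cvg (t_ : nat -> dtree) s (l : R) : (forall n, above n (t_ n)) ->
  s i @[i --> \oo] --> l -> ev (t_ n) s @[n --> \oo] --> l.
Proof.
move=> at_ /cvgrPdist_le sl; apply/cvgrPdist_le => e e0; have [n0 _ H] := sl e e0.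
exists n0 => // n /= n0n; have at0 := above_le n0n (at_ n).
have h1 := ev_le at0 (s := s) (s' := fun=> l + e).
have h2 := ev_le at0 (s := fun=> l - e) (s' := s).
rewrite !ev_cst in h1 h2; apply/ler_normlP; split.
  suff : ev (t_ n) s <= l + e by lra.
  by apply: h1 => i /H /= /ler_normlP[]; lra.
suff : l - e <= ev (t_ n) s by lra.
by apply: h2 => i /H /= /ler_normlP[]; lra.
Qed.

Lemma ev_sum (J : Type) (r : seq J) t (f : nat -> J -> R) :
  ev t (fun i => \sum_(j <- r) f i j) = \sum_(j <- r) ev t (f ^~ j).
Proof.
elim: r => [|j r IH].
  by rewrite big_nil (ev_eq t (s' := fun=> 0)) ?ev_cst// => i; rewrite big_nil.
by rewrite big_cons -IH -evD; apply: ev_eq => i; rewrite big_cons.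
Qed.

(** Only the averages of [s] converge, not [s] itself; the convergence of [w] makes up for it. In
    the error term [s i * (w i - k)] the second factor is uniformly small on the tail used by
    [t_ n], and nonnegativity of [s] lets its bounded averages control the first. *)
Lemma ev_prod_cvg (t_ : nat -> dtree) s (w : nat -> R) (l k : R) :
  (forall n, above n (t_ n)) -> (forall i, 0 <= s i) ->
  ev (t_ n) s @[n --> \oo] --> l -> w i @[i --> \oo] --> k ->
  ev (t_ n) (fun i => s i * w i) @[n --> \oo] --> l * k.
Proof.
move=> at_ s0 sl wk.
have E n : ev (t_ n) (fun i => s i * w i) =
    ev (t_ n) s * k + ev (t_ n) (fun i => s i * (w i - k)).
  by rewrite -evZr -evD; apply: ev_eq => i; ring.
rewrite (_ : (fun n => _) = fun n => ev (t_ n) s * k +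
  ev (t_ n) (fun i => s i * (w i - k))); last exact/funext.
rewrite -[X in _ --> X]addr0; apply: cvgD.
  by apply: cvgM => //; exact: cvg_cst.
apply/cvgr0Pnorm_le => e e0; have l1 : 0 < `|l| + 1 by rewrite ltr_wpDl.
have e1 : 0 < e / (`|l| + 1) by rewrite divr_gt0.
have /cvgrPdist_le/(_ 1 ltr01)[n1 _ P1] := sl.
have /cvgrPdist_le/(_ _ e1)[n2 _ P2] := wk.
exists (maxn n1 n2) => // n /=; rewrite geq_max => /andP[/P1/= n1n n2n].
apply: le_trans (ev_norm _ _) _.
apply: (@le_trans _ _ (ev (t_ n) (fun i => s i * (e / (`|l| + 1))))).
  apply: (ev_le (above_le n2n (at_ n))) => i /P2/= h.
  by rewrite normrM ger0_norm// distrC ler_wpM2l.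
rewrite evZr mulrA ler_pdivrMr// mulrC ler_pM2l//.
by move: n1n => /ler_normlP[]; have := ler_norm l; lra.
Qed.

(** Jensen's inequality for dyadic weights. The real majorants [G] are what gets averaged, as [psi]
    may take the value [+oo]. *)
Lemma ev_convex (psi : R -> \bar R) n t s (G : nat -> R) : econvex psi ->
  (forall y, 0 <= psi y)%E ->
  above n t -> (forall i, (n <= i)%N -> (psi (s i) <= (G i)%:E)%E) ->
  (psi (ev t s) <= (ev t G)%:E)%E.
Proof.
move=> cpsi p0 + sG; elim: t => [i|a IHa b IHb] /=; first exact: sG.
move=> /andP[/IHa {}IHa /IHb {}IHb].
have h : 0 <= (2^-1 : R) <= 1 by apply/andP; split; lra.
have := cpsi 2^-1 (ev a s) (ev b s) h.
rewrite (_ : 2^-1 * ev a s + _ = (ev a s + ev b s) / 2); last by field.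
move=> /le_trans; apply.
rewrite (_ : (ev a G + ev b G) / 2 = 2^-1 * ev a G + (1 - 2^-1) * ev b G); last by field.
rewrite [leRHS]EFinD !EFinM; apply: leeD; apply: lee_wpmul2l => //; rewrite lee_fin; lra.
Qed.

End convex_combinations.

Section combinations_of_functions.
Context d {T : measurableType d} {R : realType}.
Variables (mu : {measure set T -> \bar R}) (D : set T).
Hypothesis mD : measurable D.

Local Notation I f := (Rintegral mu D f).

Lemma ev_rintegrable t (f : nat -> T -> R) : (forall i, rintegrable mu D (f i)) ->
  rintegrable mu D (fun x => ev t (f ^~ x)).
Proof.
move=> fi; elim: t => [i|a IHa b IHb] /=; first exact: fi.
under eq_fun do rewrite mulrC.
by apply: rintegrableZ => //; exact: rintegrableD.
Qed.

Lemma ev_Rintegral t (f : nat -> T -> R) : (forall i, rintegrable mu D (f i)) ->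
  I (fun x => ev t (f ^~ x)) = ev t (fun i => I (f i)).
Proof.
move=> fi; elim: t => [i|a IHa b IHb] //=.
have ia := ev_rintegrable a fi; have ib := ev_rintegrable b fi.
by rewrite RintegralZr//; [rewrite RintegralD// IHa IHb|exact: rintegrableD].
Qed.

Lemma ev_measurable t (f : nat -> T -> R) : (forall i, measurable_fun D (f i)) ->
  measurable_fun D (fun x => ev t (f ^~ x)).
Proof.
move=> mf; elim: t => [i|a IHa b IHb] /=; first exact: mf.
by apply: measurable_funM => //; exact: measurable_funD.
Qed.

Lemma ev_L2 t (f : nat -> T -> R) : (forall i, L2 mu D (f i)) ->
  L2 mu D (fun x => ev t (f ^~ x)).
Proof.
move=> Lf; elim: t => [i|a IHa b IHb] /=; first exact: Lf.
under eq_fun do rewrite mulrC.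
by apply: L2Z => //; exact: L2D.
Qed.

(** Parallelogram identity; the subtracted term is the gain that makes minimizing sequences
    Cauchy. *)
Lemma sqn_midpoint f g : L2 mu D f -> L2 mu D g ->
  sqn mu D (fun x => (f x + g x) / 2) =
  (sqn mu D f + sqn mu D g) / 2 - sqn mu D (fun x => f x - g x) / 4.
Proof.
move=> Lf Lg; have e1 := sqnDZ mD 1 Lf Lg; have e2 := sqnDZ mD (-1) Lf Lg.
rewrite (_ : sqn mu D (fun x => (f x + g x) / 2) =
    2^-1 ^+ 2 * sqn mu D (fun x => f x + 1 * g x)); last first.
  rewrite -sqnZ//; last by apply: L2D => //; exact: L2Z.
  by apply: eq_Rintegral => x _; congr (_ ^+ 2); ring.
rewrite (_ : sqn mu D (fun x => f x - g x) = sqn mu D (fun x => f x + -1 * g x)).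
  by rewrite e1 e2; field.
by apply: eq_Rintegral => x _; rewrite mulN1r.
Qed.

Lemma sqn_ev_le n t (f : nat -> T -> R) K : above n t -> (forall i, L2 mu D (f i)) ->
  (forall i, (n <= i)%N -> sqn mu D (f i) <= K) -> sqn mu D (fun x => ev t (f ^~ x)) <= K.
Proof.
move=> + Lf fK; elim: t => [i|a IHa b IHb] /=; first exact: fK.
move=> /andP[/IHa {}IHa /IHb {}IHb]; rewrite sqn_midpoint; [|exact: ev_L2|exact: ev_L2].
by have := sqn_ge0 mu D (fun x => ev a (f ^~ x) - ev b (f ^~ x)); lra.
Qed.

End combinations_of_functions.

(** * Selection of convergent combinations *)

Section selection.
Context d {T : measurableType d} {R : realType}.
Variables (mu : {measure set T -> \bar R}) (D : set T).
Hypotheses (mD : measurable D) (Doo : (mu D < +oo)%E).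

Local Notation I f := (Rintegral mu D f).
Local Notation "'aeD' x , P" := {ae mu, forall x, D x -> P}
  (at level 200, x name).

(** Bounded and strictly convex for [s >= 0], so its integral is finite for every measurable [m].
    The absolute value keeps it continuous on the whole line. *)
Definition recip (s : R) : R := (1 + `|s|)^-1.

Lemma recip_den (s : R) : 1 <= 1 + `|s|. Proof. by rewrite lerDl. Qed.

Lemma recip_gt0 s : 0 < recip s.
Proof. by rewrite invr_gt0 (lt_le_trans ltr01 (recip_den s)). Qed.

Lemma recip_le1 s : recip s <= 1.
Proof. by rewrite invf_le1 ?recip_den// (lt_le_trans ltr01 (recip_den s)). Qed.

Lemma recip_continuous : continuous recip.
Proof.
move=> s; apply: cvgV; first by rewrite gt_eqF// (lt_le_trans ltr01 (recip_den s)).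
by apply: cvgD; [exact: cvg_cst|apply: cvg_norm; exact: cvg_id].
Qed.

(** For [a = recip p] and [b = recip q], the left-hand side is their harmonic mean; it lies below
    the arithmetic mean by [(a - b)^2 / (2 (a + b))], and [a + b <= 2]. *)
Lemma recip_midpoint (p q : R) : 0 <= p -> 0 <= q ->
  recip ((p + q) / 2) <= (recip p + recip q) / 2 - (recip p - recip q) ^+ 2 / 4.
Proof.
move=> p0 q0; have a0 := recip_gt0 p; have a1 := recip_le1 p.
have b0 := recip_gt0 q; have b1 := recip_le1 q.
have -> : recip ((p + q) / 2) = 2 * (recip p * recip q) / (recip p + recip q).
  rewrite /recip !ger0_norm//; last by rewrite divr_ge0// addr_ge0.
  by field; rewrite !gt_eqF//; lra.
set a := recip p in a0 a1 *; set b := recip q in b0 b1 *.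
have ab0 : 0 < a + b by lra.
rewrite ler_pdivrMr//.
have -> : ((a + b) / 2 - (a - b) ^+ 2 / 4) * (a + b) =
  2 * (a * b) + (a - b) ^+ 2 / 4 * (2 - (a + b)) by field.
by rewrite lerDl mulr_ge0// ?divr_ge0 ?sqr_ge0//; lra.
Qed.

(* A minimizing sequence of the strictly convex functional
   [t |-> int recip (ev t m) + sum int (ev t g)^2] is Cauchy. *)
Lemma forward_combinations (J : finType) (m : nat -> T -> R) (g : nat -> J -> T -> R) (K : R) :
  (forall i, measurable_fun D (m i)) -> (forall i, aeD x, 0 <= m i x) ->
  (forall i j, L2 mu D (g i j)) -> (forall i j, sqn mu D (g i j) <= K) ->
  exists t_ : nat -> dtree, (forall n, above n (t_ n)) /\
    forall e, 0 < e -> exists n0, forall n p, (n0 <= n)%N -> (n0 <= p)%N ->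
    sqn mu D (fun x => recip (ev (t_ n) (m ^~ x)) - recip (ev (t_ p) (m ^~ x))) <= e /\
    forall j, sqn mu D (fun x => ev (t_ n) (fun i => g i j x) - ev (t_ p) (fun i => g i j x)) <= e.
Proof.
move=> mm m0 Lg gK.
have m0' : aeD x, forall i, 0 <= m i x.
  have : {ae mu, forall x, forall i, D x -> 0 <= m i x} by exact/ae_foralln.
  by apply: filterS => x h Dx i; exact: h.
pose y t x := recip (ev t (m ^~ x)); pose G t j x := ev t (fun i => g i j x).
have mrecip : measurable_fun setT recip by apply: continuous_measurable_fun; exact: recip_continuous.
have my t : measurable_fun D (y t) by apply: measurableT_comp => //; exact: ev_measurable.
have y1 t : aeD x, `|y t x| <= 1.
  by apply: aeW => x _; rewrite ger0_norm ?recip_le1// ltW// recip_gt0.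
have yi t : rintegrable mu D (y t) by exact: (rint_bounded mD Doo (my t) (y1 t)).
have yL t : L2 mu D (y t) by exact: (L2_bounded mD Doo (my t) (y1 t)).
have LG t j : L2 mu D (G t j) by apply: ev_L2 => // i; exact: Lg.
pose Q t := I (y t) + \sum_j sqn mu D (G t j).
have Q0 t : 0 <= Q t.
  rewrite addr_ge0 ?sumr_ge0// => [|j _]; last exact: sqn_ge0.
  by apply: Rintegral_ge0 => x _; rewrite ltW// recip_gt0.
have Qb t : Q t <= fine (mu D) + \sum_(j : J) K.
  rewrite lerD//.
    rewrite -[leRHS]mul1r -Rintegral_cst//; apply: le_Rintegral => //; [exact: yi|exact: (rint_cst mD _ Doo)|].
    by move=> x _; exact: recip_le1.
  by apply: ler_sum => j _; apply: (sqn_ev_le mD (above0 t)).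
have Qmid a b : Q (Node a b) <= (Q a + Q b) / 2 -
    (sqn mu D (fun x => y a x - y b x) + \sum_j sqn mu D (fun x => G a j x - G b j x)) / 4.
  have s1 : I (y (Node a b)) <= (I (y a) + I (y b)) / 2 - sqn mu D (fun x => y a x - y b x) / 4.
    have [_ d2] := L2B mD (yL a) (yL b).
    have i1 := rintegrableD mD (yi a) (yi b).
    have i2 := rintegrableZ mD 2^-1 i1; have i3 := rintegrableZ mD 4^-1 d2.
    have -> : (I (y a) + I (y b)) / 2 - sqn mu D (fun x => y a x - y b x) / 4 =
        I (fun x => 2^-1 * (y a x + y b x) - 4^-1 * (y a x - y b x) ^+ 2).
      rewrite (RintegralB mD i2 i3) (RintegralZl _ mD i1) (RintegralZl _ mD d2).
      by rewrite (RintegralD mD (yi a) (yi b)) /sqn; ring.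
    apply: ae_le_Rintegral => //; first exact: rintegrableB.
    apply: filterS m0' => x m0' Dx; rewrite [2^-1 * _]mulrC [4^-1 * _]mulrC.
    by apply: recip_midpoint; apply: ev_ge0; exact: m0'.
  have s2 : \sum_j sqn mu D (G (Node a b) j) = (\sum_j sqn mu D (G a j) +
      \sum_j sqn mu D (G b j)) / 2 - (\sum_j sqn mu D (fun x => G a j x - G b j x)) / 4.
    rewrite -big_split/= !mulr_suml -sumrB; apply: eq_bigr => j _.
    exact: (sqn_midpoint mD (LG a j) (LG b j)).
  by rewrite /Q s2; lra.
(* The admissible combinations shrink as [n] grows, so the infimum varies with [n]; the supremum of
   these bounded infima takes the place of the minimum value. *)
pose Sn n := [set q | exists t, above n t /\ q = Q t].
have hSn n : has_inf (Sn n).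
  split; first by exists (Q (Leaf n)), (Leaf n); split => //=.
  by exists 0 => _ [t [_ ->]].
pose Jn n := inf (Sn n).
have Jlb n t : above n t -> Jn n <= Q t.
  by move=> at_; apply: ge_inf; [case: (hSn n)|exists t].
have Jub n : Jn n <= fine (mu D) + \sum_(j : J) K.
  by apply: le_trans (Qb (Leaf n)); apply: Jlb => /=.
have Jnd n k : (n <= k)%N -> Jn n <= Jn k.
  move=> nk; apply: lb_le_inf; first by case: (hSn k).
  by move=> _ [t [at_ ->]]; apply: Jlb; exact: above_le at_.
have ch n : {t | above n t /\ Q t <= Jn n + n.+1%:R^-1}.
  apply: cid; have n0 : 0 < n.+1%:R^-1 :> R by rewrite invr_gt0.
  by have [_ [t [at_ ->]] lt] := inf_adherent n0 (hSn n); exists t; split => //; exact: ltW.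
have hJ : has_sup (range Jn).
  split; first by exists (Jn 0%N), 0%N.
  by exists (fine (mu D) + \sum_(j : J) K) => _ [n _ <-].
have Jsup n : Jn n <= sup (range Jn) by apply: ub_le_sup; [case: hJ|exists n].
exists (fun n => sval (ch n)); split => [n|e e0]; first by case: (svalP (ch n)).
have e8 : 0 < e / 8 by rewrite divr_gt0.
have [_ [n1 _ <-] n1P] := sup_adherent e8 hJ.
have /cvgr0Pnorm_le/(_ _ e8)[n2 _ n2P] := @cvg_harmonic R.
exists (maxn n1 n2) => n p; rewrite !geq_max => /andP[n1n n2n] /andP[n1p n2p].
have := n2P n n2n; have := n2P p n2p; rewrite /= !ger0_norm// => hp hn.
have [an Qn] := svalP (ch n); have [ap Qp] := svalP (ch p).
set tn := sval (ch n) in an Qn *; set tp := sval (ch p) in ap Qp *.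
(* The midpoint of both trees lies above [n1], so its value exceeds the supremum minus [e / 8],
   while the two trees are at most the supremum plus [e / 8]. A quarter of the gap is thus at most
   [e / 4]. *)
have := Qmid tn tp; have := Jlb n1 (Node tn tp).
rewrite /= (above_le n1n an) (above_le n1p ap) => /(_ isT) h1 h2.
have h3 := Jsup n; have h4 := Jsup p.
set A := sqn mu D _ in h2; set B := \sum_j _ in h2.
have A0 : 0 <= A by exact: sqn_ge0.
have B0 : 0 <= B by apply: sumr_ge0 => j _; exact: sqn_ge0.
have AB : A + B <= e.
  move: hp hn Qn Qp n1P; set r := n.+1%:R^-1; set r' := p.+1%:R^-1; set S := sup _ in h3 h4 *.
  by lra.
split; first by rewrite -/A; lra.
move=> j; apply: (@le_trans _ _ B); last by lra.
by rewrite /B (bigD1 j)//= lerDl sumr_ge0// => i _; exact: sqn_ge0.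
Qed.

(* Uses only the bound on the integrals of [m i]: by Fatou the combinations cannot
   tend to infinity on a set of positive measure. *)
Lemma recip_cvg (f_ : nat -> T -> R) (y : T -> R) (K : R) :
  (forall n, rintegrable mu D (f_ n)) -> (forall n, aeD x, 0 <= f_ n x) ->
  (forall n, I (f_ n) <= K) -> (aeD x, recip (f_ n x) @[n --> \oo] --> y x) ->
  exists f, [/\ rintegrable mu D f, aeD x, 0 <= f x &
    aeD x, f_ n x @[n --> \oo] --> f x].
Proof.
move=> fi f0 fK fy.
pose L x := limn_einf (fun n => (Num.max 0 (f_ n x))%:E).
have f0' : aeD x, forall i, 0 <= f_ i x.
  have : {ae mu, forall x, forall i, D x -> 0 <= f_ i x} by exact/ae_foralln.
  by apply: filterS => x h Dx i; exact: h.
have mf n : measurable_fun D (f_ n) by exact: rintegrable_measurable (fi n).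
have mL : measurable_fun D L.
  rewrite /L /limn_einf; apply: measurableT_comp => //.
  apply: measurable_fun_limn_esup => n.
  apply/measurable_EFinP; apply: measurableT_comp => //.
  by apply: measurable_maxr => //; exact: mf.
have L0 x : (0 <= L x)%E.
  by apply: limn_einf_ge; apply: nearW => n; rewrite lee_fin le_max lexx.
have LK : (\int[mu]_(x in D) L x <= K%:E)%E.
  by apply: ae_fatou => // e e0; apply: nearW => n; have := fK n; lra.
have Li : mu.-integrable D L.
  apply/integrableP; split => //; under eq_integral do rewrite gee0_abs//.
  exact: le_lt_trans LK (ltry _).
have Lfin := integrable_ae mD Li.
have cv : aeD x, exists l : R, 0 <= l /\ f_ n x @[n --> \oo] --> l.
  apply: filterS3 f0' fy Lfin => x f0x fyx Lx Dx.
  move: (f0x Dx) (fyx Dx) (Lx Dx) => {}f0x {}fyx {}Lx.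
  have yle : 0 <= y x.
    rewrite -(cvg_lim _ fyx)//; apply: limr_ge; first exact: cvgP fyx.
    by apply: nearW => n; rewrite ltW// recip_gt0.
  (* If [y x = 0], the [f_ n x] eventually pass every bound, so the finite [L x] would be at least
     [L x + 1]. *)
  have yn0 : y x != 0.
    apply/eqP => y0; have : ((fine (L x) + 1)%:E <= L x)%E.
      apply: limn_einf_ge; have l0 : 0 <= fine (L x) by rewrite fine_ge0.
      have d0 : 0 < (fine (L x) + 2)^-1 by rewrite invr_gt0; lra.
      rewrite y0 in fyx; have /cvgr0Pnorm_le/(_ _ d0) := fyx.
      apply: filterS => n; rewrite ger0_norm; last by rewrite ltW// recip_gt0.
      rewrite /recip lef_pV2 ?posrE; last 2 first.
      - by rewrite ger0_norm ?f0x//; have := f0x n; lra.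
      - by lra.
      by rewrite ger0_norm ?f0x// lee_fin le_max => h; apply/orP; right; lra.
    by rewrite -(fineK Lx) lee_fin /=; lra.
  have yp : 0 < y x by rewrite lt_neqAle eq_sym yn0.
  have c : f_ n x @[n --> \oo] --> (y x)^-1 - 1.
    have -> : (fun n => f_ n x) = (fun n => (recip (f_ n x))^-1 - 1).
      apply/funext => n; rewrite /recip invrK ger0_norm ?f0x//; lra.
    by apply: cvgB; [apply: cvgV|exact: cvg_cst].
  exists ((y x)^-1 - 1); split => //.
  rewrite -(cvg_lim _ c)//; apply: limr_ge; first exact: cvgP c.
  by apply: nearW => n; exact: f0x.
have ffL : aeD x, f_ n x @[n --> \oo] --> fine (L x) /\ 0 <= fine (L x).
  apply: filterS2 f0' cv => x f0x cvx Dx; have [l [l0 fl]] := cvx Dx.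
  have : (f_ n x)%:E @[n --> \oo] --> l%:E by apply: cvg_EFin => //; exact: nearW.
  move=> /cvg_limn_einf_sup[E _].
  rewrite /L (_ : (fun n => _) = fun n => (f_ n x)%:E) ?E//.
  by apply/funext => n; congr EFin; apply/max_idPr; exact: f0x.
exists (fun x => fine (L x)); split.
- have mfL : measurable_fun D (fun x => fine (L x)) by exact: measurableT_comp.
  have ffL' : aeD x, f_ n x @[n --> \oo] --> fine (L x).
    by apply: filterS ffL => x /[apply] -[].
  have Kb e : 0 < e -> \forall n \near \oo, I (f_ n) <= K + e.
    by move=> e0; apply: nearW => n; have := fK n; lra.
  by have [] := cvg_fatou mD fi f0 mfL ffL' Kb.
- by apply: filterS ffL => x /[apply] -[].
- by apply: filterS ffL => x /[apply] -[].
Qed.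

End selection.

(** * Passage to the limit *)

Section limit_passage.
Context {R : realType} {N : nat}.
Local Notation V := 'rV[R]_N.
Local Notation leb := (@lebesgue_row R N).
Variable Om : set V.
Hypotheses (Om_open : open Om) (Om_bounded : bounded_set Om) (N_gt0 : (0 < N)%N).
Variables (j : V -> R -> R) (c : R) (a : V -> R) (psi : R -> \bar R).
Hypotheses (j_lsc : forall x, Om x -> lower_semicontinuous (fun s => (j x s)%:E))
  (c_ge0 : 0 <= c) (a_L1 : inL1 Om a)
  (j_ge : {ae leb, forall x, Om x -> forall s, a x - c * `|s| ^+ 2 <= j x s})
  (psi_ge0 : forall s, (0 <= psi s)%E) (psi_convex : econvex psi)
  (psi_lsc : lower_semicontinuous psi)
  (psi_superlinear : ((psi s * (s^-1)%:E)%E @[s --> +oo]) --> +oo%E).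
Variable F : (V -> R) -> R.
Hypothesis FH : inHminus1 Om F.
Implicit Types (u v w m : V -> R) (g h : 'I_N -> V -> R).

Local Notation I f := (Rintegral leb Om f).
Local Notation sq u := (sqn leb Om u).
Local Notation "'L2O' u" := (L2 leb Om u) (at level 10, u at level 8).
Local Notation rint f := (rintegrable leb Om f).
Local Notation "'aeO' x , P" := {ae leb, forall x, Om x -> P}
  (at level 200, x name).
Let mOm := measurable_Om Om_open.
Let Ooo := Om_finite Om_open Om_bounded.
Let HL2 u g (H : inH10 Om u g) := H10_L2 Om_open Om_bounded H.
Let HgL2 u g (H : inH10 Om u g) := H10_gL2 Om_open Om_bounded H.
Let ai : rint a. Proof. exact: a_L1. Qed.

Lemma bound_rint u : L2O u -> rint (fun x => a x - c * u x ^+ 2).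
Proof. by move=> [_ ui]; apply: rintegrableB => //; exact: rintegrableZ. Qed.

Lemma bound_Rintegral u : L2O u -> I (fun x => a x - c * u x ^+ 2) = I a - c * sq u.
Proof.
move=> [_ ui]; have ci := rintegrableZ mOm c ui.
by rewrite (RintegralB mOm ai ci) (RintegralZl c mOm ui).
Qed.

(** The strict inequality provides a measurable majorant of the integrand. Its negative part is
    integrable thanks to the lower bound on [j], its positive part because the integral is below
    [y]; being finite a.e., it may then be replaced by a real function. *)
Lemma cost_majorant m u (y : R) : L2O u -> (cost Om j psi m u < y%:E)%E ->
  exists G, [/\ rint G, aeO x, ((j x (u x))%:E + psi (m x) <= (G x)%:E)%E & I G <= y].
Proof.
move=> Lu /ereal_inf_lt[_ [G [mG fG] <-] Gy]; have bi := bound_rint Lu.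
pose b x := a x - c * u x ^+ 2.
have bG : aeO x, ((b x)%:E <= G x)%E.
  apply: filterS2 j_ge fG => x jx fGx Ox; apply: le_trans (fGx Ox).
  rewrite -[leLHS]adde0; apply: leeD => //; rewrite lee_fin.
  by have := jx Ox (u x); rewrite real_normK ?num_real.
have mGn : measurable_fun Om G^\-%E by exact: measurable_funeneg.
have mGp : measurable_fun Om G^\+%E by exact: measurable_funepos.
have Gn : (\int[leb]_(x in Om) G^\- x < +oo)%E.
  have /integrableP[mb bf] := bi; apply: le_lt_trans bf.
  apply: ae_ge0_le_integral => //; first exact: measurableT_comp.
  apply: filterS bG => x bGx Ox; rewrite funenegE ge_max abse_ge0 andbT.
  rewrite leeNl; apply: le_trans (bGx Ox).
  by rewrite leeNl -EFinN lee_fin/= -normrN ler_norm.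
have Gn0 : (0 <= \int[leb]_(x in Om) G^\- x)%E by exact: integral_ge0.
have Gp : (\int[leb]_(x in Om) G^\+ x < +oo)%E.
  rewrite ltNge leye_eq; apply/negP => /eqP Gpy.
  move: Gy; rewrite integralE Gpy; move: Gn Gn0.
  by case: (\int[leb]_(x in Om) G^\- x)%E => [r| |]//= _ _; rewrite ltNge leey.
have Gi : leb.-integrable Om G.
  apply/integrableP; split => //.
  rewrite (_ : (fun x => `|G x|)%E = (fun x => G^\+ x + G^\- x)%E); last first.
    by apply/funext => x; rewrite -/((abse \o G) x) fune_abse.
  by rewrite ge0_integralD// lte_add_pinfty.
have Gfin := integrable_ae mOm Gi.
have GE : aeO x, G x = (fine (G x))%:E.
  by apply: filterS Gfin => x Gx Ox; rewrite fineK// Gx.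
have mfG : measurable_fun Om (fun x => (fine (G x))%:E).
  by apply/measurable_EFinP; exact: measurableT_comp.
have IE : (\int[leb]_(x in Om) G x = \int[leb]_(x in Om) (fine (G x))%:E)%E.
  by apply: ae_eq_integral => //; apply: filterS GE => x h Ox; exact: h.
have fGi : rint (fun x => fine (G x)).
  have /integrableP[_ aG] := Gi; apply/integrableP; split => //.
  rewrite (ae_eq_integral (fun x => `|G x|)%E) //.
  - exact: measurableT_comp.
  - exact: measurableT_comp.
  - by apply: filterS GE => x h Ox /=; rewrite [in RHS]h.
exists (fun x => fine (G x)); split => //.
- by apply: filterS2 fG GE => x fGx GEx Ox; rewrite -GEx// fGx.
- by rewrite -lee_fin -(EFin_Rintegral mOm fGi) -IE ltW.
Qed.

(** Superlinearity in the form that yields uniform integrability: [M] is arbitrary, so up to a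
    constant [m] is an arbitrarily small multiple of any function dominating [psi (m)]. *)
Lemma psi_growth (M : R) : 0 < M -> exists2 s0, 0 <= s0 &
  forall s y, (psi s <= y%:E)%E -> 0 <= y -> s <= s0 + y / M.
Proof.
move=> M0; have /cvgeyPge/(_ M) [A [Ar AP]] := psi_superlinear.
exists (Num.max 0 A); first by rewrite le_max lexx.
move=> s y py y0; case: (leP s (Num.max 0 A)) => [h|].
  by apply: le_trans h _; rewrite lerDl divr_ge0// ltW.
rewrite gt_max => /andP[s0 As]; have := AP s As.
move: py; case: (psi s) (psi_ge0 s) => [p| |]//; rewrite !lee_fin => p0 py.
rewrite ler_pdivlMr// => h.
have : s <= y / M by rewrite ler_pdivlMr// mulrC (le_trans h).
by move=> /le_trans; apply; rewrite lerDr le_max lexx.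
Qed.

Lemma le_ereal_approx (x y : \bar R) :
  (forall z : R, (z%:E < x)%E -> (z%:E <= y)%E) -> (x <= y)%E.
Proof.
move=> H; case: x H => [r| |] H; last by rewrite leNye.
  apply/lee_subgt0Pr => e e0; rewrite -EFinB; apply: H.
  by rewrite lte_fin ltrBlDr ltrDl.
case: y H => [r| |] H //.
  by have := H (r + 1) (ltry _); rewrite lee_fin gerDl => /(lt_le_trans ltr01); rewrite ltxx.
by have := H 0 (ltry _).
Qed.

Lemma ev_H10 (u_ : nat -> V -> R) (g_ : nat -> 'I_N -> V -> R) t :
  (forall i, inH10 Om (u_ i) (g_ i)) ->
  inH10 Om (fun x => ev t (u_ ^~ x)) (fun l x => ev t (fun i => g_ i l x)).
Proof.
move=> Hn; elim: t => [i|p IHp q IHq] /=; first exact: Hn.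
have H1 := H10_lin Om_open Om_bounded 1 IHp IHq.
have H2 := H10_lin Om_open Om_bounded 2^-1 H1 (H10_0 Om_open Om_bounded).
move: H2; congr inH10; first by apply/funext => x; ring.
by apply/funext => l; apply/funext => x; ring.
Qed.

Section minimizing_sequence.
Variables (m_ : nat -> V -> R) (u_ : nat -> V -> R) (g_ : nat -> 'I_N -> V -> R).
Variables (G_ : nat -> V -> R) (K I0 : R) (u : V -> R).
Hypotheses (adm_ : forall i, admissible Om (m_ i))
  (Hn : forall i, inH10 Om (u_ i) (g_ i))
  (mui : forall i, rint (fun x => m_ i x * u_ i x ^+ 2))
  (eqn : forall i v h, inH10 Om v h -> rint (fun x => m_ i x * v x ^+ 2) ->
      gdot Om (g_ i) h + I (fun x => m_ i x * u_ i x * v x) = F v)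
  (nK : forall i, nsq Om (u_ i) (g_ i) <= K)
  (muK : forall i, I (fun x => m_ i x * u_ i x ^+ 2) <= K)
  (Gi : forall i, rint (G_ i))
  (Gge : forall i, aeO x, ((j x (u_ i x))%:E + psi (m_ i x) <= (G_ i x)%:E)%E)
  (IG : forall i, I (G_ i) <= I0 + i.+1%:R^-1)
  (Lu : L2O u) (cu : cvgL2 leb Om u_ u) (uae : aeO x, u_ i x @[i --> \oo] --> u x).

(** The cost majorant minus the lower bound on [j]. It dominates [psi (m_ i)], hence is nonnegative,
    and its integrals are bounded: it serves both the uniform integrability of [m_] and Fatou's
    lemma for the cost. *)
Let k_ i x := G_ i x - (a x - c * u_ i x ^+ 2).

Let ki i : rint (k_ i).
Proof. by apply: rintegrableB => //; apply: bound_rint; exact: HL2 (Hn i). Qed.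

Let Ik i : I (k_ i) = I (G_ i) - I a + c * sq (u_ i).
Proof.
have Lui := HL2 (Hn i).
by rewrite (RintegralB mOm (Gi i) (bound_rint Lui)) bound_Rintegral//; ring.
Qed.

Let psik : aeO x, forall i, (psi (m_ i x) <= (k_ i x)%:E)%E.
Proof.
have : {ae leb, forall x, forall i, Om x ->
    ((j x (u_ i x))%:E + psi (m_ i x) <= (G_ i x)%:E)%E} by exact/ae_foralln.
apply: filterS2 j_ge => x jx Gx Ox i; have := Gx i Ox.
have := jx Ox (u_ i x); rewrite real_normK ?num_real// /k_.
case: (psi (m_ i x)) (psi_ge0 (m_ i x)) => [p| |]//=.
by rewrite -EFinD !lee_fin; lra.
Qed.

Let k0 : aeO x, forall i, 0 <= k_ i x.
Proof.
by apply: filterS psik => x h Ox i; rewrite -lee_fin; exact: le_trans (h Ox i).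
Qed.

Let m0 : aeO x, forall i, 0 <= m_ i x.
Proof.
have : {ae leb, forall x, forall i, Om x -> 0 <= m_ i x}.
  by apply/ae_foralln => i; case: (adm_ i).
by apply: filterS => x h Ox i; exact: h.
Qed.

Let B := I0 + 1 - I a + c * K.

Let IkB i : I (k_ i) <= B.
Proof.
have c0 := c_ge0; rewrite Ik /B; have := IG i.
have i1 : i.+1%:R^-1 <= 1 :> R by rewrite invf_le1// ler1n.
have uK : sq (u_ i) <= K by apply: le_trans (nK i); rewrite lerDl gsq_ge0.
have := ler_wpM2l c0 uK; move: i1; set r := i.+1%:R^-1; lra.
Qed.

Let B0 : 0 <= B.
Proof.
apply: le_trans (IkB 0%N); apply: (ae_Rintegral_ge0 mOm (ki 0%N)).
by apply: filterS k0 => x h Ox; exact: h.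
Qed.

Let K0 : 0 <= K. Proof. exact: le_trans (nsq_ge0 _ _ _) (nK 0%N). Qed.

Let mi i : rint (m_ i). Proof. by case: (adm_ i). Qed.

Let m_growth (M : R) : 0 < M -> exists2 s0, 0 <= s0 &
  aeO x, forall i, m_ i x <= s0 + k_ i x / M.
Proof.
move=> M0; have [s0 s00 H] := psi_growth M0; exists s0 => //.
by apply: filterS2 psik k0 => x px kx Ox i; apply: H; [exact: px|exact: kx].
Qed.

Lemma m_Rintegral_bounded : exists C, forall i, I (m_ i) <= C.
Proof.
have [s0 _ ms] := m_growth ltr01; exists (I (fun=> s0) + B) => i.
have si := rint_cst mOm s0 Ooo; apply: le_trans (lerD (lexx _) (IkB i)).
rewrite -(RintegralD mOm si (ki i)); apply: (ae_le_Rintegral mOm (mi i)).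
  exact: (rintegrableD mOm si (ki i)).
by apply: filterS ms => x h Ox; have := h Ox i; rewrite divr1.
Qed.

Variables (t_ : nat -> dtree) (m : V -> R) (g : 'I_N -> V -> R).
Hypotheses (at_ : forall n, above n (t_ n)) (im : rint m) (mge0 : aeO x, 0 <= m x)
  (cm : aeO x, ev (t_ n) (m_ ^~ x) @[n --> \oo] --> m x)
  (Lg : forall l, L2O (g l))
  (cg : forall l, cvgL2 leb Om (fun n x => ev (t_ n) (fun i => g_ i l x)) (g l)).

Let am : admissible Om m. Proof. by []. Qed.

(** The combinations of [u_] taken from ever later tails still converge to [u] in [L^2], and their
    gradients are the combinations of [g_]; closedness then identifies [g] as the gradient of
    [u]. *)
Let Hu : inH10 Om u g.
Proof.
apply: (H10_closed Om_open Om_bounded (fun n => ev_H10 (t_ n) Hn) Lu Lg) => //.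
apply/cvgr0Pnorm_le => e e0; have /cvgr0Pnorm_le/(_ e e0)[n0 _ H] := cu.
exists n0 => // n /= n0n; rewrite ger0_norm ?sqn_ge0//.
rewrite (_ : sq _ = sq (fun x => ev (t_ n) (fun i => u_ i x - u x))); last first.
  by apply: eq_Rintegral => x _; rewrite evB ev_cst.
apply: (sqn_ev_le mOm (above_le n0n (at_ n)) (f := fun i x => u_ i x - u x)).
  by move=> i; exact: (L2B mOm (HL2 (Hn i)) Lu).
by move=> i /H /=; rewrite ger0_norm ?sqn_ge0.
Qed.

Let mu_meas v : measurable_fun Om v -> measurable_fun Om (fun x => m x * v x ^+ 2).
Proof.
move=> mv; apply: measurable_funM; last exact: measurable_funX.
exact: rintegrable_measurable im.
Qed.

Let prod_cvg (w_ : nat -> V -> R) w : (aeO x, w_ i x @[i --> \oo] --> w x) ->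
  aeO x, ev (t_ n) (fun i => m_ i x * w_ i x) @[n --> \oo] --> m x * w x.
Proof.
move=> cw; apply: filterS3 m0 cm cw => x m0x cmx cwx Ox.
by apply: ev_prod_cvg => //; [exact: m0x|exact: cmx|exact: cwx].
Qed.

Let sqr_cvg : aeO x, u_ i x ^+ 2 @[i --> \oo] --> u x ^+ 2.
Proof. by apply: filterS uae => x h Ox; exact: (cvgM (h Ox) (h Ox)). Qed.

Let muu : rint (fun x => m x * u x ^+ 2).
Proof.
have [mu _] := Lu.
have [] := @cvg_fatou _ _ _ leb Om mOm (fun n x => ev (t_ n) (fun i => m_ i x * u_ i x ^+ 2))
  (fun x => m x * u x ^+ 2) K _ _ (mu_meas mu) (prod_cvg sqr_cvg) _ => //.
- by move=> n; exact: ev_rintegrable.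
- move=> n; apply: filterS m0 => x m0x Ox; apply: ev_ge0 => i.
  by rewrite mulr_ge0 ?sqr_ge0// m0x.
- move=> e e0; apply: nearW => n; rewrite ev_Rintegral//.
  apply: (@le_trans _ _ (ev (t_ n) (fun=> K))); first by apply: (ev_le (above0 _)) => i _; exact: muK.
  by rewrite ev_cst; lra.
Qed.

(** The averaged equation [E] has constant right-hand side [F v]. Its gradient term converges by
    strong convergence in [L^2], its product term by [vitali_Rintegral]. *)
Let eq_bounded v h (Cv : R) : inH10 Om v h -> 0 < Cv -> (forall x, `|v x| <= Cv) ->
  gdot Om g h + I (fun x => m x * u x * v x) = F v.
Proof.
move=> Hv Cv0 vC; have Lv := HL2 Hv; have Lh := HgL2 Hv.
have [mv _] := Lv; have [mu _] := Lu.
have mui_ i : measurable_fun Om (u_ i) by case: (HL2 (Hn i)).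
have mmi i : measurable_fun Om (m_ i) by exact: rintegrable_measurable (mi i).
have miv i : rint (fun x => m_ i x * v x ^+ 2).
  apply: (ae_le_rintegrable mOm _ (rintegrableZ mOm (Cv ^+ 2) (mi i))).
    by apply: measurable_funM => //; exact: measurable_funX.
  apply: filterS m0 => x m0x Ox; rewrite normrM ger0_norm ?m0x// mulrC ler_wpM2r ?m0x//.
  by rewrite normrX ler_sqr ?nnegrE// ltW.
have muvi i := rintegrable_muv Om_open (adm_ i) (mui_ i) mv (mui i) (miv i).
have E n : gdot Om (fun l x => ev (t_ n) (fun i => g_ i l x)) h +
    I (fun x => ev (t_ n) (fun i => m_ i x * (u_ i x * v x))) = F v.
  have -> : gdot Om (fun l x => ev (t_ n) (fun i => g_ i l x)) h =
      ev (t_ n) (fun i => gdot Om (g_ i) h).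
    rewrite /gdot ev_sum; apply: eq_bigr => l _.
    rewrite -(ev_Rintegral mOm _ (f := fun i x => g_ i l x * h l x)).
      by apply: eq_Rintegral => x _; rewrite evZr.
    by move=> i; exact: (L2_mul mOm (HgL2 (Hn i) l) (Lh l)).
  have -> : I (fun x => ev (t_ n) (fun i => m_ i x * (u_ i x * v x))) =
      ev (t_ n) (fun i => I (fun x => m_ i x * u_ i x * v x)).
    rewrite -(ev_Rintegral mOm _ (f := fun i x => m_ i x * u_ i x * v x))//.
    by apply: eq_Rintegral => x _; apply: ev_eq => i; rewrite mulrA.
  rewrite -evD -[RHS](ev_cst (t_ n)); apply: ev_eq => i; exact: eqn.
have c1 := gdot_cvg Om_open (fun n => HgL2 (ev_H10 (t_ n) Hn)) Lg Lh cg.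
have uv : aeO x, u_ i x * v x @[i --> \oo] --> u x * v x.
  by apply: filterS uae => x ux Ox; apply: cvgM; [exact: ux|exact: cvg_cst].
have [|||_ c2] := @vitali_Rintegral _ _ _ leb Om mOm
    (fun n x => ev (t_ n) (fun i => m_ i x * (u_ i x * v x)))
    (fun x => m x * (u x * v x)) Ooo _ _ (prod_cvg uv).
- move=> n; apply: ev_measurable => i.
  by apply: measurable_funM => //; exact: measurable_funM.
- apply: measurable_funM; first exact: rintegrable_measurable im.
  exact: measurable_funM.
- move=> e e0.
  have K1 : 0 < K + 1 by rewrite ltr_wpDl.
  have B1 : 0 < B + 1 by rewrite ltr_wpDl.
  (* [de] makes [Cv * de * K] at most [e / 2], and then [M] makes [Cv * B / (4 * de * M)] at most
     [e / 2]. The added ones keep both positive when [K] or [B] is zero. *)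
  pose de := e / (2 * Cv * (K + 1)).
  have de0 : 0 < de by exact: (divr_gt0 e0 (mulr_gt0 (mulr_gt0 (ltr0Sn _ _) Cv0) K1)).
  pose M := Cv * (B + 1) / (2 * de * e).
  have M0 : 0 < M by exact: (divr_gt0 (mulr_gt0 Cv0 B1) (mulr_gt0 (mulr_gt0 (ltr0Sn _ _) de0) e0)).
  have [s0 s00 ms] := m_growth M0.
  pose r n x := Cv * ev (t_ n) (fun i => de * (m_ i x * u_ i x ^+ 2) +
    (4 * de * M)^-1 * k_ i x).
  have ri i : rint (fun x => de * (m_ i x * u_ i x ^+ 2) + (4 * de * M)^-1 * k_ i x).
    by apply: rintegrableD => //; apply: rintegrableZ.
  have d4 : 0 < 4 * de by rewrite mulr_gt0.
  have d4M : 0 < 4 * de * M by rewrite mulr_gt0.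
  exists (Cv * (s0 / (4 * de))), r; split.
  + exact: (mulr_ge0 (ltW Cv0) (divr_ge0 s00 (ltW d4))).
  + by move=> n; apply: rintegrableZ => //; exact: (ev_rintegrable mOm).
  + move=> n; apply: filterS3 m0 ms k0 => x m0x msx k0x Ox.
    move: (m0x Ox) (msx Ox) (k0x Ox) => {}m0x {}msx {}k0x; split.
      rewrite /r mulr_ge0 ?(ltW Cv0)//; apply: ev_ge0 => i.
      have m0i := m0x i; have k0i := k0x i.
      apply: addr_ge0; first exact: (mulr_ge0 (ltW de0) (mulr_ge0 m0i (sqr_ge0 _))).
      by apply: (mulr_ge0 _ k0i); rewrite invr_ge0 ltW.
    apply: le_trans (ev_norm _ _) _; rewrite /r -mulrDr.
    rewrite -[s0 / _](ev_cst (t_ n)) -evD -evZ; apply: (ev_le (above0 _)) => i _.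
    rewrite !normrM ger0_norm// mulrCA mulrA mulrC.
    apply: ler_pM => //; first by rewrite mulr_ge0.
    rewrite mulrC.
    (* Completing the square in [|u_ i x|] around [(2 * de)^-1]. The term [m_ i x / (4 * de)] is
       next bounded through the growth of [psi], which splits it into a constant and a multiple of
       [k_ i x]. *)
    have h1 : m_ i x * `|u_ i x| <= de * (m_ i x * u_ i x ^+ 2) + m_ i x / (4 * de).
      have -> : de * (m_ i x * u_ i x ^+ 2) + m_ i x / (4 * de) =
          m_ i x * `|u_ i x| + m_ i x * (de * (`|u_ i x| - (2 * de)^-1) ^+ 2).
        rewrite -[u_ i x ^+ 2]real_normK ?num_real//.
        by field; rewrite gt_eqF.
      by rewrite lerDl; exact: (mulr_ge0 (m0x i) (mulr_ge0 (ltW de0) (sqr_ge0 _))).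
    apply: le_trans (le_trans _ h1) _; first by rewrite mulrC.
    rewrite addrCA lerD2l; apply: (@le_trans _ _ ((s0 + k_ i x / M) / (4 * de))).
      by rewrite ler_pM2r ?invr_gt0.
    rewrite le_eqVlt; apply/orP; left; apply/eqP.
    by field; rewrite !gt_eqF.
  + move=> n; rewrite /r RintegralZl//; last exact: (ev_rintegrable mOm).
    rewrite ev_Rintegral//.
    have -> : e = Cv * ev (t_ n) (fun=> e / Cv).
      by rewrite ev_cst mulrCA divff ?mulr1// gt_eqF.
    rewrite ler_pM2l//; apply: (ev_le (above0 _)) => i _.
    rewrite RintegralD//; [|exact: rintegrableZ|exact: rintegrableZ].
    rewrite (RintegralZl de mOm (mui i)) (RintegralZl _ mOm (ki i)).
    have h1 := ler_wpM2l (ltW de0) (muK i).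
    have h2 : (4 * de * M)^-1 * I (k_ i) <= (4 * de * M)^-1 * B.
      by rewrite ler_pM2l ?invr_gt0.
    apply: le_trans (lerD h1 h2) _.
    have -> : (4 * de * M)^-1 * B = e / Cv / 2 * (B / (B + 1)).
      by rewrite /M; field; rewrite !gt_eqF.
    have -> : de * K = e / Cv / 2 * (K / (K + 1)) by rewrite /de; field; rewrite !gt_eqF.
    have q1 : K / (K + 1) <= 1 by rewrite ler_pdivrMr// mul1r lerDl.
    have q2 : B / (B + 1) <= 1 by rewrite ler_pdivrMr// mul1r lerDl.
    have eC : 0 <= e / Cv / 2 by rewrite !divr_ge0// ltW.
    by have := ler_wpM2l eC q1; have := ler_wpM2l eC q2; lra.
have c3 := cvgD c1 c2.
have c4 : (fun=> F v) @ \oo --> gdot Om g h + I (fun x => m x * (u x * v x)).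
  by under eq_fun => n do rewrite -(E n); exact: c3.
have <- := cvg_unique (@Rhausdorff R) c4 (cvg_cst (F v)).
by congr (_ + _); apply: eq_Rintegral => x _; rewrite mulrA.
Qed.

(** Truncations of [v] are bounded, so [eq_bounded] applies to them. They converge to [v] in
    [H^1_0], which handles the gradient term and [F]; the product term is dominated by [|m u v|],
    integrable since [v] lies in [L^2_m]. *)
Let m_state : state Om F m u.
Proof.
apply/(stateP Om_open Om_bounded F u am); exists g; split => // v h Hv mvv.
pose e_ n : R := n.+1%:R^-1; have e0 : e_ n @[n --> \oo] --> 0 by exact: cvg_harmonic.
have ep n : 0 < e_ n by rewrite invr_gt0.
have Ht n := H10_trunc Om_open Om_bounded (e_ n) Hv.
have [c1 c2] := H10_trunc_cvg Om_open Om_bounded Hv e0.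
have [mv _] := HL2 Hv; have [mu _] := Lu.
have E n : gdot Om g (fun l x => dtrunc (e_ n) (v x) * h l x) +
    I (fun x => m x * u x * trunc (e_ n) (v x)) = F (fun x => trunc (e_ n) (v x)).
  apply: (eq_bounded (Ht n) (Cv := (2 * e_ n)^-1)) => [|x]; last exact: trunc_bounded.
  by rewrite invr_gt0; exact: (mulr_gt0 (ltr0Sn _ _) (ep n)).
have d1 : gdot Om g (fun l x => dtrunc (e_ n) (v x) * h l x) @[n --> \oo] --> gdot Om g h.
  rewrite gdotC; under eq_fun do rewrite gdotC.
  exact: (gdot_cvg Om_open (fun n => HgL2 (Ht n)) (HgL2 Hv) Lg c2).
have d2 := dual_cvg Om_open Om_bounded FH Ht Hv c1 c2.
have imuv := rintegrable_muv Om_open am mu mv muu mvv.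
have mmu : measurable_fun Om (fun x => m x * u x).
  by apply: measurable_funM => //; exact: rintegrable_measurable im.
have [|||||_ d3] := @dominated_Rintegral _ _ _ leb Om mOm
  (fun n x => m x * u x * trunc (e_ n) (v x)) (fun x => m x * u x * v x)
  (fun x => `|m x * u x * v x|).
- by move=> n; apply: measurable_funM => //; have [] := HL2 (Ht n).
- exact: measurable_funM.
- exact: integrable_norm imuv.
- by apply: aeW => x _; apply: cvgM; [exact: cvg_cst|exact: trunc_cvg].
- by apply: aeW => x _ n; rewrite normrM [leRHS]normrM ler_wpM2l// trunc_le.
have d4 : F (fun x => trunc (e_ n) (v x)) @[n --> \oo] -->
    gdot Om g h + I (fun x => m x * u x * v x).
  by under eq_fun => n do rewrite -(E n); exact: (cvgD d1 d3).
exact: (cvg_unique (@Rhausdorff R) d4 d2).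
Qed.

(** The limit of the bounds on the integrals of [k_], by strong convergence of [u_]. Adding back the
    integral of [a - c u^2] leaves exactly [I0]. *)
Let c' := I0 - I a + c * sq u.

Let k_eventually e : 0 < e -> \forall n \near \oo, I (fun x => ev (t_ n) (k_ ^~ x)) <= c' + e.
Proof.
move=> e0; have c0 := c_ge0; have c1 : 0 < c + 1 by rewrite ltr_wpDl.
have ec : 0 < e / 2 / (c + 1) by rewrite !divr_gt0.
have e2 : 0 < e / 2 by rewrite divr_gt0.
have su := cvgL2_sqn mOm (fun i => HL2 (Hn i)) Lu cu.
have /cvgrPdist_le/(_ _ ec)[n1 _ P1] := su.
have /cvgr0Pnorm_le/(_ _ e2)[n2 _ P2] := @cvg_harmonic R.
exists (maxn n1 n2) => // n /= nn; rewrite ev_Rintegral//.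
rewrite -[c' + e](ev_cst (t_ n)); apply: (ev_le (above_le nn (at_ n))) => i.
rewrite geq_max => /andP[/P1/= h1 /P2/= h2]; rewrite Ik /c'.
have := IG i; move: h2; rewrite ger0_norm//; set r := i.+1%:R^-1 => h2 h3.
have h4 : sq (u_ i) <= sq u + e / 2 / (c + 1) by move/ler_normlP : h1 => [? ?]; lra.
have := ler_wpM2l c0 h4; rewrite mulrDr.
have h5 : c * (e / 2 / (c + 1)) <= e / 2.
  by rewrite mulrCA ler_piMr ?(ltW e2)// ler_pdivrMr// mul1r lerDl.
by lra.
Qed.

Let Kl x := limn_einf (fun n => (Num.max 0 (ev (t_ n) (k_ ^~ x)))%:E).

(** On a late tail, lower semicontinuity of [j] replaces [u_ i x] by [u x] up to [e / 2]. Convexity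
    then bounds [psi] of the combination of the [m_ i x], and lower semicontinuity of [psi] passes
    to [m x]. The other [e / 2] pays for the averages of [u_ i x ^+ 2]. *)
Let m_cost_ae : aeO x,
  ((j x (u x))%:E + psi (m x) <= Kl x + (a x - c * u x ^+ 2)%:E)%E.
Proof.
have Gall : aeO x, forall i, ((j x (u_ i x))%:E + psi (m_ i x) <= (G_ i x)%:E)%E.
  have : {ae leb, forall x, forall i, Om x ->
    ((j x (u_ i x))%:E + psi (m_ i x) <= (G_ i x)%:E)%E} by exact/ae_foralln.
  by apply: filterS => x h Ox i; exact: h.
apply: filterS3 Gall cm uae => x Gx cmx ux Ox.
move: (Gx Ox) (cmx Ox) (ux Ox) => {}Gx {}cmx {}ux.
have c0 := c_ge0; have c1 : 0 < c + 1 by rewrite ltr_wpDl.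
set b := a x - c * u x ^+ 2.
(* A real [z] strictly below [psi (m x)] is exactly what lower semicontinuity handles, and it covers
   the value [+oo] as well. *)
suff H (z : R) : (z%:E < psi (m x))%E -> ((j x (u x) + z - b)%:E <= Kl x)%E.
  rewrite -leeBlDr//; apply: le_ereal_approx => z zx.
  have : ((z + b - j x (u x))%:E < psi (m x))%E.
    move: zx; case: (psi (m x)) (psi_ge0 (m x)) => [p| |]//= _ zx; last exact: ltry.
    by move: zx; rewrite /= !lte_fin; lra.
  by move=> /H; apply: le_trans; rewrite lee_fin; lra.
move=> zx; apply/lee_subgt0Pr => e e0; rewrite -EFinB.
have e3 : 0 < e / 2 by rewrite divr_gt0.
have ec : 0 < e / 2 / (c + 1) by rewrite !divr_gt0.
apply: limn_einf_ge.
have [W1 W1m W1P] := psi_lsc zx.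
have j1 : ((j x (u x) - e / 2)%:E < (j x (u x))%:E)%E by rewrite lte_fin; lra.
have [W2 W2m W2P] := j_lsc Ox j1.
have [n1 _ P1] := cmx _ W1m; have [n2 _ P2] := ux _ W2m.
have u2 : ev (t_ n) (fun i => u_ i x ^+ 2) @[n --> \oo] --> u x ^+ 2.
  by apply: ev_cvg => //; exact: (cvgM ux ux).
have /cvgrPdist_le/(_ _ ec)[n3 _ P3] := u2.
exists (maxn n1 (maxn n2 n3)) => // n /=; rewrite !geq_max => /and3P[n1n n2n n3n].
rewrite lee_fin le_max; apply/orP; right.
have h1 := W1P _ (P1 n n1n).
have h2 : (psi (ev (t_ n) (m_ ^~ x)) <=
    (ev (t_ n) (fun i => G_ i x - (j x (u x) - e / 2)))%:E)%E.
  apply: (ev_convex psi_convex psi_ge0 (above_le n2n (at_ n))) => i n2i.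
  have h3 := W2P _ (P2 i n2i); rewrite lte_fin in h3; have := Gx i.
  case: (psi (m_ i x)) (psi_ge0 (m_ i x)) => [p| |]//= _.
  by rewrite -EFinD !lee_fin; lra.
have := lt_le_trans h1 h2; rewrite lte_fin evB ev_cst => h4.
have E : ev (t_ n) (k_ ^~ x) = ev (t_ n) (G_ ^~ x) - a x + c * ev (t_ n) (fun i => u_ i x ^+ 2).
  by rewrite /k_ evB evB ev_cst evZ; ring.
rewrite E; have := P3 n n3n => /= /ler_normlP[_ h5].
have h6 : u x ^+ 2 - e / 2 / (c + 1) <= ev (t_ n) (fun i => u_ i x ^+ 2) by lra.
have := ler_wpM2l c0 h6; rewrite mulrBr.
have h7 : c * (e / 2 / (c + 1)) <= e / 2.
  by rewrite mulrCA ler_piMr ?(ltW e3)// ler_pdivrMr// mul1r lerDl.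
by rewrite /b; lra.
Qed.

(** By [m_cost_ae] the measurable function [Kl + (a - c u^2)] competes in the upper integral,
    whatever the measurability of the integrand itself. *)
Let m_cost : (cost Om j psi m u <= I0%:E)%E.
Proof.
have evi n : rint (fun x => ev (t_ n) (k_ ^~ x)) by exact: ev_rintegrable.
have mKl : measurable_fun Om Kl.
  rewrite /Kl /limn_einf; apply: measurableT_comp => //.
  apply: measurable_fun_limn_esup => n.
  apply/measurable_EFinP; apply: measurableT_comp => //.
  by apply: measurable_maxr => //; exact: rintegrable_measurable (evi n).
have Kl0 x : (0 <= Kl x)%E.
  by apply: limn_einf_ge; apply: nearW => n; rewrite lee_fin le_max lexx.
have IKl : (\int[leb]_(x in Om) Kl x <= c'%:E)%E.
  apply: (ae_fatou mOm evi) k_eventually => n.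
  by apply: filterS k0 => x h Ox; apply: ev_ge0 => i; exact: h.
have iKl : leb.-integrable Om Kl.
  apply/integrableP; split => //; under eq_integral do rewrite gee0_abs//.
  exact: le_lt_trans IKl (ltry _).
have bi := bound_rint Lu; have [mb _] := Lu.
have mbE : measurable_fun Om (fun x => (a x - c * u x ^+ 2)%:E).
  by apply/measurable_EFinP; exact: rintegrable_measurable bi.
apply: (@le_trans _ _ (\int[leb]_(x in Om) (Kl x + (a x - c * u x ^+ 2)%:E))%E).
  apply: ereal_inf_lbound; exists (fun x => (Kl x + (a x - c * u x ^+ 2)%:E)%E) => //.
  by split => //; exact: emeasurable_funD.
rewrite (integralD mOm iKl bi) (EFin_Rintegral mOm bi) bound_Rintegral//.
apply: le_trans (leeD2r _ IKl) _; rewrite -EFinD lee_fin /c'; lra.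
Qed.

Lemma limit_minimizes : [/\ admissible Om m, state Om F m u & (cost Om j psi m u <= I0%:E)%E].
Proof. by split; [exact: am|exact: m_state|exact: m_cost]. Qed.

End minimizing_sequence.

Lemma minimizing_sequence_limit (m_ u_ G_ : nat -> V -> R) (I0 : R) :
  (forall i, admissible Om (m_ i)) -> (forall i, state Om F (m_ i) (u_ i)) ->
  (forall i, rint (G_ i)) ->
  (forall i, aeO x, ((j x (u_ i x))%:E + psi (m_ i x) <= (G_ i x)%:E)%E) ->
  (forall i, I (G_ i) <= I0 + i.+1%:R^-1) ->
  exists m u, [/\ admissible Om m, state Om F m u & (cost Om j psi m u <= I0%:E)%E].
Proof.
move=> am_ st_ iG Gge IG.
have [K KP] := state_bound Om_open Om_bounded N_gt0 FH.
have /choice[g_ gP] i := KP _ _ (am_ i) (st_ i).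
have Hn i : inH10 Om (u_ i) (g_ i) by case: (gP i).
have nK i : nsq Om (u_ i) (g_ i) <= K by case: (gP i).
have [u [s [Lu ss cu uae]]] := rellich Om_open Om_bounded Hn nK.
(* The accuracies survive the extraction because [i <= s i]. *)
have IGs i : I (G_ (s i)) <= I0 + i.+1%:R^-1.
  apply: le_trans (IG _) _; rewrite lerD2l lef_pV2 ?posrE ?ltr0Sn//.
  by rewrite ler_nat ltnS extract_ge.
pose m' i := m_ (s i); pose g' i := g_ (s i).
have im i : rint (m' i) by case: (am_ (s i)).
have m'0 i : aeO x, 0 <= m' i x by case: (am_ (s i)).
have mm i := rintegrable_measurable (im i).
have Lg i l : L2O (g' i l) := HgL2 (Hn (s i)) l.
have gK i l : sq (g' i l) <= K.
  by apply: le_trans (sq_le_gsq _ _ _) _; apply: le_trans (nK (s i)); rewrite lerDr sqn_ge0.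
have [t_ [at_ tC]] := forward_combinations mOm Ooo mm m'0 Lg gK.
have mrecip : measurable_fun setT (@recip R).
  by apply: continuous_measurable_fun; exact: recip_continuous.
have LE n : L2O (fun x => recip (ev (t_ n) (m' ^~ x))).
  apply: (@L2_bounded _ _ _ _ _ mOm _ 1 Ooo).
    by apply: measurableT_comp => //; exact: ev_measurable.
  by apply: aeW => x _; rewrite ger0_norm ?recip_le1// ltW// recip_gt0.
have [|y [_ _ [r [rs ry]]]] := riesz_fischer mOm LE.
  by move=> e /tC[n0 h]; exists n0 => n p nn np; case: (h n p nn np).
have /choice[g gE] l : exists f, L2O f /\
    cvgL2 leb Om (fun n x => ev (t_ n) (fun i => g' i l x)) f.
  have [|e e0|f [Lf cf _]] := @riesz_fischer _ _ _ leb Om mOm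
    (fun n x => ev (t_ n) (fun i => g' i l x)).
  - by move=> n; exact: ev_L2.
  - by have [n0 h] := tC e e0; exists n0 => n p nn np; have [_] := h n p nn np; exact.
  - by exists f.
(* The second extraction [r], which gives a.e. convergence, still leaves the [n]-th combination
   supported on indices from [n] on. *)
have atr n : above n (t_ (r n)) by exact: (above_le (extract_ge rs n) (at_ (r n))).
have Hs i : inH10 Om (u_ (s i)) (g' i) by exact: Hn.
have [C IC] := @m_Rintegral_bounded m' (fun i => u_ (s i)) g' (fun i => G_ (s i)) K I0
  (fun i => am_ (s i)) Hs (fun i => nK (s i)) (fun i => iG (s i)) (fun i => Gge (s i)) IGs.
have [|||m [mi m0 cm]] := @recip_cvg _ _ _ leb Om mOm
    (fun n x => ev (t_ (r n)) (m' ^~ x)) y C _ _ _ ry.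
- by move=> n; exact: ev_rintegrable.
- move=> n; have : {ae leb, forall x, forall i, Om x -> 0 <= m' i x} by exact/ae_foralln.
  by apply: filterS => x h Ox; apply: ev_ge0 => i; exact: h.
- move=> n; rewrite ev_Rintegral// -[leRHS](ev_cst (t_ (r n))).
  by apply: (ev_le (above0 _)) => i _; exact: IC.
exists m, u; apply: (@limit_minimizes m' (fun i => u_ (s i)) g' (fun i => G_ (s i)) K I0 u
  (fun i => am_ (s i)) Hs _ _ (fun i => nK (s i)) _ (fun i => iG (s i)) (fun i => Gge (s i))
  IGs Lu cu uae (fun n => t_ (r n)) m g atr mi m0 cm (fun l => proj1 (gE l))).
- by move=> i; case: (gP (s i)).
- by move=> i; case: (gP (s i)).
- by move=> i; case: (gP (s i)).
- by move=> l; exact: (cvgL2_comp (extract_cvg rs) (proj2 (gE l))).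
Qed.

(** The states are bounded in [L^2] uniformly in [m], so the integral of [a - c u^2] is bounded
    below. The final [- 1] makes a majorant with a smaller integral contradictory. *)
Lemma cost_bounded_below : exists L : R, forall m u, admissible Om m -> state Om F m u ->
  (L%:E <= cost Om j psi m u)%E.
Proof.
have [K KP] := state_bound Om_open Om_bounded N_gt0 FH.
exists (I a - c * K - 1) => m u am st; rewrite leNgt; apply/negP => lt.
have [g [Hu _ _ nK _]] := KP _ _ am st; have Lu := HL2 Hu.
have [G [iG Gge IG]] := cost_majorant Lu lt.
have : I a - c * sq u <= I G.
  rewrite -bound_Rintegral//; apply: (ae_le_Rintegral mOm (bound_rint Lu) iG).
  apply: filterS2 j_ge Gge => x jx Gx Ox; have := Gx Ox; have := jx Ox (u x).
  rewrite real_normK ?num_real//; case: (psi (m x)) (psi_ge0 (m x)) => [p| |]//=.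
  by rewrite !lee_fin; lra.
have uK : sq u <= K by apply: le_trans nK; rewrite lerDl gsq_ge0.
have c0 := c_ge0; have := ler_wpM2l c0 uK; lra.
Qed.

End limit_passage.

Theorem theorem4p1 (R : realType) (N : nat) (N_gt0 : (0 < N)%N)
  (Om : set 'rV[R]_N) (Om_open : open Om) (Om_bounded : bounded_set Om)
  (j : 'rV[R]_N -> R -> R) (c : R) (a : 'rV[R]_N -> R)
  (j_meas : forall s, lebesgue_measurable_fun Om (j ^~ s))
  (j_lsc : forall x, Om x -> lower_semicontinuous (fun s => (j x s)%:E))
  (c_ge0 : 0 <= c) (a_L1 : inL1 Om a)
  (j_ge : {ae @lebesgue_row R N, forall x, Om x ->
            forall s, a x - c * `|s| ^+ 2 <= j x s})
  (psi : R -> \bar R) (psi_ge0 : forall s, (0 <= psi s)%E)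
  (psi_proper : eproper psi) (psi_convex : econvex psi)
  (psi_lsc : lower_semicontinuous psi)
  (psi_dom : edom psi `<=` [set s | 0 <= s])
  (psi_dom_not_point : forall s, edom psi <> [set s])
  (psi_superlinear : ((psi s * (s^-1)%:E)%E @[s --> +oo]) --> +oo%E)
  (F : ('rV[R]_N -> R) -> R) (F_Hminus1 : inHminus1 Om F) :
  exists m, solution Om F j psi m.
Proof.
pose feasible : set (('rV[R]_N -> R) * ('rV[R]_N -> R)) :=
  [set p | admissible Om p.1 /\ state Om F p.1 p.2].
pose inf := ereal_inf [set cost Om j psi p.1 p.2 | p in feasible].
have inf_le m u : admissible Om m -> state Om F m u -> (inf <= cost Om j psi m u)%E.
  by move=> am st; apply: ereal_inf_lbound; exists (m, u).
have [L LP] := cost_bounded_below Om_open Om_bounded N_gt0 c_ge0 a_L1 j_ge psi_ge0 F_Hminus1.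
have L_inf : (L%:E <= inf)%E.
  by apply: le_ereal_inf_tmp => _ [[m u] [am st] <-]; exact: LP.
(* The lower bound [L] excludes [-oo]; a finite infimum and [+oo] are treated separately. *)
move: inf_le L_inf; case infE : inf => [I0| |] // inf_le _.
- have pick i : exists p, feasible p /\ exists G,
      [/\ rintegrable (@lebesgue_row R N) Om G,
          {ae @lebesgue_row R N, forall x, Om x ->
             ((j x (p.2 x))%:E + psi (p.1 x) <= (G x)%:E)%E} &
          Rintegral (@lebesgue_row R N) Om G <= I0 + i.+1%:R^-1].
    have /ereal_inf_lt[_ [p [am st] <-] lt] : (inf < (I0 + i.+1%:R^-1)%:E)%E.
      by rewrite infE lte_fin ltrDl invr_gt0.
    have [g [Hu _]] := st; exists p; split => //.
    exact: (cost_majorant Om_open a_L1 j_ge psi_ge0 (H10_L2 Om_open Om_bounded Hu) lt).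
  have /choice[p_ pP] := pick; have /choice[G_ GP] i := (pP i).2.
  have [|||||m [u [am st le]]] := @minimizing_sequence_limit R N Om Om_open Om_bounded N_gt0
    j c a psi j_lsc c_ge0 a_L1 j_ge psi_ge0 psi_convex psi_lsc psi_superlinear F F_Hminus1
    (fun i => (p_ i).1) (fun i => (p_ i).2) G_ I0.
  + by move=> i; case: (pP i).1.
  + by move=> i; case: (pP i).1.
  + by move=> i; case: (GP i).
  + by move=> i; case: (GP i).
  + by move=> i; case: (GP i).
  exists m; split => //; exists u => // m' u' am' st'.
  exact: le_trans le (inf_le _ _ am' st').
(* Here every admissible pair has infinite cost, so any pair minimizes; it remains to have one, and
   [m = 0] with its state will do. *)
- have [u st] := state_zero Om_open Om_bounded N_gt0 F_Hminus1.
  exists (fun=> 0); split; first exact: (admissible_cst Om_open Om_bounded).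
  exists u => // m' u' am' st'; apply: le_trans (inf_le _ _ am' st'); exact: leey.
Qed.
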